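(* Let $X_1,X_2,\ldots$ be the growing sequence of random recursive trees defined in the context, on a probability space $(\Omega,\mathcal F,\mathbb P)$; let $\mathrm{IPL}_n$ be the internal path length of $X_n$ and $\mathcal G_n=\sigma(X_1,\dots,X_n)$. Let $\mathrm{IPL}_\infty$ be the almost sure limit of $\frac{\mathrm{IPL}_n-n\log n}{n}$ as $n\to\infty$ (this limit exists). Then $$\mathcal L\left\{\sqrt{\frac{n}{\log n}}\left(\mathrm{IPL}_\infty-\frac{\mathrm{IPL}_n-n\log n}{n}\right)\Bigg|\,\mathcal G_n\right\}$$ converges, as $n\to\infty$, in the almost sure weak sense to the constant kernel $\omega\mapsto\mathcal N_{0,1}$; that is, for $\mathbb P$-almost every $\omega$ these conditional distributions converge weakly on $\mathbb R$ to the standard normal distribution $\mathcal N_{0,1}$.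
   Context: Random recursive trees: $X_1$ is the tree consisting of a single node (the root) labelled $1$. Given $X_1,\dots,X_n$, where $X_n$ is a tree with nodes labelled $1,\dots,n$, choose one of the $n$ nodes of $X_n$ uniformly at random and attach to it a new direct descendant labelled $n+1$; the resulting tree is $X_{n+1}$. The depth of a node is its graph distance to the node labelled $1$; the internal path length $\mathrm{IPL}_n$ is the sum of the depths of all $n$ nodes of $X_n$. $\mathcal L\{X\mid\mathcal G\}$ denotes a (regular) version of the conditional distribution of the real random variable $X$ given the $\sigma$-algebra $\mathcal G$, viewed as a random probability measure on $\mathbb R$. The formula is considered for $n\ge2$. *)

(* Defs.v *)
From HB Require Import structures.
From mathcomp Require Import all_boot all_order all_algebra.
From mathcomp Require Import all_classical all_reals all_analysis.
Import Order.TTheory GRing.Theory Num.Theory.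
Import numFieldNormedType.Exports.

Set Implicit Arguments.
Unset Strict Implicit.
Unset Printing Implicit Defensive.

Local Open Scope classical_set_scope.
Local Open Scope ring_scope.

(* A rooted tree whose n nodes are labelled 1, ..., n in order of insertion,
   stored as the sequence of the parents of the nodes 2, ..., n: the item of
   index i is the parent of the node i + 2.  The empty sequence is the tree
   whose only node is the root 1. *)
Definition rtree := seq nat.

Definition root_tree : rtree := [::].

Definition nnodes (t : rtree) : nat := (size t).+1.

Definition is_node (t : rtree) (v : nat) : bool := (1 <= v <= nnodes t)%N.

(* the new direct descendant of v gets the label nnodes t + 1 *)
Definition attach (t : rtree) (v : nat) : rtree := rcons t v.

(* v is a direct descendant of u *)
Definition child (t : rtree) : rel nat :=
  fun u v => (2 <= v <= nnodes t)%N && (nth 0%N t (v - 2) == u).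

Definition adj (t : rtree) : rel nat :=
  fun u v => child t u v || child t v u.

Definition walk_of_length (t : rtree) (u v k : nat) : bool :=
  [exists p : k.-tuple 'I_(nnodes t).+1,
     path (adj t) u (map val p) && (last u (map val p) == v)].

(* Graph distance: the least k admitting a walk of k edges from u to v; in a
   connected graph with n nodes such a k exists below n. *)
Definition gdist (t : rtree) (u v : nat) : nat :=
  find (walk_of_length t u v) (iota 0 (nnodes t)).

Definition depth (t : rtree) (v : nat) : nat := gdist t 1 v.

Definition ipl (t : rtree) : nat := (\sum_(1 <= v < (nnodes t).+1) depth t v)%N.

(* Generators of G_n = sigma(X_1, ..., X_n), rtree being a countable set with
   the discrete sigma-algebra; X_0 plays no role. *)
Definition history (T : Type) (X : nat -> T -> rtree) (n : nat) : set (set T) :=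
  \bigcup_(k in [set k | (1 <= k <= n)%N])
    preimage_set_system [set: T] (X k) [set: set rtree].

(* In rrt_unif, the node chosen for the attachment is uniform on the nodes of
   X_n conditionally on G_n. *)
Record random_recursive_tree (d : measure_display) (T : measurableType d)
    (R : realType) (P : probability T R) (X : nat -> T -> rtree) : Prop := {
  rrt_meas : forall n (B : set rtree), (1 <= n)%N -> measurable (X n @^-1` B);
  rrt_root : forall w, X 1%N w = root_tree;
  rrt_grow : forall n w, (1 <= n)%N ->
    exists2 v, is_node (X n w) v & X n.+1 w = attach (X n w) v;
  rrt_unif : forall n v (B : set T), (1 <= n)%N -> (1 <= v <= n)%N ->
    <<s history X n >> B ->
    P (B `&` [set w | X n.+1 w = attach (X n w) v]) = (n%:R^-1%:E * P B)%E }.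

Definition ipl_normalized (R : realType) (T : Type) (X : nat -> T -> rtree)
    (n : nat) (w : T) : R :=
  ((ipl (X n w))%:R - n%:R * ln n%:R) / n%:R.

Definition ipl_limit (d : measure_display) (T : measurableType d)
    (R : realType) (P : probability T R) (X : nat -> T -> rtree)
    (L : T -> R) : Prop :=
  {ae P, forall w, ipl_normalized R X n w @[n --> \oo] --> L w}.

(* k is a regular version of the conditional distribution of Z given the
   sigma-algebra generated by G: being a kernel from (T, <<s G >>), it has
   <<s G >>-measurable maps w |-> k w A. *)
Definition regular_cond_distribution (d : measure_display)
    (T : measurableType d) (R : realType) (P : probability T R)
    (Z : T -> R) (G : set (set T))
    (k : R.-pker (g_sigma_algebraType G) ~> (measurableTypeR R)) : Prop :=
  forall (B : set T) (A : set (measurableTypeR R)),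
    <<s G >> B -> measurable A ->
    (\int[P]_(w in B) k w A = P (B `&` Z @^-1` A))%E.

Definition weak_cvg (R : realType)
    (mu : nat -> {measure set (measurableTypeR R) -> \bar R})
    (nu : {measure set (measurableTypeR R) -> \bar R}) : Prop :=
  forall f : R -> R, continuous f -> (exists M : R, forall x, `|f x| <= M) ->
    (\int[mu n]_x (f x)%:E @[n --> \oo] --> \int[nu]_x (f x)%:E)%E.

(* Main.v *)
Require Import Defs.
From HB Require Import structures.
From mathcomp Require Import all_boot all_order all_algebra.
From mathcomp Require Import all_classical all_reals all_analysis.
From mathcomp Require Import measurable_realfun ring lra zify.
Import Order.TTheory GRing.Theory Num.Theory.
Import numFieldNormedType.Exports.
Local Open Scope classical_set_scope.
Local Open Scope ring_scope.
Set Implicit Arguments.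
Unset Strict Implicit.
Unset Printing Implicit Defensive.

(** Notation of this comment: M_n is the mean depth of the nodes of X_n, S_n the
empirical variance of these depths, H_n the n-th harmonic number.

The normalized path length equals M_n - log n.  The process W_n = M_n - H_n is
a martingale: if D is the depth of the node chosen at time n, then
W_(n+1) - W_n = (D - M_n) / (n+1), so that the conditional variance of this
increment is S_n / (n+1)^2.  Moreover S_n - log n stays bounded almost surely.
Hence, conditionally on G_n, the tail of the martingale has variance close to
the sum over k >= n of log n / k^2, that is log n / n, and the theorem is a
central limit theorem for martingale tails.

The sigma-algebra G_n is generated by X_n and has finitely many atoms
[tree_event X n t].  Conditional expectations given X_n = t are therefore
iterates of the operator [step], which averages a function of trees over the
nodes to which the next node may be attached.  Everything probabilistic is
reduced to pointwise inequalities of the form F <= V - step V between functions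
of trees with V >= 0: they telescope along the growth
([Rintegral_superharmonic]) and give a maximal inequality
([maximal_inequality]).  Conditioning on an atom only changes the tree from
which one starts.

The potentials V are assembled from [exp_depth], the mean of (3/2)^depth over
the nodes.  It dominates the moments of order at most four of the depths, and
divided by the square root of n it is superharmonic, hence bounded along
almost every path.  Three consequences of the maximal inequality are used: this
bound, the almost sure convergence of W_n ([martingale_ae_cauchy],
[ae_cvg_normalized]) and the boundedness of S_n - log n ([ae_regular]).

The central limit theorem itself is Lindeberg's argument for the functions
cos (theta x + beta).  With c_n = sqrt (n / log n), the function
exp (- theta^2 (n/k) / 2) cos (theta c_n (W_k - W_n) + beta) of X_k, k >= n,
solves the heat equation in the deterministic clock n/k, the variance that
should remain after time k; [step_char_wave] bounds its defect of harmonicity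
by the decrement of a potential whose value at time n is O(1 / log n).  This
gives the convergence of the trigonometric integrals of the conditional laws
([kernel_cos_bound]), and the maximal inequality gives their tightness
([kernel_tail_bound]).  The passage to all bounded continuous test functions is
[weak_cvg_of_cos]; the Gaussian integrals are computed in [normal_cos]. *)

(** * Approximation by polynomials in the sine *)

Lemma unit_interval_unif_continuous (R : realType) (F : R -> R) (e : R) :
  continuous F -> 0 < e ->
  exists2 dlt : R, 0 < dlt & forall x y : R, 0 <= x <= 1 -> `|x - y| < dlt ->
    `|F x - F y| <= e.
Proof.
move=> cF e0.
have cov : \forall dl \near 0^'+, `[(0:R), 1]%classic `<=`
    (fun x => forall y, `|x - y| < dl -> `|F x - F y| <= e).
  have ncov := (compact_near_coveringP _).1 (@segment_compact R 0 1).
  apply: (ncov R (0^'+)) => x _.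
  have e20 : 0 < e / 2 by rewrite divr_gt0.
  have /cvgrPdist_lt/(_ _ e20) := cF x.
  rewrite -nbhs_nearE => /nbhs_ballP[r /= r0 hr].
  have r20 : 0 < r / 2 by rewrite divr_gt0.
  near=> z dl => /= y zy.
  have xz : `|x - z| < r / 2 by near: z; apply: nbhsx_ballx.
  have dlr : dl < r / 2 by near: dl; apply: nbhs_right_lt.
  have -> : F z - F y = (F x - F y) - (F x - F z) by ring.
  rewrite (le_trans (ler_normB _ _))// [leRHS]splitr lerD// ltW//; apply: hr.
    rewrite /ball/= (_ : x - y = (x - z) + (z - y)); last by ring.
    by rewrite (le_lt_trans (ler_normD _ _))// [ltRHS]splitr ltrD// (lt_trans zy).
  by rewrite /ball/= (lt_trans xz)// ltr_pdivrMr// ltr_pMr// ltr1n.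
near ((0:R)^'+) => dl; exists dl; first by near: dl; apply: nbhs_right_gt.
move=> x y x01; apply: (near cov dl) => //.
Unshelve. all: by end_near. Qed.

(** The mean of g after N steps, each +1 with probability y and 0
otherwise, of a walk started at s.  For s = 0 this is the Bernstein polynomial
of g, in a form for which its properties follow by induction on N. *)
Fixpoint walk_mean (R : realType) (y : R) (g : nat -> R) (N s : nat) : R :=
  if N is N'.+1 then y * walk_mean y g N' s.+1 + (1 - y) * walk_mean y g N' s
  else g s.

Lemma walk_mean_affine (R : realType) (y : R) (g : nat -> R) (a b : R) N s :
  walk_mean y (fun k => a + b * g k) N s = a + b * walk_mean y g N s.
Proof. by elim: N s => //= N IH s; rewrite !IH; ring. Qed.

Lemma walk_mean_le (R : realType) (y : R) (g h : nat -> R) N s M :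
  0 <= y <= 1 -> (N + s <= M)%N -> (forall k, (k <= M)%N -> g k <= h k) ->
  walk_mean y g N s <= walk_mean y h N s.
Proof.
move=> /andP[y0 y1]; elim: N s => /= [s sM|N IH s sM] gh; first exact: gh.
apply: lerD; apply: ler_wpM2l; rewrite ?subr_ge0//; apply: IH => //; lia.
Qed.

(** Bias and variance of the binomial law. *)
Lemma walk_mean_sqr (R : realType) (y c : R) N s :
  walk_mean y (fun k => (k%:R - c) ^+ 2) N s =
    (s%:R + N%:R * y - c) ^+ 2 + N%:R * y * (1 - y).
Proof.
elim: N s => [|N IH] s /=; first by ring.
by rewrite !IH -!natr1; ring.
Qed.

(** Bernstein's proof of the Weierstrass theorem: uniform continuity
bounds the error by e/2 near y, and the variance y (1 - y) / N controls the
contribution of the points away from y. *)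
Lemma walk_mean_approx (R : realType) (F : R -> R) (M e : R) :
  continuous F -> (forall x, `|F x| <= M) -> 0 < e ->
  exists N : nat, forall y : R, 0 <= y <= 1 ->
    `|walk_mean y (fun k => F (k%:R / N%:R)) N 0 - F y| <= e.
Proof.
move=> cF bF e0; have e20 : 0 < e / 2 by rewrite divr_gt0.
have [dl dl0 Hdl] := unit_interval_unif_continuous cF e20.
have M0 : 0 <= M by apply: le_trans (bF 0).
pose K := 2 * M / dl ^+ 2.
have K0 : 0 <= K by apply: divr_ge0; [exact: mulr_ge0|exact: sqr_ge0].
have key (y x : R) : 0 <= y <= 1 -> `|F x - F y| <= e / 2 + K * (x - y) ^+ 2.
  move=> y01; have [lt_dl|ge_dl] := ltP `|y - x| dl.
    by rewrite distrC (le_trans (Hdl _ _ y01 lt_dl))// lerDl; apply: mulr_ge0 => //; exact: sqr_ge0.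
  have : `|F x - F y| <= 2 * M.
    by rewrite (le_trans (ler_normB _ _))// mulrDl mul1r lerD.
  move=> /le_trans; apply; rewrite -[leLHS]add0r lerD ?(ltW e20)//.
  rewrite /K mulrAC ler_pdivlMr ?exprn_gt0// ler_wpM2l ?mulr_ge0//.
  by rewrite -(real_normK (num_real (x - y))) lerXn2r// ?nnegrE// ?(ltW dl0) 1?distrC.
near \oo => N.
have N0 : (0 < N)%N by near: N; exists 1%N.
have KN : K / N%:R <= e / 2.
  rewrite ler_pdivrMr ?ltr0n// mulrC -ler_pdivrMr//.
  by near: N; apply: nbhs_infty_ger.
exists N => y y01; have /andP[y0 y1] := y01.
set g := fun k => _.
have NR0 : N%:R != 0 :> R by rewrite pnatr_eq0 -lt0n.
have hq : walk_mean y (fun k => e / 2 + (K / N%:R ^+ 2) * (k%:R - N%:R * y) ^+ 2) N 0 <= e.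
  rewrite walk_mean_affine walk_mean_sqr [leRHS]splitr lerD//.
  rewrite [X in _ * X](_ : _ = N%:R * (y * (1 - y))); last by ring.
  rewrite [leLHS](_ : _ = K / N%:R * (y * (1 - y))); last by field.
  rewrite (le_trans _ KN)// ler_piMr ?(divr_ge0 K0 (ler0n _ _))//.
  by rewrite mulr_ile1// ?subr_ge0// gerBl.
have gk k : `|g k - F y| <= e / 2 + (K / N%:R ^+ 2) * (k%:R - N%:R * y) ^+ 2.
  rewrite [X in _ <= _ + X](_ : _ = K * (k%:R / N%:R - y) ^+ 2); first exact: key.
  by field.
have hw (a : R) : walk_mean y (fun k => - F y + a * g k) N 0 =
   - F y + a * walk_mean y g N 0 := walk_mean_affine _ _ _ _ _ _.
rewrite ler_norml; apply/andP; split.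
  rewrite lerNl opprB.
  have -> : F y - walk_mean y g N 0 = walk_mean y (fun k => F y + (- 1) * g k) N 0.
    by rewrite walk_mean_affine; ring.
  apply: le_trans hq; apply: (@walk_mean_le _ _ _ _ _ _ N) => //; first by rewrite addn0.
  move=> k _; apply: le_trans (gk k); rewrite mulN1r distrC; exact: ler_norm.
have -> : walk_mean y g N 0 - F y = walk_mean y (fun k => - F y + 1 * g k) N 0.
  by rewrite walk_mean_affine; ring.
apply: le_trans hq; apply: (@walk_mean_le _ _ _ _ _ _ N) => //; first by rewrite addn0.
by move=> k _; apply: le_trans (gk k); rewrite mul1r addrC; exact: ler_norm.
Unshelve. all: by end_near. Qed.

(** * Weak convergence from trigonometric integrals *)

Lemma bounded_fun_integrable d (T : measurableType d) (R : realType)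
    (mu : {measure set T -> \bar R}) (D : set T) (f : T -> R) (M : R) :
  measurable D -> (mu D < +oo)%E -> measurable_fun D f ->
  (forall x, `|f x| <= M) -> mu.-integrable D (EFin \o f).
Proof.
move=> mD muD mf bf; apply: measurable_bounded_integrable => //.
exists M; split; first exact: num_real.
by move=> x Mx y _ /=; rewrite (le_trans (bf y))// ltW.
Qed.

(** The family of frequencies and phases is part of the definition so
that the property is preserved by multiplication by a sine. *)
Definition trig_convergent (R : realType)
    (mu : nat -> {measure set (measurableTypeR R) -> \bar R})
    (nu : {measure set (measurableTypeR R) -> \bar R}) (h : R -> R) : Prop :=
  [/\ measurable_fun setT h, exists M, forall x, `|h x| <= M &
   forall a b : R, \int[mu n]_x (h x * cos (a * x + b)) @[n --> \oo] -->
     \int[nu]_x (h x * cos (a * x + b))].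

Lemma measurable_cos_affine (R : realType) (a b : R) :
  measurable_fun (setT : set R) (fun x : R => cos (a * x + b)).
Proof.
apply: continuous_measurable_fun => x.
apply: continuous_comp; last exact: continuous_cos.
by apply: cvgD; [apply: cvgM; [exact: cvg_cst|exact: cvg_id]|exact: cvg_cst].
Qed.

Lemma measurable_sin_affine (R : realType) (a b : R) :
  measurable_fun (setT : set R) (fun x : R => sin (a * x + b)).
Proof.
rewrite (_ : (fun _ => _) = fun x : R => cos (a * x + (b - pi / 2))).
  exact: measurable_cos_affine.
by apply/funext => x; rewrite addrA cosBpihalf.
Qed.

Section trigonometric_polynomials.
Context (R : realType) (mu : nat -> {measure set (measurableTypeR R) -> \bar R})
  (nu : {measure set (measurableTypeR R) -> \bar R}).
Context (mu1 : forall n, mu n setT = 1%E) (nu1 : nu setT = 1%E).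

Lemma trig_integrable (m : {measure set (measurableTypeR R) -> \bar R}) (h : R -> R)
   (M : R) : m setT = 1%E -> measurable_fun setT h -> (forall x, `|h x| <= M) ->
  forall a b : R, m.-integrable setT (EFin \o (fun x : R => h x * cos (a * x + b))).
Proof.
move=> m1 mh bh a b; apply: (@bounded_fun_integrable _ _ _ _ _ _ M) => //.
- by rewrite m1 ltry.
- by apply: measurable_funM => //; exact: measurable_cos_affine.
- move=> x; rewrite normrM -[leRHS]mulr1; apply: ler_pM => //; exact: cos_max.
Qed.

Lemma trig_convergentD (f g : R -> R) (al be : R) :
  trig_convergent mu nu f -> trig_convergent mu nu g ->
  trig_convergent mu nu (fun x => al * f x + be * g x).
Proof.
move=> [mf [Mf bf] cf] [mg [Mg bg] cg]; split.
- by apply: measurable_funD; apply: measurable_funM.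
- exists (`|al| * Mf + `|be| * Mg) => x.
  by rewrite (le_trans (ler_normD _ _))// !normrM lerD// ler_wpM2l.
move=> a b.
have E (m : {measure set (measurableTypeR R) -> \bar R}) : m setT = 1%E ->
    \int[m]_x ((al * f x + be * g x) * cos (a * x + b)) =
    al * \int[m]_x (f x * cos (a * x + b)) + be * \int[m]_x (g x * cos (a * x + b)).
  move=> m1; have fi := trig_integrable m1 mf bf a b.
  have gi := trig_integrable m1 mg bg a b.
  rewrite -!RintegralZl// -RintegralD//.
  + by apply: eq_Rintegral => x _; ring.
  + by have := integrableZl measurableT al fi.
  + by have := integrableZl measurableT be gi.
rewrite E//; under eq_cvg do rewrite E//.
by apply: cvgD; apply: cvgM => //; exact: cvg_cst.
Qed.

(** The product of a sine and a cosine is a sum of two cosines of shifted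
frequencies and phases. *)
Lemma trig_convergent_sin (f : R -> R) (th : R) :
  trig_convergent mu nu f -> trig_convergent mu nu (fun x => sin (th * x) * f x).
Proof.
move=> [mf [Mf bf] cf].
have ms : measurable_fun (setT : set R) (fun x : R => sin (th * x)).
  rewrite (_ : (fun _ => _) = fun x : R => sin (th * x + 0)).
    exact: measurable_sin_affine.
  by apply/funext => x; rewrite addr0.
split.
- exact: measurable_funM.
- exists Mf => x; rewrite normrM -[leRHS]mul1r; apply: ler_pM => //.
  exact: sin_max.
move=> a b.
have E (m : {measure set (measurableTypeR R) -> \bar R}) : m setT = 1%E ->
    \int[m]_x (sin (th * x) * f x * cos (a * x + b)) =
    2^-1 * \int[m]_x (f x * cos ((th + a) * x + (b - pi / 2))) +
    2^-1 * \int[m]_x (f x * cos ((th - a) * x + (- b - pi / 2))).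
  move=> m1; have fi := trig_integrable m1 mf bf.
  rewrite -!RintegralZl// -RintegralD//.
  + apply: eq_Rintegral => x _; rewrite !addrA !cosBpihalf.
    rewrite (_ : (th + a) * x + b = th * x + (a * x + b)); last by ring.
    rewrite (_ : (th - a) * x - b = th * x - (a * x + b)); last by ring.
    by rewrite sinD sinB; field.
  + exact: (integrableZl measurableT 2^-1 (fi _ _)).
  + exact: (integrableZl measurableT 2^-1 (fi _ _)).
rewrite E//; under eq_cvg do rewrite E//.
by apply: cvgD; apply: cvgM => //; exact: cvg_cst.
Qed.

Lemma trig_convergent_walk_mean (th : R) (g : nat -> R) N s :
  trig_convergent mu nu (fun=> 1) ->
  trig_convergent mu nu (fun x => walk_mean ((1 + sin (th * x)) / 2) g N s).
Proof.
move=> h1; elim: N s => [|N IH] s /=.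
  have := trig_convergentD (g s) 0 h1 h1.
  by congr trig_convergent; apply/funext => x; ring.
have h2 k := trig_convergentD 1 1 (IH k) (trig_convergent_sin th (IH k)).
have h3 k := trig_convergentD 1 (- 1) (IH k) (trig_convergent_sin th (IH k)).
have := trig_convergentD (1 / 2) (1 / 2) (h2 s.+1) (h3 s).
by congr trig_convergent; apply/funext => x; field.
Qed.
End trigonometric_polynomials.

Definition tail_set (R : realType) (K : R) : set R := [set x | K < `|x|].

Lemma measurable_tail_set (R : realType) (K : R) : measurable (tail_set K).
Proof.
rewrite (_ : tail_set K = (fun x : R => `|x|) @^-1` `]K, +oo[%classic).
  by rewrite -[X in measurable X]setTI; apply: normr_measurable => //.
by apply/seteqP; split => x /=; rewrite /tail_set/= in_itv/= andbT.
Qed.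

Lemma tail_set_cvg0 (R : realType)
    (nu : {measure set (measurableTypeR R) -> \bar R}) :
  (nu setT < +oo)%E -> (nu (tail_set (n%:R : R)) @[n --> \oo] --> 0)%E.
Proof.
move=> nufin.
have I0 : \bigcap_n tail_set (n%:R : R) = set0.
  rewrite -subset0 => x /(_ (Num.truncn `|x|).+1 I) /=.
  by rewrite /tail_set/= ltNge (ltW (truncnS_gt _)).
rewrite -(measure0 nu) -I0; apply: (@nonincreasing_cvg_mu _ _ _ nu).
- by apply: le_lt_trans nufin; apply: le_measure; rewrite ?inE//; exact: measurable_tail_set.
- by move=> i; exact: measurable_tail_set.
- by rewrite I0; exact: measurable0.
- move=> n m nm; apply/subsetPset => x; rewrite /tail_set/= => /(le_lt_trans _); apply.
  by rewrite ler_nat.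
Qed.

Lemma Rintegral_cvg_integral (R : realType)
    (mu : nat -> {measure set (measurableTypeR R) -> \bar R})
    (nu : {measure set (measurableTypeR R) -> \bar R}) (f : R -> R) (M : R) :
  (forall n, mu n setT = 1%E) -> nu setT = 1%E ->
  continuous f -> (forall x, `|f x| <= M) ->
  \int[mu n]_x f x @[n --> \oo] --> \int[nu]_x f x ->
  (\int[mu n]_x (f x)%:E @[n --> \oo] --> \int[nu]_x (f x)%:E)%E.
Proof.
move=> mu1 nu1 cf bf h.
have fi (m : {measure set (measurableTypeR R) -> \bar R}) : m setT = 1%E ->
    m.-integrable setT (EFin \o f).
  move=> m1; apply: (@bounded_fun_integrable _ _ _ _ _ _ M) => //.
    by rewrite m1 ltry.
  exact: continuous_measurable_fun.
have fin (m : {measure set (measurableTypeR R) -> \bar R}) : m setT = 1%E ->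
    (\int[m]_x (f x)%:E)%E = (\int[m]_x f x)%:E.
  by move=> m1; rewrite /Rintegral fineK//; apply: integrable_fin_num => //; exact: fi.
rewrite fin//; under eq_cvg do rewrite fin//.
by apply: cvg_EFin => //; near=> n.
Unshelve. all: by end_near. Qed.

(** f and p differ by at most e on [-K, K], and by at most 2M on the
complement, whose mass is at most e. *)
Lemma Rintegral_close (R : realType)
    (m : {measure set (measurableTypeR R) -> \bar R}) (f p : R -> R) (K M e : R) :
  m setT = 1%E -> measurable_fun setT f -> measurable_fun setT p ->
  (forall x, `|f x| <= M) -> (forall x, `|p x| <= M) ->
  0 <= e -> (forall x, `|x| <= K -> `|f x - p x| <= e) ->
  (m (tail_set K) <= e%:E)%E ->
  `|\int[m]_x f x - \int[m]_x p x| <= e + 2 * M * e.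
Proof.
move=> m1 mf mp bf bp e0 fp mK.
have M0 : 0 <= M by apply: le_trans (bf 0).
have M20 : 0 <= 2 * M by apply: mulr_ge0.
have mfin : (m setT < +oo)%E by rewrite m1 ltry.
have fi := bounded_fun_integrable measurableT mfin mf bf.
have ppi := bounded_fun_integrable measurableT mfin mp bp.
have mtail := measurable_tail_set K.
have mg : measurable_fun setT (fun x : R => e + 2 * M * \1_(tail_set K) x).
  by apply: measurable_funD => //; apply: measurable_funM => //; exact: measurable_indic.
have bg x : `|e + 2 * M * \1_(tail_set K) x| <= e + 2 * M.
  rewrite ger0_norm ?addr_ge0 ?(mulr_ge0 M20)// lerD2l ler_piMr//.
have gi := bounded_fun_integrable measurableT mfin mg bg.
rewrite -RintegralB//.
apply: (le_trans (le_normr_Rintegral _ _)) => //; first exact: (integrableB measurableT fi ppi).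
have mn : measurable_fun setT (fun x : R => `|f x - p x|).
  by apply: measurableT_comp => //; exact: measurable_funB.
have bn x : `| `|f x - p x| | <= 2 * M.
  by rewrite normr_id (le_trans (ler_normB _ _))// mulrDl mul1r lerD.
have ni := bounded_fun_integrable measurableT mfin mn bn.
apply: (@le_trans _ _ (\int[m]_x (e + 2 * M * \1_(tail_set K) x))).
  apply: le_Rintegral => // x _.
  have [xK|xK] := leP `|x| K.
    by rewrite (le_trans (fp _ xK))// lerDl mulr_ge0.
  rewrite indicE mem_set// mulr1 -[leLHS]add0r lerD//.
  by have := bn x; rewrite normr_id.
have ii : m.-integrable setT (EFin \o (\1_(tail_set K) : R -> R)).
  apply: (@bounded_fun_integrable _ _ _ _ _ _ 1) => //.
  by move=> x; rewrite ger0_norm// indicE; case: (_ \in _).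
rewrite RintegralD//; last 2 first.
  by apply: (@bounded_fun_integrable _ _ _ _ _ _ `|e|).
  exact: (integrableZl measurableT (2 * M) ii).
rewrite RintegralZl// Rintegral_cst// m1 mulr1 lerD2l ler_wpM2l//.
rewrite /Rintegral integral_indic// setIT -[leRHS]/(fine e%:E) fine_le//.
by rewrite ge0_fin_numE// (le_lt_trans mK)// ltry.
Qed.

(** Clamping to [-s, s] with s < 1 keeps away from the end points, where
the arc sine is not differentiable. *)
Lemma continuous_asin_clamp (R : realType) (s : R) : 0 < s < 1 ->
  continuous (fun x : R => asin (Num.max (- s) (Num.min s x))).
Proof.
move=> /andP[s0 s1] x.
apply: (@continuous_comp _ _ _ (fun x : R => Num.max (- s) (Num.min s x)) asin).
  have cc (c : R) : {for x, continuous ((fun=> c) : R -> R)} by exact: cvg_cst.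
  have ci : {for x, continuous (id : R -> R)} by exact: cvg_id.
  exact: (continuous_max (cc (- s)) (continuous_min (cc s) ci)).
apply: continuous_asin; apply/andP; split.
  by rewrite lt_max ltrN2 s1.
rewrite gt_max gt_min s1 andbT /=; lra.
Qed.

(** On [-K, K] the map x |-> sin (x / K) is injective, so there a bounded
continuous f is a continuous function F of this sine.  A Bernstein polynomial
of F is then a trigonometric polynomial which is close to f on [-K, K] and
bounded everywhere; tightness disposes of the rest of the line. *)
Lemma weak_cvg_of_cos (R : realType)
    (mu : nat -> {measure set (measurableTypeR R) -> \bar R})
    (nu : {measure set (measurableTypeR R) -> \bar R}) :
  (forall n, mu n setT = 1%E) -> nu setT = 1%E ->
  (forall a b : R, \int[mu n]_x cos (a * x + b) @[n --> \oo] -->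
     \int[nu]_x cos (a * x + b)) ->
  (forall e : R, 0 < e -> exists K : R,
     \forall n \near \oo, (mu n (tail_set K) <= e%:E)%E) ->
  weak_cvg mu nu.
Proof.
move=> mu1 nu1 hcos tight f cf [M bf].
apply: (@Rintegral_cvg_integral _ _ _ f M) => //.
have M0 : 0 <= M by apply: le_trans (bf 0).
apply/cvgrPdist_le => e e0.
(* the approximation error eta is paid three times, and mass eta in the tails
   costs 2 (M + 1) eta twice; the bound 1 on eta keeps p bounded by M + 1 *)
pose eta := Num.min 1 (e / (3 + 4 * (M + 1))).
have D0 : 0 < 3 + 4 * (M + 1) by lra.
have eta0 : 0 < eta by rewrite lt_min ltr01 divr_gt0.
have eta1 : eta <= 1 by rewrite ge_min lexx.
have etae : 3 * eta + 4 * (M + 1) * eta <= e.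
  by rewrite -mulrDl mulrC -ler_pdivlMr// ge_min lexx orbT.
have [K1 hK1] := tight _ eta0.
have nufin : (nu setT < +oo)%E by rewrite nu1 ltry.
have [K [K0 K1K nuK]] : exists K : R, [/\ 0 < K, K1 <= K & (nu (tail_set K) <= eta%:E)%E].
  have /fine_cvgP[fi /cvgr0Pnorm_le/(_ _ eta0) fl] := tail_set_cvg0 nufin.
  near \oo => n; exists (n%:R : R); split.
  - by rewrite ltr0n; near: n; exists 1%N.
  - by near: n; apply: nbhs_infty_ger.
  - rewrite -[leLHS]fineK; last by near: n.
    by rewrite lee_fin (le_trans (ler_norm _))//; near: n.
pose s := sin (1 : R).
have s01 : 0 < s < 1.
  have ph : 1 < pi / 2 :> R.
    rewrite lt_neqAle pihalf_ge1 andbT; apply/eqP => h1.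
    by have := @cos1_gt0 R; rewrite h1 cos_pihalf ltxx.
  apply/andP; split; first by apply: sin_gt0_pihalf; rewrite ltr01.
  rewrite -[ltRHS](sin_pihalf R) ltr_sin ?in_itv//=; apply/andP; split; lra.
(* y in [0, 1] stands for (1 + sin (x / K)) / 2 *)
pose F (y : R) := f (K * asin (Num.max (- s) (Num.min s (2 * y - 1)))).
have cF : continuous F.
  move=> y; apply: (@continuous_comp _ _ _ (fun y => K * _) f); last exact: cf.
  apply: cvgM; first exact: cvg_cst.
  apply: (@continuous_comp _ _ _ (fun y : R => 2 * y - 1)
    (fun x : R => asin (Num.max (- s) (Num.min s x)))).
    by apply: cvgB; [apply: cvgM; [exact: cvg_cst|exact: cvg_id]|exact: cvg_cst].
  exact: continuous_asin_clamp.
have [N HN] := walk_mean_approx cF (fun y => bf _) eta0.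
pose y (x : R) := (1 + sin (K^-1 * x)) / 2.
have y01 x : 0 <= y x <= 1.
  have := sin_le1 (K^-1 * x); have := sin_geN1 (K^-1 * x).
  rewrite /y; move: (sin _) => z ? ?; apply/andP; split; lra.
pose p (x : R) := walk_mean (y x) (fun k => F (k%:R / N%:R)) N 0.
have [mp _ pcvg] : trig_convergent mu nu p.
  apply: trig_convergent_walk_mean => //; split => //.
    by exists 1 => x; rewrite normr1.
  move=> a b.
  have E (m : {measure set (measurableTypeR R) -> \bar R}) :
      \int[m]_x (1 * cos (a * x + b)) = \int[m]_x cos (a * x + b).
    by apply: eq_Rintegral => x _; rewrite mul1r.
  by rewrite E; under eq_cvg do rewrite E; exact: hcos.
have bp x : `|p x| <= M + 1.
  rewrite -[p x](subrK (F (y x))) (le_trans (ler_normD _ _))// addrC lerD//.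
    exact: bf.
  by rewrite (le_trans (HN _ (y01 x))).
have bf1 x : `|f x| <= M + 1 by rewrite (le_trans (bf x))// lerDl.
have fp x : `|x| <= K -> `|f x - p x| <= eta.
  move=> xK; suff -> : f x = F (y x) by rewrite distrC HN.
  rewrite /F /y; congr f.
  have -> : 2 * ((1 + sin (K^-1 * x)) / 2) - 1 = sin (K^-1 * x) by field.
  have xK1 : `|K^-1 * x| <= 1.
    by rewrite normrM gtr0_norm ?invr_gt0// ler_pdivrMl// mulr1.
  have ph := @pihalf_ge1 R.
  move: xK1; rewrite ler_norml => /andP[l1 l2].
  have i1 : K^-1 * x \in `[- (pi / 2), pi / 2].
    by rewrite in_itv/=; apply/andP; split; lra.
  have i2 : (1:R) \in `[- (pi / 2), pi / 2].
    by rewrite in_itv/=; apply/andP; split; lra.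
  have i3 : (- 1:R) \in `[- (pi / 2), pi / 2].
    by rewrite in_itv/=; apply/andP; split; lra.
  have -> : Num.min s (sin (K^-1 * x)) = sin (K^-1 * x).
    by apply/min_idPr; rewrite leNgt ltr_sin// -leNgt.
  have -> : Num.max (- s) (sin (K^-1 * x)) = sin (K^-1 * x).
    by apply/max_idPr; rewrite -sinN leNgt ltr_sin// -leNgt.
  by rewrite sinK// mulrA divff ?mul1r// gt_eqF.
have mf := continuous_measurable_fun cf.
have pc : \int[mu n]_x p x @[n --> \oo] --> \int[nu]_x p x.
  have := pcvg 0 0.
  have E (m : {measure set (measurableTypeR R) -> \bar R}) :
      \int[m]_x (p x * cos (0 * x + 0)) = \int[m]_x p x.
    by apply: eq_Rintegral => x _; rewrite mul0r addr0 cos0 mulr1.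
  by rewrite E; under eq_cvg do rewrite E.
move/cvgrPdist_le : pc => /(_ _ eta0) pc.
near=> n.
have muK : (mu n (tail_set K) <= eta%:E)%E.
  apply: (@le_trans _ _ (mu n (tail_set K1))); last by near: n.
  apply: le_measure; rewrite ?inE; [exact: measurable_tail_set..|].
  by move=> x; rewrite /tail_set/=; apply: le_lt_trans.
have h1 := Rintegral_close (mu1 n) mf mp bf1 bp (ltW eta0) fp muK.
have h2 := Rintegral_close nu1 mf mp bf1 bp (ltW eta0) fp nuK.
have h3 : `|\int[nu]_x p x - \int[mu n]_x p x| <= eta by near: n.
move: h1 h2 h3; move: (\int[nu]_x p x) (\int[nu]_x f x) (\int[mu n]_x p x) (\int[mu n]_x f x).
move=> A B C D; rewrite !ler_norml => /andP[? ?] /andP[? ?] /andP[? ?].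
by apply/andP; split; lra.
Unshelve. all: by end_near. Qed.

(** * The characteristic function of the normal law *)

(** The density of the normal law is its Radon-Nikodym derivative. *)
Lemma integral_normal_prob (R : realType) (f : R -> \bar R) :
  measurable_fun setT f -> (\int[normal_prob 0 1]_x `|f x| < +oo)%E ->
  (\int[normal_prob 0 1]_x f x =
   \int[lebesgue_measure]_x (f x * (normal_pdf 0 1 x)%:E))%E.
Proof.
move=> mf finf; have dom := @normal_prob_dominates R 0 1.
rewrite -(Radon_Nikodym_change_of_variables dom)//=; last first.
  by apply/integrableP; split.
apply: ae_eq_integral => //.
- by apply: emeasurable_funM => //; apply: (measurable_int lebesgue_measure).
- apply: emeasurable_funM => //=; apply/measurable_EFinP.
  exact: measurable_normal_pdf.
- apply: ae_eqe_mul2l => /=.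
  rewrite Radon_NikodymE//=; case: cid => /= h [h1 h2 h3].
  apply: integral_ae_eq => //=.
  + by apply/measurableT_comp => //; exact: measurable_normal_pdf.
  + by move=> E E01 mE; rewrite -h3.
Qed.

Section normal_characteristic_function.
Context (R : realType).
Implicit Types (x th b : R).
Local Notation mu := (@lebesgue_measure R).
Local Notation phi := (@normal_pdf R 0 1).

Lemma phiE x : phi x = normal_peak 1 * expR (- (x ^+ 2) / 2).
Proof. by rewrite normal_pdfE// /normal_fun subr0 expr1n. Qed.

Lemma is_derive_phi x : is_derive x 1 phi (- x * phi x).
Proof.
rewrite (_ : phi = fun x => normal_peak 1 * expR (- (x ^+ 2) / 2)); last first.
  by apply/funext => y; exact: phiE.
have d1 : is_derive x 1 (fun x : R => - (x ^+ 2) / 2) (- x).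
  by apply: is_derive_eq; rewrite /GRing.scale/=; field.
have d2 : is_derive x 1 (expR \o (fun x : R => - (x ^+ 2) / 2))
    (expR (- (x ^+ 2) / 2) * (- x)).
  exact: is_derive1_comp.
have d3 := @is_deriveZ _ _ _ _ (normal_peak 1 : R) _ _ _ d2.
apply: (@is_derive_eq _ _ _ _ _ _ _ _ d3).
by rewrite /GRing.scale/=; ring.
Qed.

(** Domination by a wider Gaussian: the factor exp (3 x^2 / 8) that this
leaves absorbs |x|.  It makes |x| phi (x) integrable. *)
Lemma norm_idM_phi_le : exists C : R, forall x, `|x| * phi x <= C * normal_pdf 0 2 x.
Proof.
have p1 : 0 < normal_peak 1 :> R by apply: normal_peak_gt0; rewrite oner_eq0.
have p2 : 0 < normal_peak 2 :> R by apply: normal_peak_gt0; rewrite pnatr_eq0.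
exists (8 / 3 * normal_peak 1 / normal_peak 2) => x.
rewrite phiE normal_pdfE ?pnatr_eq0// /normal_fun subr0.
rewrite [leRHS](_ : _ = normal_peak 1 * (8 / 3 * expR (- x ^+ 2 / (2 ^+ 2 *+ 2)))); last first.
  by field; rewrite gt_eqF.
rewrite mulrCA ler_wpM2l ?(ltW p1)//.
have -> : expR (- x ^+ 2 / (2 ^+ 2 *+ 2)) = expR (- x ^+ 2 / 2) * expR (x ^+ 2 * 3 / 8).
  by rewrite -expRD; congr expR; rewrite -mulr_natr; field.
rewrite mulrCA [in leLHS]mulrC ler_wpM2l ?expR_ge0//.
have h : 1 + x ^+ 2 * 3 / 8 <= expR (x ^+ 2 * 3 / 8) by exact: expR_ge1Dx.
have h2 : `|x| <= 1 + x ^+ 2.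
  rewrite -(real_normK (num_real x)); move: `|x| => y.
  have : 0 <= (y - 1 / 2) ^+ 2 by exact: sqr_ge0.
  by rewrite sqrrB => ?; lra.
have := sqr_ge0 x; lra.
Qed.

Lemma phi_integrable (g : R -> R) (C : R) : measurable_fun setT g ->
  (forall x, `|g x| <= C) -> mu.-integrable setT (EFin \o (fun x => g x * phi x)).
Proof.
move=> mg bg.
have C0 : 0 <= C by apply: le_trans (bg 0).
apply: (@le_integrable _ _ _ mu setT _ _ (fun x => (C * phi x)%:E)) => //.
- apply/measurable_EFinP; apply: measurable_funM => //; exact: measurable_normal_pdf.
- move=> x _ /=; rewrite lee_fin normrM (ger0_norm (normal_pdf_ge0 _ _ _)).
  by rewrite [leRHS]ger0_norm ?mulr_ge0 ?normal_pdf_ge0// ler_wpM2r ?normal_pdf_ge0.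
- exact: (integrableZl measurableT C (integrable_normal_pdf 0 1)).
Qed.

Lemma idM_phi_integrable : mu.-integrable setT (EFin \o (fun x => `|x| * phi x)).
Proof.
have [C hC] := norm_idM_phi_le.
apply: (@le_integrable _ _ _ mu setT _ _ (fun x => (C * normal_pdf 0 2 x)%:E)) => //.
- apply/measurable_EFinP; apply: measurable_funM; last exact: measurable_normal_pdf.
  exact: normr_measurable.
- move=> x _ /=; rewrite lee_fin ger0_norm ?mulr_ge0 ?normal_pdf_ge0//.
  by rewrite (le_trans (hC x))// ler_norm.
- exact: (integrableZl measurableT C (integrable_normal_pdf 0 2)).
Qed.

Lemma phi_cvg0 : phi n%:R @[n --> \oo] --> 0.
Proof.
have h : (n%:R ^-1 * (2 * normal_peak 1)) @[n --> \oo] --> (0 : R).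
  rewrite -(mul0r (2 * normal_peak 1)); apply: cvgMl. 
  apply/gtr0_cvgV0; last exact: cvgr_idn.
  by near=> n; rewrite ltr0n; near: n; exists 1%N.
apply: (squeeze_cvgr _ (cvg_cst 0) h); near=> n; rewrite normal_pdf_ge0/=.
have n0 : (0 < n%:R :> R) by rewrite ltr0n; near: n; exists 1%N.
have n1 : (1 <= n%:R :> R) by rewrite ler1n; near: n; exists 1%N.
rewrite phiE [leRHS](_ : _ = normal_peak 1 * (2 / n%:R)); last by ring.
rewrite ler_wpM2l ?normal_peak_ge0//.
rewrite mulNr expRN -[leLHS]mulr1 ler_pdivrMl ?expR_gt0//.
rewrite mulrA.
rewrite ler_pdivlMr// mul1r.
have := @expR_ge1Dx R (n%:R ^+ 2 / 2).
have : n%:R <= n%:R ^+ 2 :> R by rewrite expr2 ler_peMr// ltW.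
lra.
Unshelve. all: by end_near. Qed.

Lemma is_derive_affine (a b x : R) : is_derive x 1 (fun x : R => a * x + b) a.
Proof. by apply: is_derive_eq; rewrite /GRing.scale/=; ring. Qed.

Lemma is_derive_sin_affine_phi (a b x : R) :
  is_derive x 1 (fun x => sin (a * x + b) * phi x)
    (a * (cos (a * x + b) * phi x) - x * sin (a * x + b) * phi x).
Proof.
have d0 := is_derive_affine a b x.
have d1 : is_derive x 1 (sin \o (fun x : R => a * x + b)) (cos (a * x + b) * a).
  exact: is_derive1_comp.
have d2 := is_derive_phi x.
have d3 := is_deriveM d1 d2.
by apply: (@is_derive_eq _ _ _ _ _ _ _ _ d3); rewrite /GRing.scale/=; ring.
Qed.

Let stein_fun (a b x : R) := a * (cos (a * x + b) * phi x) - x * sin (a * x + b) * phi x.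

Let measurable_stein_fun (a b : R) : measurable_fun setT (stein_fun a b).
Proof.
have mc := measurable_cos_affine a b; have ms := measurable_sin_affine a b.
have mp := @measurable_normal_pdf R 0 1.
apply: measurable_funB; apply: measurable_funM => //; exact: measurable_funM.
Qed.

Let continuous_stein_fun (a b : R) : continuous (stein_fun a b).
Proof.
have h : continuous (fun x : R => a * x + b).
  by move=> x; apply: cvgD; [apply: cvgM; [exact: cvg_cst|exact: cvg_id]|exact: cvg_cst].
have cp : continuous phi by apply: continuous_normal_pdf; rewrite oner_eq0.
move=> x; apply: cvgB.
  apply: cvgM; first exact: cvg_cst.
  apply: cvgM; last exact: cp.
  by apply: (continuous_comp (h x)); exact: continuous_cos.
apply: cvgM; last exact: cp.
apply: cvgM; first exact: cvg_id.
by apply: (continuous_comp (h x)); exact: continuous_sin.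
Qed.

Let stein_bound (a x : R) := `|a| * phi x + `|x| * phi x.

Let stein_bound_integrable (a : R) : mu.-integrable setT (EFin \o stein_bound a).
Proof.
rewrite (_ : EFin \o _ = (fun x => (`|a| * phi x)%:E + (`|x| * phi x)%:E)%E).
  apply: integrableD => //; last exact: idM_phi_integrable.
  by apply: (@phi_integrable (fun=> `|a|) `|a|) => // x; rewrite normr_id.
by apply/funext => x; rewrite /stein_bound /= EFinD.
Qed.

Let stein_fun_le (a b x : R) : `|stein_fun a b x| <= stein_bound a x.
Proof.
have p0 := normal_pdf_ge0 0 1 x.
rewrite (le_trans (ler_normB _ _))// !normrM (ger0_norm p0) lerD//.
  by rewrite ler_wpM2l// ler_piMl// cos_max.
by rewrite ler_wpM2r// ler_piMr// sin_max.
Qed.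

Let integral_stein_fun_segment (a b : R) (n : nat) : (0 < n)%N ->
  (\int[mu]_(x in `[(- n%:R)%R, n%:R]) (stein_fun a b x)%:E =
  ((sin (a * n%:R + b) * phi n%:R)%:E - (sin (a * - n%:R + b) * phi (- n%:R))%:E))%E.
Proof.
move=> n0; have n0R : 0 < n%:R :> R by rewrite ltr0n.
have dG (x : R) : is_derive x 1 (fun x => sin (a * x + b) * phi x) (stein_fun a b x).
  exact: is_derive_sin_affine_phi.
have cG (x : R) : {for x, continuous (fun x => sin (a * x + b) * phi x)}.
  apply/differentiable_continuous/derivable1_diffP.
  exact: (@ex_derive _ _ _ _ _ _ _ (dG x)).
apply: (@continuous_FTC2 _ (stein_fun a b) (fun x => sin (a * x + b) * phi x)).
- lra.
- apply: continuous_subspaceT; exact: continuous_stein_fun.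
- split.
  + by move=> x _; exact: (@ex_derive _ _ _ _ _ _ _ (dG x)).
  + apply: cvg_at_right_filter; exact: cG.
  + apply: cvg_at_left_filter; exact: cG.
- by move=> x _; rewrite derive1E; exact: (@derive_val _ _ _ _ _ _ _ (dG x)).
Qed.

(** Stein's identity for the sine: the integrand is the derivative of
sin (a x + b) phi (x), which vanishes at infinity. *)
Lemma stein_sin (a b : R) :
  \int[mu]_x (a * (cos (a * x + b) * phi x) - x * sin (a * x + b) * phi x) = 0.
Proof.
pose D n : set R := `[(- n%:R)%R, n%:R]%classic.
have mD n : measurable (D n) by exact: measurable_itv.
pose g n x := ((stein_fun a b \_ (D n)) x)%:E.
have cvg1 : (\int[mu]_x g n x @[n --> \oo] --> \int[mu]_x (stein_fun a b x)%:E)%E.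
  apply: (@dominated_cvg _ _ _ mu setT measurableT g _ (EFin \o stein_bound a)) => //.
  - move=> n; apply/measurable_EFinP.
    apply/(measurable_restrictT _ (mD n)).
    exact: measurable_funTS.
  - move=> x _; apply: cvg_near_cst.
    near=> n; rewrite /g patchE mem_set//.
    rewrite /D /= in_itv/= -ler_norml; near: n; exact: nbhs_infty_ger.
  - move=> n x _; rewrite /g patchE; case: ifP => _; last first.
      by rewrite abse0 lee_fin (le_trans _ (stein_fun_le a b x)).
    by rewrite lee_fin stein_fun_le.
have cvg0 : (\int[mu]_x g n x @[n --> \oo] --> 0%:E)%E.
  pose h (n : nat) := sin (a * n%:R + b) * phi n%:R - sin (a * - n%:R + b) * phi (- n%:R).
  have hg : \forall n \near \oo, (h n)%:E = (\int[mu]_x g n x)%E.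
    near=> n.
    have n0 : (0 < n)%N by near: n; exists 1%N.
    rewrite /h EFinB -(integral_stein_fun_segment a b n0) integral_mkcond.
    by apply: eq_integral => x _; rewrite restrict_EFin.
  apply: cvg_trans; first exact: (near_eq_cvg hg).
  apply: cvg_EFin; first exact: nearW.
  have phiN x : phi (- x) = phi x by rewrite !phiE sqrrN.
  have h0 : 2 * phi n%:R @[n --> \oo] --> (2 * 0 : R).
    by apply: cvgM; [exact: cvg_cst|exact: phi_cvg0].
  have h0N := cvgN h0.
  rewrite mulr0 in h0 h0N; rewrite oppr0 in h0N.
  have {}h0N : - (2 * phi n%:R) @[n --> \oo] --> (0 : R) by exact: h0N.
  apply: (squeeze_cvgr _ h0N h0); near=> n; rewrite /= /h phiN -mulrBl.
  rewrite -ler_norml normrM (ger0_norm (normal_pdf_ge0 _ _ _)).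
  rewrite ler_wpM2r ?normal_pdf_ge0// (le_trans (ler_normB _ _))//.
  by rewrite (_ : 2 = 1 + 1)// lerD// sin_max.
have := cvg_unique _ cvg1 cvg0; rewrite /Rintegral => -> //.
Unshelve. all: by end_near. Qed.

Lemma cos_phi_integrable (a b : R) :
  mu.-integrable setT (EFin \o (fun x => cos (a * x + b) * phi x)).
Proof.
by apply: (@phi_integrable _ 1); [exact: measurable_cos_affine|move=> x; exact: cos_max].
Qed.

Let psi (b a : R) := \int[mu]_x (cos (a * x + b) * phi x).

(** Differentiation under the integral sign, followed by Stein's identity,
gives the differential equation psi' = - a psi. *)
Let is_derive_psi (b a : R) : is_derive a 1 (psi b) (- a * psi b a).
Proof.
have da (y x : R) : is_derive y 1 (fun a => cos (a * x + b) * phi x)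
    (- x * sin (y * x + b) * phi x).
  have d0 : is_derive y 1 (fun a : R => a * x + b) x.
    by apply: is_derive_eq; rewrite /GRing.scale/=; ring.
  have d1 : is_derive y 1 (cos \o (fun a : R => a * x + b)) (- sin (y * x + b) * x).
    exact: is_derive1_comp.
  have d2 := is_deriveM d1 (is_derive_cst (phi x) y 1).
  by apply: (@is_derive_eq _ _ _ _ _ _ _ _ d2); rewrite /GRing.scale/=; ring.
have p1 (y x : R) : partial1of2 (fun a x => cos (a * x + b) * phi x) y x =
    - x * sin (y * x + b) * phi x.
  by rewrite partial1of2E; exact: (@derive_val _ _ _ _ _ _ _ (da y x)).
have I : `](a - 1), (a + 1)[%classic a by rewrite /= in_itv/=; apply/andP; split; lra.
have H1 x : `](a - 1), (a + 1)[%classic x ->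
  mu.-integrable setT (EFin \o (fun y => cos (x * y + b) * phi y)).
  by move=> _; exact: cos_phi_integrable.
have H2 (x y : R) : `](a - 1), (a + 1)[%classic x -> setT y ->
  derivable (fun a : R => cos (a * y + b) * phi y) x 1.
  by move=> _ _; exact: (@ex_derive _ _ _ _ _ _ _ (da x y)).
have H3 (y : R) : 0 <= `|y| * phi y by rewrite mulr_ge0// normal_pdf_ge0.
have H4 (x y : R) : `](a - 1), (a + 1)[%classic x -> setT y ->
   `|partial1of2 (fun a x => cos (a * x + b) * phi x) x y| <= `|y| * phi y.
  move=> _ _; rewrite p1 !normrM (ger0_norm (normal_pdf_ge0 _ _ _)).
  by rewrite ler_wpM2r ?normal_pdf_ge0// normrN ler_piMr// sin_max.
have D := derivable_under_integral measurableT I H1 H2 H3 idM_phi_integrable H4.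
have E := differentiation_under_integral measurableT I H1 H2 H3 idM_phi_integrable H4.
apply: DeriveDef; first exact: D.
rewrite -derive1E E /=.
under eq_Rintegral do rewrite p1.
have xi : mu.-integrable setT (EFin \o (fun x => x * sin (a * x + b) * phi x)).
  apply: le_integrable (stein_bound_integrable 0) => //.
    apply/measurable_EFinP; have ms := measurable_sin_affine a b.
    by apply: measurable_funM; [exact: measurable_funM|exact: measurable_normal_pdf].
  move=> x _ /=; rewrite lee_fin /stein_bound normr0 mul0r add0r.
  rewrite [leRHS]ger0_norm// !normrM (ger0_norm (normal_pdf_ge0 _ _ _)).
  by rewrite ler_wpM2r ?normal_pdf_ge0// ler_piMr// sin_max.
have := stein_sin a b.
rewrite RintegralB//; last exact: (integrableZl measurableT a (cos_phi_integrable a b)).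
rewrite RintegralZl//; last exact: cos_phi_integrable.
move=> /eqP; rewrite subr_eq0 => /eqP h.
rewrite mulNr /psi h -[RHS]mulN1r -RintegralZl//.
by apply: eq_Rintegral => x _; ring.
Qed.

(** By [is_derive_psi] the function exp (a^2 / 2) psi (a) is constant. *)
Lemma normal_cos (a b : R) :
  \int[normal_prob 0 1]_x cos (a * x + b) = expR (- (a ^+ 2) / 2) * cos b.
Proof.
have -> : \int[normal_prob 0 1]_x cos (a * x + b) = psi b a.
  have mc := measurable_cos_affine a b.
  have fin : (@normal_prob R 0 1 setT < +oo)%E by rewrite probability_setT ltry.
  have /integrableP[_ ifin] := bounded_fun_integrable measurableT fin mc
    (fun x => cos_max (a * x + b)).
  by rewrite /Rintegral integral_normal_prob//; exact/measurable_EFinP.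
have d (x : R) : is_derive x 1 (fun a : R => expR (a ^+ 2 / 2) * psi b a) 0.
  have d0 : is_derive x 1 (fun a : R => a ^+ 2 / 2) x.
    by apply: is_derive_eq; rewrite /GRing.scale/=; field.
  have d1 : is_derive x 1 (expR \o (fun a : R => a ^+ 2 / 2)) (expR (x ^+ 2 / 2) * x).
    exact: is_derive1_comp.
  have d2 := is_deriveM d1 (is_derive_psi b x).
  by apply: (@is_derive_eq _ _ _ _ _ _ _ _ d2); rewrite /GRing.scale/=; ring.
have := is_derive_0_is_cst a 0 d.
rewrite expr0n mul0r expR0 mul1r.
have -> : psi b 0 = cos b.
  rewrite /psi; under eq_Rintegral do rewrite mul0r add0r.
  rewrite RintegralZl//; last exact: integrable_normal_pdf.
  by rewrite /Rintegral integral_normal_pdf mulr1.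
by move=> <-; rewrite mulNr expRN mulKf// gt_eqF// expR_gt0.
Qed.

End normal_characteristic_function.

(** * Depths of the nodes of a recursive tree *)

Section depth_of_nodes.
Local Open Scope nat_scope.

Definition recursive_tree (t : rtree) : bool :=
  all (fun i => 1 <= nth 0 t i <= i.+1) (iota 0 (size t)).

Lemma nnodes_attach t v : nnodes (attach t v) = (nnodes t).+1.
Proof. by rewrite /nnodes size_rcons. Qed.

Lemma recursive_tree_attach t v :
  recursive_tree (attach t v) = recursive_tree t && is_node t v.
Proof.
rewrite /recursive_tree /attach size_rcons -(addn1 (size t)) iotaD cats1 all_rcons andbC; congr (_ && _).
  apply: eq_in_all => i; rewrite mem_iota /= add0n => it.
  by rewrite nth_rcons it.
by rewrite add0n nth_rcons ltnn eqxx.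
Qed.

(** The depths of the nodes 1, 2, ... computed along the insertions: a new
node is one deeper than its parent. *)
Definition depths (t : rtree) : seq nat :=
  foldl (fun ds p => rcons ds (nth 0 ds p.-1).+1) [:: 0] t.

Lemma depths_attach t v :
  depths (attach t v) = rcons (depths t) (nth 0 (depths t) v.-1).+1.
Proof. by rewrite /depths /attach -cats1 foldl_cat. Qed.

Lemma size_depths t : size (depths t) = nnodes t.
Proof.
elim/last_ind: t => // t v IH.
by rewrite -[rcons t v]/(attach t v) depths_attach size_rcons IH nnodes_attach.
Qed.

Lemma nth0_depths t : nth 0 (depths t) 0 = 0.
Proof.
elim/last_ind: t => // t v IH.
by rewrite -[rcons t v]/(attach t v) depths_attach nth_rcons size_depths.
Qed.

Lemma nth_depths t i : recursive_tree t -> i < size t ->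
  nth 0 (depths t) i.+1 = (nth 0 (depths t) (nth 0 t i).-1).+1.
Proof.
elim/last_ind: t => // t v IH.
rewrite -[rcons t v]/(attach t v) recursive_tree_attach => /andP[rt tv].
rewrite depths_attach /attach size_rcons ltnS leq_eqVlt.
have [v1 vn] := andP tv.
move=> /predU1P[->|it].
  rewrite nth_rcons size_depths ltnn eqxx !nth_rcons ltnn eqxx size_depths.
  by rewrite (_ : v.-1 < nnodes t) //; lia.
have /andP[p1 p2] : 1 <= nth 0 t i <= i.+1.
  by move/allP: rt => /(_ i); rewrite mem_iota add0n; apply.
rewrite !nth_rcons !size_depths it.
rewrite (_ : i.+1 < nnodes t) // (_ : (nth 0 t i).-1 < nnodes t); last first.
  by rewrite /nnodes; lia.
exact: IH.
Qed.

Lemma child_depths t u v : recursive_tree t -> child t u v ->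
  [/\ 1 <= u, u < v, v <= nnodes t &
   nth 0 (depths t) v.-1 = (nth 0 (depths t) u.-1).+1].
Proof.
move=> rt /andP[/andP[v2 vn] /eqP tu].
have vt : v - 2 < size t by rewrite /nnodes in vn; lia.
have /andP[p1 p2] : 1 <= nth 0 t (v - 2) <= (v - 2).+1.
  by move/allP: rt => /(_ (v - 2)); rewrite mem_iota add0n; apply.
split => //; [by rewrite -tu|by rewrite -tu; lia|].
by rewrite -tu -nth_depths// (_ : (v - 2).+1 = v.-1) //; lia.
Qed.

(** Adjacent nodes have depths differing by one. *)
Lemma path_adj_depths t u p : recursive_tree t -> path (adj t) u p ->
  nth 0 (depths t) (last u p).-1 <= nth 0 (depths t) u.-1 + size p.
Proof.
move=> rt; elim: p u => [u _|v p IH u] /=; first by rewrite addn0.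
move=> /andP[uv /IH]; move=> /leq_trans; apply.
case/orP: uv => /(child_depths rt)[_ _ _]; lia.
Qed.

(** The walk is obtained by following parents down to the root; as labels
decrease along it, its length is smaller than the number of nodes, the bound up
to which [gdist] searches. *)
Lemma nth_depths_lt t v : recursive_tree t -> is_node t v ->
  nth 0 (depths t) v.-1 < nnodes t /\
  exists p, [/\ path (adj t) 1 p, last 1 p = v,
    size p = nth 0 (depths t) v.-1 & all (fun u => u <= nnodes t) p].
Proof.
move=> rt /andP[v1 vn]; suff: nth 0 (depths t) v.-1 <= v.-1 /\
  exists p, [/\ path (adj t) 1 p, last 1 p = v,
    size p = nth 0 (depths t) v.-1 & all (fun u => u <= nnodes t) p].
  by case=> h ?; split => //; rewrite (leq_ltn_trans h)//; lia.
elim/ltn_ind: v v1 vn => -[//|[|v]] IH _ vn.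
  by split; [rewrite /= nth0_depths|exists [::]; rewrite /= nth0_depths].
have c : child t (nth 0 t v) v.+2 by rewrite /child vn /= subSS subSS subn0.
have [u1 uv _ e] := child_depths rt c.
have [h [p [pp lp sp ap]]] := IH _ uv u1 (leq_trans (ltnW uv) vn).
split; first by rewrite e; lia.
exists (rcons p v.+2); split.
- by rewrite rcons_path pp lp /= /adj c.
- by rewrite last_rcons.
- by rewrite size_rcons sp e.
- by rewrite all_rcons vn.
Qed.

Lemma walk_of_lengthP t u v k :
  reflect (exists p, [/\ size p = k, all (fun w => w <= nnodes t) p,
    path (adj t) u p & last u p = v]) (walk_of_length t u v k).
Proof.
apply: (iffP existsP) => [[p /andP[pp /eqP lp]]|[p [<- ap pp lp]]].
  exists (map val p); split => //; first by rewrite size_map size_tuple.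
  by rewrite all_map; apply/allP => w _ /=; rewrite -ltnS.
pose q : seq 'I_(nnodes t).+1 := map inord p.
have qp : map val q = p.
  rewrite -map_comp -[RHS]map_id; apply/eq_in_map => w wp /=.
  by rewrite inordK// ltnS; exact: (allP ap).
have sq : size q == size p by rewrite size_map.
by exists (Tuple sq); rewrite /= qp pp lp eqxx.
Qed.

Lemma depthE t v : recursive_tree t -> is_node t v ->
  depth t v = nth 0 (depths t) v.-1.
Proof.
move=> rt tv; have [kn [p [pp lp sp ap]]] := nth_depths_lt rt tv.
set k := nth 0 (depths t) v.-1 in kn sp *.
have nk : has (walk_of_length t 1 v) (iota 0 k) = false.
  apply/hasPn => j; rewrite mem_iota add0n /= => jk; apply/negP.
  move=> /walk_of_lengthP[q [sq aq pq lq]].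
  have := path_adj_depths rt pq; rewrite lq -/k.
  rewrite nth0_depths; lia.
have wk : walk_of_length t 1 v k by apply/walk_of_lengthP; exists p.
rewrite /depth /gdist (_ : nnodes t = k + (nnodes t - k.+1).+1); last by lia.
by rewrite iotaD find_cat nk /= add0n wk addn0 size_iota.
Qed.

Lemma iplE t : recursive_tree t -> ipl t = sumn (depths t).
Proof.
move=> rt; rewrite /ipl sumnE [RHS](big_nth 0) size_depths big_add1 /=.
apply: eq_big_nat => v vn.
by rewrite depthE// /is_node; lia.
Qed.

End depth_of_nodes.

(** * Elementary inequalities *)

Lemma derive_ge0_ge0 (R : realType) (f df : R -> R) :
  f 0 = 0 -> (forall x : R, is_derive x 1 f (df x)) -> (forall x, 0 <= x -> 0 <= df x) ->
  forall x, 0 <= x -> 0 <= f x.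
Proof.
move=> f0 fdf df0 x x0; rewrite -f0.
apply: (@ger0_derive1_ndecr _ f 0 x) => //.
- move=> y; rewrite in_itv/= => /andP[y0 _].
  rewrite derive1E (@derive_val _ _ _ _ _ _ _ (fdf y)); apply: df0; exact: ltW.
- apply: continuous_subspaceT => y; apply/differentiable_continuous/derivable1_diffP.
  exact: (@ex_derive _ _ _ _ _ _ _ (fdf y)).
Qed.

Lemma sin_le_id (R : realType) (x : R) : 0 <= x -> 0 <= x - sin x.
Proof.
apply: (@derive_ge0_ge0 _ (fun x => x - sin x) (fun x => 1 - cos x)) => [|y _].
- by rewrite sin0 subr0.
- by rewrite subr_ge0 cos_le1.
Qed.

Lemma cos_ge_onem (R : realType) (x : R) : 0 <= x -> 0 <= x - 1 + cos x.
Proof.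
apply: (@derive_ge0_ge0 _ (fun x => x - 1 + cos x) (fun x => 1 - sin x)) => [|y|y _].
- by rewrite cos0; ring.
- by apply: is_derive_eq; rewrite /GRing.scale/=; ring.
- by rewrite subr_ge0 sin_le1.
Qed.

Lemma cos_taylor2_ge0 (R : realType) (x : R) : 0 <= x -> 0 <= cos x - 1 + x ^+ 2 / 2.
Proof.
apply: (@derive_ge0_ge0 _ (fun x => cos x - 1 + x ^+ 2 / 2) (fun x => x - sin x)).
- by rewrite cos0; ring.
- by move=> y; apply: is_derive_eq; rewrite /GRing.scale/=; field.
- exact: sin_le_id.
Qed.

Lemma sin_taylor2 (R : realType) (x : R) : 0 <= x -> 0 <= x ^+ 2 / 2 - x + sin x.
Proof.
apply: (@derive_ge0_ge0 _ (fun x => x ^+ 2 / 2 - x + sin x) (fun x => x - 1 + cos x)).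
- by rewrite sin0; ring.
- by move=> y; apply: is_derive_eq; rewrite /GRing.scale/=; field.
- exact: cos_ge_onem.
Qed.

Lemma cos_taylor3 (R : realType) (x : R) : 0 <= x ->
  0 <= x ^+ 3 / 6 - (cos x - 1 + x ^+ 2 / 2).
Proof.
apply: (@derive_ge0_ge0 _ (fun x => x ^+ 3 / 6 - (cos x - 1 + x ^+ 2 / 2))
  (fun x => x ^+ 2 / 2 - x + sin x)).
- by rewrite cos0; ring.
- by move=> y; apply: is_derive_eq; rewrite /GRing.scale/=; field.
- exact: sin_taylor2.
Qed.

Lemma sin_taylor3 (R : realType) (x : R) : 0 <= x ->
  0 <= x ^+ 3 / 6 - (x - sin x).
Proof.
apply: (@derive_ge0_ge0 _ (fun x => x ^+ 3 / 6 - (x - sin x))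
  (fun x => cos x - 1 + x ^+ 2 / 2)).
- by rewrite sin0; ring.
- by move=> y; apply: is_derive_eq; rewrite /GRing.scale/=; field.
- exact: cos_taylor2_ge0.
Qed.

(** The Taylor remainders of cos h at order two and of sin h at order one
are both at most |h|^3 / 6. *)
Lemma cosD_taylor (R : realType) (x h : R) :
  `|cos (x + h) - (cos x - h * sin x - h ^+ 2 / 2 * cos x)| <= `|h| ^+ 3.
Proof.
wlog h0 : x h / 0 <= h.
  move=> W; have [h0|h0] := leP 0 h; first exact: W.
  have := W (- x) (- h); rewrite oppr_ge0 (ltW h0) normrN => /(_ isT).
  rewrite -opprD !cosN sinN sqrrN.
  by rewrite mulrNN.
rewrite cosD (ger0_norm h0).
have -> : cos x * cos h - sin x * sin h - (cos x - h * sin x - h ^+ 2 / 2 * cos x) =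
  cos x * (cos h - 1 + h ^+ 2 / 2) + sin x * (h - sin h) by ring.
rewrite (le_trans (ler_normD _ _))// !normrM.
rewrite (ger0_norm (cos_taylor2_ge0 h0)) (ger0_norm (sin_le_id h0)).
have c := cos_taylor3 h0; have s := sin_taylor3 h0.
apply: (@le_trans _ _ (h ^+ 3 / 6 + h ^+ 3 / 6)).
  rewrite lerD//.
    rewrite -[leRHS]mul1r ler_pM// ?cos_taylor2_ge0 ?cos_max//; lra.
  rewrite -[leRHS]mul1r ler_pM// ?sin_le_id ?sin_max//; lra.
have : 0 <= h ^+ 3 by rewrite exprn_ge0.
lra.
Qed.

Lemma expRN_taylor (R : realType) (s : R) : 0 <= s ->
  0 <= expR (- s) - (1 - s) <= s ^+ 2.
Proof.
move=> s0; apply/andP; split; first by rewrite subr_ge0 expR_ge1Dx.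
have h : expR (- s) <= (1 + s)^-1.
  by rewrite expRN lef_pV2 ?posrE ?expR_gt0 ?expR_ge1Dx//; lra.
rewrite lerBlDr (le_trans h)// -[leLHS]mul1r ler_pdivrMr; last by lra.
have s3 : 0 <= s ^+ 3 by rewrite exprn_ge0.
rewrite (_ : _ * (1 + s) = 1 + s ^+ 3); first lra.
by ring.
Qed.

Section decrements.
Context (R : realType) (n : R) (n1 : 1 <= n).
Let n0 : 0 < n. Proof. by apply: lt_le_trans n1. Qed.
Let m0 : 0 < n + 1. Proof. by rewrite addr_gt0. Qed.
Let nn0 : n != 0. Proof. by rewrite gt_eqF. Qed.
Let mn0 : n + 1 != 0. Proof. by rewrite gt_eqF. Qed.

(** The lemmas of this section compare a potential at sizes n and n + 1; the
factor 1 + 1 / (2 (n + 1)) in some of them is the mean growth of [exp_depth] in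
one step, see [step_exp_depth]. *)
Lemma decr_inv : (n + 1) ^- 2 <= n^-1 - (n + 1)^-1.
Proof.
rewrite -subr_ge0 [leRHS](_ : _ = (n * (n + 1) ^+ 2)^-1); last by field; apply/andP.
by rewrite invr_ge0 mulr_ge0 ?exprn_ge0// ltW.
Qed.

Lemma decr_inv_growth :
  (n + 1) ^- 2 / 2 <= n^-1 - (1 + 1 / 2 * (n + 1)^-1) * (n + 1)^-1.
Proof.
rewrite -subr_ge0 [leRHS](_ : _ = (n * (n + 1) ^+ 2)^-1); last by field; apply/andP.
by rewrite invr_ge0 mulr_ge0 ?exprn_ge0// ltW.
Qed.

Lemma decr_sqr_growth :
  (n + 1) ^- 3 <= n ^- 2 - (1 + 1 / 2 * (n + 1)^-1) * (n + 1) ^- 2.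
Proof.
rewrite -subr_ge0 [leRHS](_ : _ = (n ^+ 2 + 6 * n + 2) / 2 * (n ^+ 2 * (n + 1) ^+ 3)^-1); last first.
  by field; apply/andP.
apply: mulr_ge0; first by rewrite divr_ge0// !addr_ge0 ?mulr_ge0 ?exprn_ge0 ?(ltW n0).
by rewrite invr_ge0 mulr_ge0 ?exprn_ge0// ltW.
Qed.

Lemma decr_sqr : n^-1 * (n + 1) ^- 2 <= n ^- 2 - (n + 1) ^- 2.
Proof.
rewrite -subr_ge0 [leRHS](_ : _ = (n ^+ 2 * (n + 1))^-1); last first.
  by field; apply/andP.
by rewrite invr_ge0 mulr_ge0 ?exprn_ge0// ltW.
Qed.

Lemma decr_cube : n ^- 2 * (n + 1) ^- 2 <= n ^- 3 - (n + 1) ^- 3.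
Proof.
rewrite -subr_ge0 [leRHS](_ : _ = (2 * n ^+ 2 + 2 * n + 1) * (n ^+ 3 * (n + 1) ^+ 3)^-1); last first.
  by field; apply/andP.
apply: mulr_ge0; first by rewrite !addr_ge0 ?mulr_ge0 ?exprn_ge0 ?(ltW n0).
by rewrite invr_ge0 mulr_ge0 ?exprn_ge0// ltW.
Qed.

Lemma decr_sqrt_growth :
  (1 + 1 / 2 * (n + 1)^-1) * (Num.sqrt (n + 1))^-1 <= (Num.sqrt n)^-1.
Proof.
rewrite ler_pdivrMr ?sqrtr_gt0// [leRHS]mulrC ler_pdivlMr ?sqrtr_gt0//.
have p0 : 0 <= 1 + 1 / 2 * (n + 1)^-1.
  have : 0 <= (n + 1)^-1 by rewrite invr_ge0 ltW.
  lra.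
rewrite -(@ler_pXn2r _ 2)// ?nnegrE ?mulr_ge0 ?sqrtr_ge0//.
rewrite exprMn !sqr_sqrtr ?(ltW n0) ?(ltW m0)//.
rewrite -subr_ge0 [leRHS](_ : _ = (3 * n + 4) / 4 * (n + 1) ^- 2); last by field.
apply: mulr_ge0; first by have := n0; lra.
by rewrite invr_ge0 exprn_ge0// ltW.
Qed.

End decrements.

(** * Averaging over the next attachment *)

Section averages.
Context (R : realType).
Implicit Types (f g : nat -> R) (s : seq nat).

Definition avg f s : R := (\sum_(d <- s) f d) / (size s)%:R.

Lemma avg_affine f g (x y z : R) s : (0 < size s)%N ->
  avg (fun d => x + y * f d + z * g d) s = x + y * avg f s + z * avg g s.
Proof.
move=> s0; rewrite /avg !big_split/= -!mulr_sumr big_const_seq count_predT iter_addr_0.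
by rewrite -mulr_natr; field; rewrite pnatr_eq0 -lt0n.
Qed.

Lemma le_avg f g s : (forall d, f d <= g d) -> avg f s <= avg g s.
Proof. by move=> fg; rewrite ler_wpM2r ?invr_ge0// ler_sum. Qed.

Lemma eq_avg f g s : f =1 g -> avg f s = avg g s.
Proof. by move=> fg; congr (_ / _); apply: eq_bigr => d _; rewrite fg. Qed.

Lemma avg_rcons f s d : (0 < size s)%N ->
  avg f (rcons s d) = avg f s + (f d - avg f s) * ((size s)%:R + 1)^-1.
Proof.
move=> s0; rewrite /avg -cats1 big_cat big_seq1 size_cat /= addn1 -natr1.
have h : (0 : R) < (size s)%:R by rewrite ltr0n.
by field; apply/andP; split; rewrite gt_eqF// addr_gt0.
Qed.

Lemma avg_norm_le f s : `|avg f s| <= avg (fun d => `|f d|) s.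
Proof.
rewrite /avg normrM [X in _ * X <= _]ger0_norm ?invr_ge0// ler_wpM2r ?invr_ge0//.
exact: ler_norm_sum.
Qed.

Lemma sqr_avg_le f s : (0 < size s)%N -> avg f s ^+ 2 <= avg (fun d => f d ^+ 2) s.
Proof.
move=> s0; set m := avg f s.
have : 0 <= avg (fun d => (f d - m) ^+ 2) s.
  by rewrite divr_ge0// sumr_ge0// => d _; exact: sqr_ge0.
rewrite (@eq_avg _ (fun d => m ^+ 2 + (- (2 * m)) * f d + 1 * f d ^+ 2)); last first.
  by move=> d; ring.
rewrite avg_affine// -/m; lra.
Qed.

End averages.

Section tree_functionals.
Context (R : realType).
Implicit Types (t : rtree) (v d : nat) (a : R).

Definition order t : R := (nnodes t)%:R.
Definition mean_depth t : R := avg (fun d => d%:R) (depths t).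
Definition var_depth t : R :=
  avg (fun d => (d%:R - mean_depth t) ^+ 2) (depths t).
(** The base 3/2 is such that the mean growth rate of this average is
n^(1/2), which is small enough for the Lindeberg condition, while (3/2)^d still
dominates d^4 up to a constant. *)
Definition exp_depth t : R := avg (fun d => (3 / 2) ^+ d) (depths t).
Definition depth_of t v : nat := nth 0%N (depths t) v.-1.

Local Notation N := order.
Local Notation M := mean_depth.
Local Notation S := var_depth.
Local Notation B := exp_depth.
Local Notation C := (10 ^+ 4 : R).

Lemma size_depths_gt0 t : (0 < size (depths t))%N.
Proof. by rewrite size_depths. Qed.
Hint Resolve size_depths_gt0 : core.

Lemma order_ge1 t : 1 <= N t. Proof. by rewrite ler1n. Qed.
Lemma order_gt0 t : 0 < N t. Proof. by rewrite ltr0n. Qed.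
Lemma orderS_gt0 t : 0 < N t + 1. Proof. by rewrite addr_gt0// order_gt0. Qed.
Lemma orderS_neq0 t : N t + 1 != 0. Proof. by rewrite gt_eqF// orderS_gt0. Qed.
Hint Resolve order_ge1 order_gt0 orderS_gt0 orderS_neq0 : core.

Lemma order_attach t v : N (attach t v) = N t + 1.
Proof. by rewrite /order nnodes_attach natr1. Qed.

Lemma mean_depth_attach t v :
  M (attach t v) = M t + ((depth_of t v)%:R + 1 - M t) * (N t + 1)^-1.
Proof. by rewrite /mean_depth depths_attach avg_rcons// size_depths -natr1. Qed.

Lemma exp_depth_attach t v :
  B (attach t v) = B t + (3 / 2 * (3 / 2) ^+ depth_of t v - B t) * (N t + 1)^-1.
Proof. by rewrite /exp_depth depths_attach avg_rcons// size_depths exprS. Qed.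

(** The usual formula for the variance, from which its recursion under
attachment is computed. *)
Lemma var_depthE t : S t = avg (fun d => d%:R ^+ 2) (depths t) - M t ^+ 2.
Proof.
rewrite /var_depth (@eq_avg _ _ (fun d => M t ^+ 2 + (- (2 * M t)) * d%:R + 1 * d%:R ^+ 2)); last first.
  by move=> d; ring.
by rewrite avg_affine// -/(M t); ring.
Qed.

Lemma var_depth_attach t v : S (attach t v) = S t +
  (N t * (N t + 1)^-1 * ((depth_of t v)%:R + 1 - M t) ^+ 2 - S t) * (N t + 1)^-1.
Proof.
rewrite !var_depthE mean_depth_attach depths_attach avg_rcons// size_depths -natr1.
rewrite -/(N t); set q := avg _ _; set m := M t; set x := _ + 1 - m.
rewrite (_ : (nth 0 (depths t) v.-1)%:R + 1 = x + m); last by rewrite /x /depth_of; ring.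
by field.
Qed.

(** The conditional expectation of g at the next tree, given the present
one: the parent of the new node is uniform. *)
Definition step (g : rtree -> R) t : R :=
  (\sum_(1 <= v < (nnodes t).+1) g (attach t v)) / N t.

(** When g at the next tree depends on the new node only through the depth
of its parent, the average over nodes is an average over depths. *)
Lemma stepE (g : rtree -> R) (G : nat -> R) t :
  (forall v, g (attach t v) = G (depth_of t v)) -> step g t = avg G (depths t).
Proof.
move=> gG; rewrite /step /avg size_depths; congr (_ / _).
rewrite [RHS](big_nth 0%N) size_depths big_add1 /=.
by apply: eq_bigr => v _; rewrite gG.
Qed.

Lemma step_affine (g h : rtree -> R) (x y z : R) t :
  step (fun s => x + y * g s + z * h s) t = x + y * step g t + z * step h t.
Proof.
rewrite /step !big_split/= -!mulr_sumr sumr_const_nat subn1 /=.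
by rewrite -mulr_natr -/(N t); field; rewrite gt_eqF.
Qed.

Lemma eq_step (g h : rtree -> R) t :
  (forall v, g (attach t v) = h (attach t v)) -> step g t = step h t.
Proof. by move=> gh; congr (_ / _); apply: eq_bigr => v _; rewrite gh. Qed.

Lemma step_weight (w : R -> R) (g : rtree -> R) t :
  step (fun s => w (N s) * g s) t = w (N t + 1) * step g t.
Proof.
rewrite (@eq_step _ (fun s => 0 + w (N t + 1) * g s + 0 * g s)); last first.
  by move=> v; rewrite order_attach; ring.
by rewrite step_affine; ring.
Qed.

Lemma step_exp_depth t : step B t = (1 + 1 / 2 * (N t + 1)^-1) * B t.
Proof.
set p := (N t + 1)^-1.
rewrite (@stepE _ (fun d => B t * (1 - p) + (3 / 2 * p) * (3 / 2) ^+ d + 0 * (3 / 2) ^+ d)).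
  by rewrite avg_affine// -/(B t); field.
by move=> v; rewrite exp_depth_attach -/p; ring.
Qed.

(** Bernoulli's inequality gives 1 + x / 10 <= (11/10)^x, and the fourth
power of 11/10 is at most 3/2. *)
Lemma pow4_le (x : nat) : (x%:R + 1) ^+ 4 <= C * (3 / 2) ^+ x :> R.
Proof.
have h : 1 + x%:R / 10 <= (11 / 10) ^+ x :> R.
  elim: x => [|x IH]; first by rewrite mul0r addr0.
  rewrite exprS -natr1; apply: (@le_trans _ _ (11 / 10 * (1 + x%:R / 10))).
    have : 0 <= x%:R :> R by []. lra.
  by rewrite ler_wpM2l.
have h4 : (1 + x%:R / 10) ^+ 4 <= (3 / 2) ^+ x :> R.
  apply: (@le_trans _ _ (((11 / 10) ^+ x) ^+ 4)).
    by rewrite lerXn2r// ?nnegrE ?addr_ge0// ?divr_ge0 ?exprn_ge0// ?divr_ge0.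
  by rewrite exprAC lerXn2r// ?nnegrE; lra.
apply: (@le_trans _ _ (C * (1 + x%:R / 10) ^+ 4)); last by rewrite ler_wpM2l.
rewrite -exprMn lerXn2r ?nnegrE ?addr_ge0 ?mulr_ge0 ?addr_ge0 ?divr_ge0//.
have : 0 <= x%:R :> R by []. lra.
Qed.

Lemma exp_depth_ge1 t : 1 <= B t.
Proof.
rewrite -[leLHS](_ : avg (fun=> 1) (depths t) = 1).
  by apply: le_avg => d; rewrite exprn_ege1//; lra.
rewrite (@eq_avg _ _ (fun d => 1 + 0 * 0 + 0 * 0)); last by move=> d; ring.
by rewrite avg_affine//; ring.
Qed.

Let avg_pow4 t : avg (fun d => (d%:R + 1) ^+ 4) (depths t) <= C * B t.
Proof.
rewrite -[leRHS](_ : avg (fun d => 0 + C * (3 / 2) ^+ d + 0 * (3 / 2) ^+ d) (depths t) = C * B t).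
  by apply: le_avg => d; rewrite mul0r add0r addr0; exact: pow4_le.
by rewrite avg_affine// -/(B t); ring.
Qed.

Let mean_pow4 t : (M t) ^+ 4 <= C * B t.
Proof.
apply: le_trans (avg_pow4 t).
apply: (@le_trans _ _ ((avg (fun d => d%:R ^+ 2) (depths t)) ^+ 2)).
  rewrite -[4%N]/(2 * 2)%N exprM lerXn2r ?nnegrE ?sqr_ge0//.
    by rewrite divr_ge0// sumr_ge0// => d _; exact: sqr_ge0.
  exact: sqr_avg_le.
apply: (le_trans (sqr_avg_le _ _)) => //.
apply: le_avg => d; rewrite -exprM lerXn2r ?nnegrE ?addr_ge0//; lra.
Qed.

Let pow4D (x y : R) : (x - y) ^+ 4 <= 8 * x ^+ 4 + 8 * y ^+ 4.
Proof.
rewrite -subr_ge0.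
rewrite [leRHS](_ : _ = ((x + y) ^+ 2) ^+ 2 + 6 * (x ^+ 2 - y ^+ 2) ^+ 2); last by ring.
by apply: addr_ge0; [exact: sqr_ge0|apply: mulr_ge0 => //; exact: sqr_ge0].
Qed.

Lemma fourth_moment_new t :
  avg (fun d => (d%:R + 1 - M t) ^+ 4) (depths t) <= 16 * (C * B t).
Proof.
apply: (@le_trans _ _ (8 * M t ^+ 4 + 8 * avg (fun d => (d%:R + 1) ^+ 4) (depths t))).
  rewrite -[leRHS](_ : avg (fun d => 8 * M t ^+ 4 + 8 * (d%:R + 1) ^+ 4 + 0 * 0) (depths t) = _).
    apply: le_avg => d; have := pow4D (d%:R + 1) (M t); lra.
  by rewrite avg_affine//; ring.
have := mean_pow4 t; have := avg_pow4 t; lra.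
Qed.

Lemma fourth_moment t :
  avg (fun d => (d%:R - M t) ^+ 4) (depths t) <= 16 * (C * B t).
Proof.
apply: (@le_trans _ _ (8 * M t ^+ 4 + 8 * avg (fun d => (d%:R + 1) ^+ 4) (depths t))).
  rewrite -[leRHS](_ : avg (fun d => 8 * M t ^+ 4 + 8 * (d%:R + 1) ^+ 4 + 0 * 0) (depths t) = _).
    apply: le_avg => d; have := pow4D d%:R (M t).
    have : d%:R ^+ 4 <= (d%:R + 1) ^+ 4 :> R.
      by rewrite lerXn2r ?nnegrE ?addr_ge0//; lra.
    lra.
  by rewrite avg_affine//; ring.
have := mean_pow4 t; have := avg_pow4 t; lra.
Qed.

Lemma var_depth_ge0 t : 0 <= S t.
Proof. by rewrite divr_ge0// sumr_ge0// => d _; exact: sqr_ge0. Qed.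

Lemma sqr_var_depth_le t : S t ^+ 2 <= 16 * (C * B t).
Proof.
apply: le_trans (fourth_moment t).
apply: (le_trans (sqr_avg_le _ _)) => //.
by apply: le_avg => d; rewrite -exprM.
Qed.

Lemma var_depth_le t : S t <= C * B t.
Proof.
rewrite var_depthE; apply: (@le_trans _ _ (avg (fun d => d%:R ^+ 2) (depths t))).
  by rewrite gerBl sqr_ge0.
apply: le_trans (avg_pow4 t); apply: le_avg => d.
apply: (@le_trans _ _ ((d%:R + 1) ^+ 2)).
  by rewrite lerXn2r ?nnegrE ?addr_ge0//; lra.
by apply: ler_weXn2l => //; rewrite lerDr.
Qed.

Lemma avg_centered t : avg (fun d => d%:R - M t) (depths t) = 0.
Proof.
rewrite (@eq_avg _ _ (fun d => - M t + 1 * d%:R + 0 * 0)); last by move=> d; ring.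
by rewrite avg_affine// -/(M t); ring.
Qed.

Lemma avg_sqr_new t : avg (fun d => (d%:R + 1 - M t) ^+ 2) (depths t) = S t + 1.
Proof.
rewrite (@eq_avg _ _ (fun d => 1 + 2 * (d%:R - M t) + 1 * (d%:R - M t) ^+ 2)); last by move=> d; ring.
by rewrite avg_affine// avg_centered -/(S t); ring.
Qed.

(** The mean increment of the variance in one step, see [step_var_depth]; it
is close to 1/n, whence the growth of the variance as log n. *)
Definition drift t : R := (N t - S t) * (N t + 1) ^- 2.

Lemma step_var_depth t : step S t = S t + drift t.
Proof.
set p := (N t + 1)^-1.
rewrite (@stepE _ (fun d => S t * (1 - p) + (N t * p ^+ 2) * (d%:R + 1 - M t) ^+ 2 + 0 * 0)).
  by rewrite avg_affine// avg_sqr_new /drift /p; field.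
by move=> v; rewrite var_depth_attach -/p; ring.
Qed.

(** An increment of the variance is of order (depth - mean)^2 / n, so that
this is controlled by the fourth moment. *)
Lemma step_sqr_var_incr t :
  step (fun s => (S s - S t) ^+ 2) t <= 64 * (C * B t) * (N t + 1) ^- 2.
Proof.
set p := (N t + 1)^-1.
have p0 : 0 <= p by rewrite invr_ge0 ltW.
have np : 0 <= N t * p <= 1.
  by rewrite mulr_ge0 ?(ltW (order_gt0 t))//= ler_pdivrMr// mul1r lerDl.
rewrite (@stepE _ (fun d => ((N t * p * (d%:R + 1 - M t) ^+ 2 - S t) * p) ^+ 2)); last first.
  by move=> v; rewrite var_depth_attach -/p; congr (_ ^+ 2); ring.
apply: (@le_trans _ _ (2 * p ^+ 2 * S t ^+ 2 + 2 * p ^+ 2 * avg (fun d => (d%:R + 1 - M t) ^+ 4) (depths t))).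
  rewrite -[leRHS](_ : avg (fun d => 2 * p ^+ 2 * S t ^+ 2 + 2 * p ^+ 2 * (d%:R + 1 - M t) ^+ 4 + 0 * 0) (depths t) = _).
    apply: le_avg => d; set x := (d%:R + 1 - M t) ^+ 2.
    rewrite (_ : (d%:R + 1 - M t) ^+ 4 = x ^+ 2); last by rewrite /x -exprM.
    rewrite exprMn [leLHS]mulrC.
    rewrite [leRHS](_ : _ = p ^+ 2 * (2 * S t ^+ 2 + 2 * x ^+ 2)); last by ring.
    rewrite ler_wpM2l ?sqr_ge0//.
    have h : (N t * p * x) ^+ 2 <= x ^+ 2.
      rewrite exprMn ler_piMl ?sqr_ge0//.
      by case/andP: np => ? ?; rewrite expr_le1.
    have := sqr_ge0 (N t * p * x + S t).
    rewrite sqrrD sqrrB; lra.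
  by rewrite avg_affine//; ring.
have h1 := sqr_var_depth_le t; have h2 := fourth_moment_new t.
rewrite -mulrDr -/p -exprVn -/p.
rewrite [leLHS](_ : _ = p ^+ 2 * (2 * (S t ^+ 2 + avg (fun d => (d%:R + 1 - M t) ^+ 4) (depths t)))); last by ring.
rewrite [leRHS]mulrC ler_wpM2l ?sqr_ge0//; lra.
Qed.

End tree_functionals.

(** * Superharmonic functions of trees *)

Section potentials.
Context (R : realType).
Implicit Types (t : rtree) (v d : nat) (a m : R).

Local Notation N := (@order R).
Local Notation M := (@mean_depth R).
Local Notation S := (@var_depth R).
Local Notation B := (@exp_depth R).
Local Notation C := (10 ^+ 4 : R).
Let N_ge1 t : 1 <= N t := order_ge1 R t.
Let N_gt0 t : 0 < N t := order_gt0 R t.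
Let NS_gt0 t : 0 < N t + 1 := orderS_gt0 R t.
Let NS_neq0 t : N t + 1 != 0 := orderS_neq0 R t.
Local Hint Resolve size_depths_gt0 N_ge1 N_gt0 NS_gt0 NS_neq0 : core.

Lemma step_exp_depth_div t :
  step (fun s => (N s)^-1 * B s) t <= (N t)^-1 * B t - (N t + 1) ^- 2 / 2 * B t.
Proof.
have b := exp_depth_ge1 R t; have h := decr_inv_growth (order_ge1 R t).
rewrite (step_weight (fun x => x^-1)) step_exp_depth mulrA -mulrBl.
rewrite ler_wpM2r//; first lra.
by rewrite mulrC; lra.
Qed.

Lemma step_exp_depth_div2 t :
  step (fun s => (N s) ^- 2 * B s) t <= (N t) ^- 2 * B t - (N t + 1) ^- 3 * B t.
Proof.
have b := exp_depth_ge1 R t; have h := decr_sqr_growth (order_ge1 R t).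
rewrite (step_weight (fun x => x ^- 2)) step_exp_depth mulrA -mulrBl.
rewrite ler_wpM2r//; first lra.
by rewrite mulrC; lra.
Qed.

Lemma step_exp_depth_div_sqrt t :
  step (fun s => (Num.sqrt (N s))^-1 * B s) t <= (Num.sqrt (N t))^-1 * B t.
Proof.
have b := exp_depth_ge1 R t; have h := decr_sqrt_growth (order_ge1 R t).
rewrite (step_weight (fun x => (Num.sqrt x)^-1)) step_exp_depth mulrA.
rewrite ler_wpM2r//; first lra.
by rewrite mulrC.
Qed.

(** The mean depth, centred by its expectation up to the constant 1; the
expected increments of the mean depth are 1 / (n + 1). *)
Definition depth_martingale t : R :=
  M t - \sum_(1 <= i < (nnodes t).+1) i%:R^-1.
Local Notation W := depth_martingale.

Lemma depth_martingale_attach t v :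
  W (attach t v) = W t + ((depth_of t v)%:R - M t) * (N t + 1)^-1.
Proof.
rewrite /depth_martingale mean_depth_attach nnodes_attach big_nat_recr//=.
rewrite -natr1 -/(N t); set s := \sum_(_ <= _ < _) _; field.
by [].
Qed.

Lemma step_sqr_martingale m t :
  step (fun s => (W s - m) ^+ 2) t = (W t - m) ^+ 2 + S t * (N t + 1) ^- 2.
Proof.
set p := (N t + 1)^-1.
rewrite (@stepE _ _ (fun d => (W t - m) ^+ 2 + 2 * (W t - m) * p * (d%:R - M t) +
   p ^+ 2 * (d%:R - M t) ^+ 2)); last first.
  by move=> v; rewrite depth_martingale_attach -/p; ring.
by rewrite avg_affine// avg_centered -/(S t) -exprVn -/p; ring.
Qed.

(** The added term bounds the expected sum of the conditional variances of
all later increments of the martingale, since the variance is at most C times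
[exp_depth].  The function is thus superharmonic and dominates the squared
oscillation of the martingale around m. *)
Definition osc_potential m t : R :=
  (W t - m) ^+ 2 + 2 * C * ((N t)^-1 * B t).

Lemma step_osc_potential m t : step (osc_potential m) t <= osc_potential m t.
Proof.
have h1 := step_exp_depth_div t; have h2 := var_depth_le R t.
rewrite /osc_potential (@eq_step _ _ (fun s => 0 + 1 * (W s - m) ^+ 2 + 2 * C * ((N s)^-1 * B s))); last first.
  by move=> v; ring.
rewrite step_affine step_sqr_martingale.
have q0 : 0 <= (N t + 1) ^- 2 by rewrite invr_ge0 sqr_ge0.
have h3 : S t * (N t + 1) ^- 2 <= C * B t * (N t + 1) ^- 2 by rewrite ler_wpM2r.
move: h1 h3; set q := (N t + 1) ^- 2; set x := step _ _; set y := _^-1 * B t.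
set z := S t * q; lra.
Qed.

(** Its decrements dominate (S - a)^2 / (2 (n + 1)^2), where S is the
variance: summed along the growth from size n, they bound the total weighted
error made when S is replaced by a = log n. *)
Definition dev_potential a t : R :=
  (S t - a) ^+ 2 * (N t)^-1 + 4 * (N t)^-1 + 128 * (C * ((N t) ^- 2 * B t)).

Lemma dev_potential_ge0 a t : 0 <= dev_potential a t.
Proof.
have b : 0 <= B t by apply: le_trans (exp_depth_ge1 R t).
have n0 : 0 <= (N t)^-1 by rewrite invr_ge0 ltW.
have n2 : 0 <= (N t) ^- 2 by rewrite -exprVn exprn_ge0.
have c0 : 0 <= C by rewrite exprn_ge0.
apply: addr_ge0; last by do 3 (apply: mulr_ge0 => //).
apply: addr_ge0; last by rewrite mulr_ge0.
by apply: mulr_ge0 => //; exact: sqr_ge0.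
Qed.

(** One step changes (S - a)^2 by the cross term with the drift and by the
squared increment; the weight p / 2 given to (S - a)^2 in the cross term is half
of what the factor 1/n of [dev_potential] can absorb. *)
Lemma step_sqr_dev a t :
  step (fun s => (S s - a) ^+ 2) t <=
  (S t - a) ^+ 2 * (1 + (N t + 1)^-1 / 2) + 4 * (N t + 1)^-1
  + 128 * (C * B t) * (N t + 1) ^- 2.
Proof.
set p := (N t + 1)^-1; set y := S t - a.
have p0 : 0 < p by rewrite invr_gt0.
have p1 : p <= 1 by rewrite invf_le1// lerDr ltW.
have b : 0 <= B t by apply: le_trans (exp_depth_ge1 R t).
rewrite (@eq_step _ _ (fun s =>
    - y ^+ 2 - 2 * y * a + (2 * y) * S s + 1 * ((S s - S t) ^+ 2 - 0))); last first.
  by move=> v; rewrite /y; ring.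
rewrite step_affine step_var_depth.
rewrite (@eq_step _ (fun s => (S s - S t) ^+ 2 - 0) (fun s => (S s - S t) ^+ 2)); last first.
  by move=> v; rewrite subr0.
have h1 := step_sqr_var_incr R t; rewrite -exprVn -/p in h1 *.
have h2 := sqr_var_depth_le R t.
have dr : drift R t = (N t - S t) * p ^+ 2 by rewrite /drift -exprVn.
have np : N t * p = 1 - p by rewrite /p; field.
(* Young's inequality, written as a sum of squares *)
have h3 : 2 * y * drift R t <= y ^+ 2 * p / 2 + 4 * p + 4 * S t ^+ 2 * p ^+ 3.
  rewrite dr -subr_ge0.
  rewrite [leRHS](_ : _ = p / 2 * (y - 2 * (N t * p) + 2 * p * S t) ^+ 2
     + 2 * p * (N t * p + p * S t) ^+ 2 + 4 * p * (1 - (N t * p) ^+ 2)); last by field.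
  have pge0 := ltW p0.
  have k1 : 0 <= 1 - (N t * p) ^+ 2.
    by rewrite np subr_ge0 expr_le1//; lra.
  apply: addr_ge0; last by apply: mulr_ge0 => //; rewrite mulr_ge0.
  by apply: addr_ge0; (apply: mulr_ge0; [by lra|exact: sqr_ge0]).
have h4 : 4 * S t ^+ 2 * p ^+ 3 <= 64 * (C * B t) * p ^+ 2.
  apply: (@le_trans _ _ (4 * S t ^+ 2 * p ^+ 2)).
    apply: ler_wpM2l; first by apply: mulr_ge0 => //; exact: sqr_ge0.
    by apply: ler_wiXn2l => //; exact: ltW.
  apply: ler_wpM2r; [exact: sqr_ge0|lra].
set st := step _ _ in h1 *.
rewrite [leLHS](_ : _ = y ^+ 2 + 2 * y * drift R t + st); last by rewrite /y; ring.
lra.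
Qed.

Lemma step_dev_potential a t :
  step (dev_potential a) t <= dev_potential a t - (S t - a) ^+ 2 * ((N t + 1) ^- 2 / 2).
Proof.
have h1 := step_sqr_dev a t; have h2 := step_exp_depth_div2 t.
have d1 := decr_inv (order_ge1 R t).
rewrite /dev_potential.
rewrite (@eq_step _ _ (fun s => 4 * (N t + 1)^-1 + (N t + 1)^-1 * (S s - a) ^+ 2 +
  128 * C * ((N s) ^- 2 * B s))); last first.
  by move=> v; rewrite order_attach; ring.
rewrite step_affine.
have b : 0 <= B t by apply: le_trans (exp_depth_ge1 R t).
move: h1 h2 d1; rewrite -!exprVn; set p := (N t + 1)^-1.
have p0 : 0 < p by rewrite invr_gt0.
set x := step _ _; set z := step _ _; set n := (N t)^-1; set y := (S t - a) ^+ 2.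
have y0 : 0 <= y by exact: sqr_ge0.
move=> h1 h2 d1.
have h3 : p * x <= p * (y * (1 + p / 2) + 4 * p + 128 * (C * B t) * p ^+ 2).
  by rewrite ler_wpM2l// ltW.
have h4 : (y + 4) * p ^+ 2 <= (y + 4) * (n - p) by rewrite ler_wpM2l// addr_ge0.
set cz := 10 ^+ 4 in h3 *.
have h5 : 128 * cz * z <= 128 * cz * (n ^+ 2 * B t - p ^+ 3 * B t).
  by rewrite ler_wpM2l// mulr_ge0// exprn_ge0.
lra.
Qed.

(** A version of [osc_potential] of the right order: the conditional
variances S / (k + 1)^2 are split as a plus the deviation S - a, which leads to
a / n instead of [exp_depth] / n. *)
Definition tight_potential a m t : R :=
  (W t - m) ^+ 2 + ((a + 1) * (N t)^-1 + dev_potential a t).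

Lemma step_tight_potential a m t : 0 <= a ->
  step (tight_potential a m) t <= tight_potential a m t.
Proof.
move=> a0; have h1 := step_dev_potential a t; have d1 := decr_inv (order_ge1 R t).
rewrite /tight_potential.
rewrite (@eq_step _ _ (fun s => (a + 1) * (N t + 1)^-1 + 1 * (W s - m) ^+ 2 + 1 * dev_potential a s)); last first.
  by move=> v; rewrite order_attach; ring.
rewrite step_affine step_sqr_martingale.
move: h1 d1; set q := (N t + 1) ^- 2; have q0 : 0 <= q by rewrite invr_ge0 sqr_ge0.
set x := step _ _; set V := dev_potential a t; set n := (N t)^-1; set p := (N t + 1)^-1.
move=> h1 d1.
have h2 : (a + 1) * q <= (a + 1) * (n - p) by rewrite ler_wpM2l// addr_ge0.
have h3 : S t * q <= (a + 1 / 2 + (S t - a) ^+ 2 / 2) * q.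
  rewrite ler_wpM2r//; have := sqr_ge0 (S t - a - 1); lra.
lra.
Qed.

(** The martingale part of the variance; the compensator is the sum of the
drifts at the earlier trees, which are the prefixes of t. *)
Definition comp_var t : R := S t - \sum_(0 <= j < size t) drift R (take j t).

Lemma comp_var_attach t v :
  comp_var (attach t v) = comp_var t + (S (attach t v) - S t) - drift R t.
Proof.
rewrite /comp_var /attach size_rcons big_nat_recr//= -cats1 take_size_cat//.
rewrite (@eq_big_nat _ _ _ _ _ _ (fun j => drift R (take j t))); last first.
  by move=> j /andP[_ js]; rewrite take_cat js.
by ring.
Qed.

Definition comp_var_potential t : R :=
  comp_var t ^+ 2 + 128 * C * ((N t)^-1 * B t).

Lemma step_comp_var_potential t : step comp_var_potential t <= comp_var_potential t.
Proof.
have h1 := step_sqr_var_incr R t; have h2 := step_exp_depth_div t.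
have h3 := step_var_depth R t.
rewrite /comp_var_potential.
have e1 : step (fun s => comp_var s ^+ 2) t <= comp_var t ^+ 2 + step (fun s => (S s - S t) ^+ 2) t.
  set y := comp_var t; set dl := drift R t.
  rewrite (@eq_step _ _ (fun s => (y - S t - dl) ^+ 2 - S t ^+ 2 + (2 * (y - dl)) * S s
    + 1 * ((S s - S t) ^+ 2))); last first.
    by move=> v; rewrite comp_var_attach -/y -/dl; ring.
  rewrite step_affine h3 -/dl.
  set st := step _ _; set s := S t.
  rewrite -subr_ge0 [leRHS](_ : _ = dl ^+ 2); first exact: sqr_ge0.
  by ring.
rewrite (@eq_step _ _ (fun s => 0 + 1 * (comp_var s ^+ 2) + 128 * C * ((N s)^-1 * B s))); last first.
  by move=> v; ring.
rewrite step_affine.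
move: h1 h2 e1; set x := step _ _; set z := step _ _; set w := step _ _.
set q := (N t + 1) ^- 2; set y := comp_var t ^+ 2; set n := (N t)^-1.
lra.
Qed.

End potentials.

(** * Lindeberg comparison along the growth *)

Section lindeberg.
Context (R : realType).
Implicit Types (t : rtree) (v d : nat) (om a m be : R).

Local Notation N := (@order R).
Local Notation M := (@mean_depth R).
Local Notation S := (@var_depth R).
Local Notation B := (@exp_depth R).
Local Notation W := (@depth_martingale R).
Local Notation C := (10 ^+ 4 : R).
Let N_ge1 t : 1 <= N t := order_ge1 R t.
Let N_gt0 t : 0 < N t := order_gt0 R t.
Let NS_gt0 t : 0 < N t + 1 := orderS_gt0 R t.
Let NS_neq0 t : N t + 1 != 0 := orderS_neq0 R t.
Local Hint Resolve size_depths_gt0 N_ge1 N_gt0 NS_gt0 NS_neq0 : core.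

(** With om = theta c and om^2 a = theta^2 n0 this is the solution of the
backward heat equation with terminal value cos (theta x + be), taken at the
point c (W - m) with remaining variance n0 / n. *)
Definition char_wave om a m be t : R :=
  expR (- (om ^+ 2 * a / 2 * (N t)^-1)) * cos (om * (W t - m) + be).

(** The three terms bound, summed over all later times, the third order
Taylor remainders, the errors in the conditional variances and the second order
errors of the exponential. *)
Definition lindeberg_potential om a t : R :=
  17 * `|om| ^+ 3 * (C * ((N t) ^- 2 * B t))
  + om ^+ 2 / 2 * (2^-1 * (N t)^-1 + dev_potential a t + a * (N t) ^- 2)
  + om ^+ 4 * a ^+ 2 / 4 * (N t) ^- 3.

Lemma step_lindeberg_potential om a t : 0 <= a ->
  17 * `|om| ^+ 3 * (C * B t) * (N t + 1) ^- 3
  + om ^+ 2 / 2 * ((N t + 1) ^- 2 / 2 + (S t - a) ^+ 2 * ((N t + 1) ^- 2 / 2)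
      + a * ((N t)^-1 * (N t + 1) ^- 2))
  + om ^+ 4 * a ^+ 2 / 4 * ((N t) ^- 2 * (N t + 1) ^- 2)
  <= lindeberg_potential om a t - step (lindeberg_potential om a) t.
Proof.
move=> a0; rewrite /lindeberg_potential.
have h1 := step_exp_depth_div2 R t.
have h2 := step_dev_potential a t.
have d1 := decr_inv (N_ge1 t); have d2 := decr_sqr (N_ge1 t); have d3 := decr_cube (N_ge1 t).
rewrite (@eq_step _ _ (fun s => om ^+ 2 / 2 * (2^-1 * (N t + 1)^-1 + a * (N t + 1) ^- 2)
    + om ^+ 4 * a ^+ 2 / 4 * (N t + 1) ^- 3
    + (17 * `|om| ^+ 3 * C) * ((N s) ^- 2 * B s) + om ^+ 2 / 2 * dev_potential a s)); last first.
  by move=> v; rewrite order_attach; ring.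
rewrite step_affine.
set x := step _ _ in h1 *; set y := step _ _ in h2 *.
set V := dev_potential a t in h2 *.
have k1 := ler_wpM2l (_ : 0 <= 17 * `|om| ^+ 3 * C) h1.
have {}k1 : 17 * `|om| ^+ 3 * C * x <= 17 * `|om| ^+ 3 * C * (N t ^- 2 * B t - (N t + 1) ^- 3 * B t).
  by apply: k1; rewrite !mulr_ge0// exprn_ge0.
have o2 : 0 <= om ^+ 2 / 2 by rewrite divr_ge0// sqr_ge0.
have k2 := ler_wpM2l o2 h2.
have k3 := ler_wpM2l o2 d1.
have k4 := ler_wpM2l o2 (ler_wpM2l a0 d2).
have o4 : 0 <= om ^+ 4 * a ^+ 2 / 4.
  by rewrite divr_ge0// mulr_ge0 ?sqr_ge0// exprn_even_ge0.
have k5 := ler_wpM2l o4 d3.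
lra.
Qed.

(** Up to a common exponential factor, one step replaces cos x by the
average of cos (x + h) over the centred increments h, that is by (1 - v/2) cos x
with v the variance of h, while the clock contributes exp (- s) cos x.  The
difference between v/2 and s is the error in the conditional variance. *)
Lemma step_char_wave om a m be t : 0 <= a ->
  `|step (char_wave om a m be) t - char_wave om a m be t| <=
  lindeberg_potential om a t - step (lindeberg_potential om a) t.
Proof.
move=> a0; apply: le_trans (step_lindeberg_potential om t a0).
set p := (N t + 1)^-1; set n := (N t)^-1.
have p0 : 0 < p by rewrite invr_gt0.
have n0 : 0 < n by rewrite invr_gt0.
(* 1/n = 1/(n+1) + 1/(n (n+1)): the clock loses n p in this step *)
have np : n = p + n * p by rewrite /n /p; field; rewrite NS_neq0 gt_eqF.
rewrite -!exprVn -/p -/n.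
pose x := om * (W t - m) + be.
pose s := om ^+ 2 * a / 2 * (n * p).
pose E := expR (- (om ^+ 2 * a / 2 * p)).
have o2 : 0 <= om ^+ 2 / 2 by apply: divr_ge0 => //; exact: sqr_ge0.
have o2a : 0 <= om ^+ 2 * a / 2 by rewrite mulrAC mulr_ge0.
have s0 : 0 <= s by rewrite /s mulr_ge0// mulr_ge0// ltW.
have pp0 : 0 <= p ^+ 2 by exact: sqr_ge0.
pose h d := om * p * (d%:R - M t).
have uE : char_wave om a m be t = E * (expR (- s) * cos x).
  rewrite /char_wave mulrA -/x; congr (_ * _); rewrite -expRD; congr expR.
  by rewrite /s -/n {1}np; ring.
have sE : step (char_wave om a m be) t = E * avg (fun d => cos (x + h d)) (depths t).
  rewrite (@stepE _ _ (fun d => 0 + E * cos (x + h d) + 0 * 0)).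
    by rewrite avg_affine//; ring.
  move=> v; rewrite /char_wave order_attach -/p -/E depth_martingale_attach -/p.
  by rewrite mul0r addr0 add0r /x /h; congr (_ * cos _); ring.
have E01 : 0 <= E <= 1.
  rewrite expR_ge0/= -expR0 ler_expR oppr_le0.
  by rewrite mulr_ge0// ltW.
rewrite uE sE -mulrBr normrM.
have [E0 E1] := andP E01.
rewrite (ger0_norm E0) (le_trans (ler_piMl _ E1))//.
set av := avg _ _.
pose sg := (om * p) ^+ 2 * S t / 2.
have b1 := exp_depth_ge1 R t.
have e1 : `|av - (1 - sg) * cos x| <= `|om * p| ^+ 3 * (17 * (C * B t)).
  have -> : (1 - sg) * cos x = avg (fun d => cos x - h d * sin x - h d ^+ 2 / 2 * cos x) (depths t).
    rewrite (@eq_avg _ _ (fun d => cos x + (- (om * p * sin x)) * (d%:R - M t)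
       + (- ((om * p) ^+ 2 / 2 * cos x)) * (d%:R - M t) ^+ 2)); last first.
      by move=> d; rewrite /h; ring.
    by rewrite avg_affine// avg_centered -/(S t) /sg; ring.
  have -> : av - avg (fun d => cos x - h d * sin x - h d ^+ 2 / 2 * cos x) (depths t) =
     avg (fun d => cos (x + h d) - (cos x - h d * sin x - h d ^+ 2 / 2 * cos x)) (depths t).
    rewrite [RHS](@eq_avg _ _ (fun d => 0 + 1 * cos (x + h d) + (- 1) *
       (cos x - h d * sin x - h d ^+ 2 / 2 * cos x))); last by move=> d; ring.
    by rewrite avg_affine// -/av; ring.
  apply: (le_trans (avg_norm_le _ _)).
  apply: (@le_trans _ _ (avg (fun d => `|om * p| ^+ 3 * (1 + 1 * (d%:R - M t) ^+ 4 + 0 * 0)) (depths t))).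
    apply: le_avg => d; apply: (le_trans (cosD_taylor _ _)).
    rewrite /h normrM exprMn ler_wpM2l ?exprn_ge0//.
    set z := d%:R - M t; rewrite mul1r mul0r addr0.
    have : z ^+ 4 = (`|z| ^+ 2) ^+ 2 by rewrite real_normK ?num_real// -exprM.
    move=> ->; move: (normr_ge0 z); set w := `|z| => w0.
    have [w1|w1] := leP w 1.
      by rewrite (le_trans (exprn_ile1 _ w0 w1))// lerDl sqr_ge0.
    by rewrite -exprM -[leLHS]add0r lerD// ler_weXn2l// ltW.
  rewrite (@eq_avg _ _ (fun d => `|om * p| ^+ 3 + `|om * p| ^+ 3 * (d%:R - M t) ^+ 4 + 0 * 0)); last first.
    by move=> d; ring.
  rewrite avg_affine// mul0r addr0 -[X in X + _]mulr1 -mulrDr ler_wpM2l ?exprn_ge0//.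
  have := fourth_moment R t.
  have : B t <= C * B t.
    by apply: ler_peMl; [apply: le_trans b1|rewrite exprn_ege1// ler1n].
  lra.
have e2 : `|(1 - sg) * cos x - expR (- s) * cos x| <= `|sg - s| + s ^+ 2.
  rewrite -mulrBl normrM (le_trans (ler_piMr _ (cos_max x)))//.
  have -> : 1 - sg - expR (- s) = (s - sg) - (expR (- s) - (1 - s)) by ring.
  rewrite (le_trans (ler_normB _ _))// distrC lerD//.
  by have /andP[g0 g1] := expRN_taylor s0; rewrite ger0_norm.
have e3 : `|sg - s| <= om ^+ 2 / 2 * (p ^+ 2 / 2 + (S t - a) ^+ 2 * (p ^+ 2 / 2) + a * (n * p ^+ 2)).
  have -> : sg - s = om ^+ 2 / 2 * (p ^+ 2 * (S t - a) - a * (n * p ^+ 2)).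
    by rewrite /sg /s {1}np; ring.
  rewrite normrM (ger0_norm o2) ler_wpM2l//.
  rewrite (le_trans (ler_normB _ _))// lerD//.
    rewrite normrM (ger0_norm pp0).
    rewrite [leRHS](_ : _ = p ^+ 2 * ((1 + (S t - a) ^+ 2) / 2)); last by field.
    rewrite ler_wpM2l//.
    rewrite -(real_normK (num_real (S t - a))); move: `|_| => w.
    have := sqr_ge0 (w - 1); lra.
  by rewrite ger0_norm// mulr_ge0// mulr_ge0// ltW.
have -> : av - expR (- s) * cos x = (av - (1 - sg) * cos x) +
  ((1 - sg) * cos x - expR (- s) * cos x) by ring.
rewrite (le_trans (ler_normD _ _))//.
have e4 : s ^+ 2 = om ^+ 4 * a ^+ 2 / 4 * (n ^+ 2 * p ^+ 2) by rewrite /s; field.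
have e5 : `|om * p| ^+ 3 * (17 * (C * B t)) = 17 * `|om| ^+ 3 * (C * B t) * p ^+ 3.
  by rewrite normrM (gtr0_norm p0) exprMn; ring.
rewrite e4 in e2; rewrite e5 in e1; lra.
Qed.

End lindeberg.

(** * The tree process and a maximal inequality *)

Section tree_process.
Context (d : measure_display) (T : measurableType d) (R : realType)
  (P : probability T R) (X : nat -> T -> rtree)
  (hX : random_recursive_tree P X).

Definition tree_event (n : nat) (t : rtree) : set T := [set w | X n w = t].
(** Probabilities as real numbers, to compute with field operations. *)
Definition real_prob (A : set T) : R := fine (P A).
Local Notation pr := real_prob.

Lemma prE A : measurable A -> P A = (pr A)%:E.
Proof. by move=> mA; rewrite fineK// fin_num_measure. Qed.

Lemma pr_ge0 A : 0 <= pr A.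
Proof. by rewrite fine_ge0. Qed.

Lemma le_pr A B : measurable A -> measurable B -> A `<=` B -> pr A <= pr B.
Proof. by move=> mA mB AB; rewrite -lee_fin -!prE// le_measure// inE. Qed.

Lemma tree_valid n w : (1 <= n)%N -> nnodes (X n w) = n /\ recursive_tree (X n w).
Proof.
elim: n => // -[_ _|n IH _]; first by rewrite (rrt_root hX).
have [IH1 IH2] := IH isT.
have [v tv ->] := rrt_grow hX w (isT : (1 <= n.+1)%N).
by rewrite nnodes_attach IH1 recursive_tree_attach IH2.
Qed.

(** The tree at time n contains the whole history. *)
Lemma tree_prefix k n w : (1 <= k <= n)%N -> X k w = take k.-1 (X n w).
Proof.
move=> /andP[k1]; elim: n => [|n IH]; first by rewrite leqn0 => /eqP k0; rewrite k0 in k1.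
rewrite leq_eqVlt => /predU1P[->|kn].
  have [[sn] _] := tree_valid w (isT : 1 <= n.+1)%N.
  by rewrite take_oversize //= sn.
have n1 : (1 <= n)%N by rewrite (leq_trans k1).
rewrite IH//; have [v _ ->] := rrt_grow hX w n1.
have [sn _] := tree_valid w n1.
rewrite /attach -cats1 take_cat; case: ltnP => // h.
have -> : (k.-1 - size (X n w))%N = 0%N by rewrite /nnodes in sn; lia.
by rewrite take0 cats0 take_oversize.
Qed.

Lemma measurable_tree n (B : set rtree) : (1 <= n)%N -> measurable [set w | B (X n w)].
Proof. exact: (rrt_meas hX). Qed.

Lemma measurable_tree_event n t : (1 <= n)%N -> measurable (tree_event n t).
Proof. exact: measurable_tree [set s | s = t]. Qed.

Lemma tree_event1 : tree_event 1 root_tree = setT.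
Proof. by apply/seteqP; split => // w _; rewrite /tree_event/= (rrt_root hX). Qed.

Lemma tree_event_step n t v : (1 <= n)%N ->
  tree_event n.+1 (attach t v) = tree_event n t `&` [set w | X n.+1 w = attach (X n w) v].
Proof.
move=> n1; apply/seteqP; split => w; rewrite /tree_event/=; last by move=> [-> ->].
have [u _ ->] := rrt_grow hX w n1.
by move=> /rcons_inj[-> ->].
Qed.

Lemma history_tree_event n (B : set rtree) : (1 <= n)%N ->
  <<s history X n >> [set w | B (X n w)].
Proof.
move=> n1; apply: sub_sigma_algebra; exists n; first by rewrite /= n1 leqnn.
by exists B => //; rewrite setTI.
Qed.

Lemma pr_tree_event_attach n t v : (1 <= n)%N -> (1 <= v <= n)%N ->
  pr (tree_event n.+1 (attach t v)) = pr (tree_event n t) / n%:R.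
Proof.
move=> n1 vn; rewrite /pr tree_event_step//.
rewrite (rrt_unif hX n1 vn (history_tree_event [set s | s = t] n1)).
by rewrite prE ?fineM//= 1?mulrC//; exact: measurable_tree_event.
Qed.

Lemma pr_tree_event_gt0 n w : (1 <= n)%N -> 0 < pr (tree_event n (X n w)).
Proof.
elim: n => // -[_ _|n IH _].
  by rewrite (rrt_root hX) tree_event1 /pr probability_setT.
have n1 : (1 <= n.+1)%N by [].
have [v /andP[v1 vn] ->] := rrt_grow hX w n1.
have [sn _] := tree_valid w n1; rewrite sn in vn.
by rewrite pr_tree_event_attach ?v1// divr_gt0 ?IH// ltr0n.
Qed.

(** The atom splits according to the parent of the next node. *)
Lemma pr_step n t H : (1 <= n)%N -> nnodes t = n -> measurable H ->
  pr (tree_event n t `&` H) =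
  \sum_(1 <= v < n.+1) pr (tree_event n.+1 (attach t v) `&` H).
Proof.
move=> n1 tn mH.
have mF v : measurable (tree_event n.+1 (attach t v) `&` H).
  by apply: measurableI => //; exact: measurable_tree_event.
have tF (A : set nat) : trivIset A (fun v => tree_event n.+1 (attach t v) `&` H).
  move=> u v _ _ [w [[h1 _] [h2 _]]]; rewrite /tree_event/= in h1 h2.
  by move: h1; rewrite h2 => /rcons_inj[].
apply/EFin_inj; rewrite -prE; last by apply: measurableI => //; exact: measurable_tree_event.
rewrite (_ : tree_event n t `&` H = \big[setU/set0]_(v <- index_iota 1 n.+1)
    (tree_event n.+1 (attach t v) `&` H)); last first.
  rewrite -bigcup_seq; apply/seteqP; split => w.
    move=> [tw Hw]; have [v tv e] := rrt_grow hX w n1.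
    rewrite /tree_event/= in tw; rewrite tw in e tv; exists v => //=.
    by move: tv; rewrite /is_node tn mem_index_iota.
  by move=> [v _] [+ Hw]; rewrite tree_event_step// => -[].
rewrite !big_add1 /= !big_mkord.
rewrite (@measure_bigsetU _ _ _ _ (fun v => tree_event n.+1 (attach t v.+1) `&` H))//.
  by rewrite -sumEFin; apply: eq_bigr => v _; exact: prE.
by move=> u v _ _ uv; apply/succn_inj; apply: (tF setT).
Qed.

Lemma pr_le_step n t H (V : rtree -> R) : (1 <= n)%N -> nnodes t = n -> measurable H ->
  (forall v, (1 <= v <= n)%N ->
    pr (tree_event n.+1 (attach t v) `&` H) <= V (attach t v) * pr (tree_event n.+1 (attach t v))) ->
  pr (tree_event n t `&` H) <= step V t * pr (tree_event n t).
Proof.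
move=> n1 tn mH hV; rewrite pr_step// /step /order tn.
rewrite mulrAC mulr_suml mulr_suml; apply: ler_sum_nat => v vn.
rewrite (le_trans (hV v _))//.
by rewrite pr_tree_event_attach// mulrA.
Qed.

(** Backward induction: a bound valid on all atoms at time n propagates to
the atoms of earlier times. *)
Lemma pr_le_superharmonic n m t H (V : rtree -> R) :
  (1 <= m <= n)%N -> nnodes t = m -> measurable H ->
  (forall s, step V s <= V s) ->
  (forall s, nnodes s = n -> pr (tree_event n s `&` H) <= V s * pr (tree_event n s)) ->
  pr (tree_event m t `&` H) <= V t * pr (tree_event m t).
Proof.
move=> /andP[m1 mn] tm mH sV hV.
move: (n - m)%N (subnKC mn) => j; elim: j m t m1 tm {mn} => [|j IH] m t m1 tm mj.
  by rewrite addn0 in mj; rewrite -mj in hV; exact: hV.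
rewrite (@le_trans _ _ (step V t * pr (tree_event m t)))//; last first.
  by rewrite ler_wpM2r// pr_ge0.
apply: pr_le_step => // v vm; apply: IH => //; first by rewrite nnodes_attach tm.
by rewrite addSnnS.
Qed.

Lemma measurable_hits_upto n j (V : rtree -> R) (lam : R) : (1 <= n)%N ->
  measurable [set w | exists2 k, (n <= k <= n + j)%N & lam <= V (X k w)].
Proof.
move=> n1; rewrite (_ : [set w | _] =
    \bigcup_(k in [set k | (n <= k <= n + j)%N]) [set w | lam <= V (X k w)]).
  apply: bigcup_measurable => k /= /andP[nk _].
  apply: (measurable_tree [set s | lam <= V s]); exact: leq_trans nk.
by apply/seteqP; split => w [k kk h]; exists k.
Qed.

(** Ville's inequality.  Either V t is at least lam, and the bound exceeds
the probability of the atom, or the level is not reached at time n and one step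
of the recursion applies. *)
Lemma maximal_inequality_finite n j t (V : rtree -> R) (lam : R) :
  (1 <= n)%N -> nnodes t = n -> 0 < lam ->
  (forall s, 0 <= V s) -> (forall s, step V s <= V s) ->
  pr (tree_event n t `&` [set w | exists2 k, (n <= k <= n + j)%N & lam <= V (X k w)])
    <= V t / lam * pr (tree_event n t).
Proof.
move=> n1 tn l0 V0 sV.
elim: j n t n1 tn => [|j IH] n t n1 tn.
all: have [lV|Vl] := leP lam (V t).
1,3: rewrite (@le_trans _ _ (pr (tree_event n t)))//;
  [apply: le_pr => //; [apply: measurableI; [exact: measurable_tree_event|exact: measurable_hits_upto]|exact: measurable_tree_event]
  |by rewrite ler_peMl ?pr_ge0// ler_pdivlMr// mul1r].
  rewrite (_ : _ `&` _ = set0); first by rewrite /pr measure0 mulr_ge0 ?pr_ge0// divr_ge0// ltW.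
  rewrite -subset0 => w [tw] [k]; rewrite addn0 -eqn_leq => /eqP <-.
  by rewrite tw leNgt Vl.
rewrite (_ : _ `&` _ = tree_event n t `&`
  [set w | exists2 k, (n.+1 <= k <= n.+1 + j)%N & lam <= V (X k w)]); last first.
  apply/seteqP; split => w [tw] [k kn kV]; split => //; exists k => //; last by lia.
  have : k <> n by move=> kE; move: kV; rewrite kE tw leNgt Vl.
  lia.
apply: (@le_trans _ _ (step (fun s => V s / lam) t * pr (tree_event n t))).
  apply: pr_le_step => // [|v vn]; first exact: measurable_hits_upto.
  by apply: IH => //; rewrite nnodes_attach tn.
rewrite ler_wpM2r ?pr_ge0//.
rewrite (@eq_step _ _ (fun s => 0 + lam^-1 * V s + 0 * 0)); last by move=> v; ring.
by rewrite step_affine [leLHS](_ : _ = step V t / lam) ?ler_wpM2r ?invr_ge0 ?(ltW l0)//; ring.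
Qed.

Lemma maximal_inequality n t (V : rtree -> R) (lam : R) :
  (1 <= n)%N -> nnodes t = n -> 0 < lam ->
  (forall s, 0 <= V s) -> (forall s, step V s <= V s) ->
  pr (tree_event n t `&` [set w | exists2 k, (n <= k)%N & lam <= V (X k w)])
    <= V t / lam * pr (tree_event n t).
Proof.
move=> n1 tn l0 V0 sV.
pose F j := tree_event n t `&` [set w | exists2 k, (n <= k <= n + j)%N & lam <= V (X k w)].
have mF j : measurable (F j).
  by apply: measurableI; [exact: measurable_tree_event|exact: measurable_hits_upto].
have UF : tree_event n t `&` [set w | exists2 k, (n <= k)%N & lam <= V (X k w)] = \bigcup_j F j.
  apply/seteqP; split => w; last by move=> [j _] [tw [k /andP[nk _] h]]; split => //; exists k.
  by move=> [tw [k nk h]]; exists (k - n)%N => //; split => //; exists k => //; lia.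
have mU : measurable (\bigcup_j F j) by apply: bigcup_measurable => j _.
rewrite UF -lee_fin -prE//.
have ndF : nondecreasing_seq F.
  move=> i j ij; apply/subsetPset => w [tw [k kk h]]; split => //; exists k => //; lia.
have cv := @nondecreasing_cvg_mu _ _ _ P _ mF mU ndF.
rewrite -(cvg_lim _ cv)//; apply: lime_le; first by apply/cvg_ex; eexists; exact: cv.
by apply: nearW => j /=; rewrite prE// lee_fin maximal_inequality_finite.
Qed.

End tree_process.

(** * Conditional laws given the history *)

Section conditional_laws.
Context (d : measure_display) (T : measurableType d) (R : realType)
  (P : probability T R) (X : nat -> T -> rtree)
  (hX : random_recursive_tree P X).
Local Notation pr := (real_prob P).

Lemma tree_event_bigsetU n t : (1 <= n)%N -> nnodes t = n ->
  tree_event X n t = \big[setU/set0]_(v <- index_iota 1 n.+1) tree_event X n.+1 (attach t v).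
Proof.
move=> n1 tn; rewrite -bigcup_seq; apply/seteqP; split => w.
  move=> tw; have [v tv e] := rrt_grow hX w n1.
  rewrite /tree_event/= in tw; rewrite tw in e tv; exists v => //=.
  by move: tv; rewrite /is_node tn mem_index_iota.
by move=> [v _]; rewrite (tree_event_step hX)// => -[].
Qed.

Lemma measurable_tree_fun n (g : rtree -> R) : (1 <= n)%N ->
  measurable_fun setT (fun w => g (X n w)).
Proof.
move=> n1 _ Y mY; rewrite setTI.
exact: (measurable_tree hX [set s | Y (g s)] n1).
Qed.

Lemma P_tree_event_lty n t : (1 <= n)%N -> (P (tree_event X n t) < +oo)%E.
Proof. by move=> n1; rewrite prE ?ltry//; exact: (measurable_tree_event hX). Qed.

Lemma Rintegral_tree_event_step n t (h : T -> R) (K : R) : (1 <= n)%N -> nnodes t = n ->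
  measurable_fun setT h -> (forall w, `|h w| <= K) ->
  \int[P]_(w in tree_event X n t) h w =
  \sum_(1 <= v < n.+1) \int[P]_(w in tree_event X n.+1 (attach t v)) h w.
Proof.
move=> n1 tn mh bh; rewrite {1}/Rintegral tree_event_bigsetU// integral_bigsetU_EFin//.
- rewrite (eq_bigr (fun v => (\int[P]_(w in tree_event X n.+1 (attach t v)) h w)%:E)).
    by rewrite sumEFin.
  move=> v _; rewrite /Rintegral fineK//; apply: integrable_fin_num.
    exact: (measurable_tree_event hX).
  apply: (@bounded_fun_integrable _ _ _ _ _ _ K) => //.
  + exact: (measurable_tree_event hX).
  + exact: P_tree_event_lty.
  + exact: measurable_funTS.
- by move=> v; exact: (measurable_tree_event hX).
- exact: iota_uniq.
- move=> u v _ _ [w [h1 h2]]; rewrite /tree_event/= in h1 h2.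
  by move: h1; rewrite h2 => /rcons_inj[].
- by apply/measurable_EFinP; exact: measurable_funTS.
Qed.

(** If V - step V dominates the defect of harmonicity of f, then the
conditional expectation of f at any later time differs from its present value
by at most V: the decrements of V telescope. *)
Lemma Rintegral_superharmonic (f V : rtree -> R) (n j : nat) t :
  (1 <= n)%N -> nnodes t = n -> (forall s, `|f s| <= 1) -> (forall s, 0 <= V s) ->
  (forall s, `|step f s - f s| <= V s - step V s) ->
  `|\int[P]_(w in tree_event X n t) f (X (n + j) w) - f t * pr (tree_event X n t)| <=
  V t * pr (tree_event X n t).
Proof.
move=> n1 tn f1 V0 fV; elim: j n t n1 tn => [|j IH] n t n1 tn.
  rewrite (_ : \int[P]_(_ in _) _ = f t * pr (tree_event X n t)).
    by rewrite subrr normr0 mulr_ge0 ?pr_ge0.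
  rewrite -Rintegral_cst; last exact: (measurable_tree_event hX).
  by apply: eq_Rintegral => w; rewrite inE /tree_event/= addn0 => ->.
set p := pr _.
rewrite (@Rintegral_tree_event_step n t _ 1)//; last first.
  by apply: measurable_tree_fun; rewrite ltn_addr.
have pv v : (1 <= v < n.+1)%N -> pr (tree_event X n.+1 (attach t v)) = p / n%:R.
  by move=> vn; rewrite (pr_tree_event_attach hX).
have n0 : n%:R != 0 :> R by rewrite pnatr_eq0 -lt0n.
have sE (g : rtree -> R) : step g t * p =
    \sum_(1 <= v < n.+1) g (attach t v) * pr (tree_event X n.+1 (attach t v)).
  rewrite /step /order tn mulrAC !mulr_suml; apply: eq_big_nat => v vn.
  by rewrite pv// mulrA.
rewrite (_ : _ - _ = (\sum_(1 <= v < n.+1) (\int[P]_(w in tree_event X n.+1 (attach t v))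
    f (X (n + j.+1)%N w) - f (attach t v) * pr (tree_event X n.+1 (attach t v))))
    + (step f t - f t) * p); last first.
  by rewrite sumrB -sE; ring.
rewrite (le_trans (ler_normD _ _))//.
apply: (@le_trans _ _ (step V t * p + (V t - step V t) * p)); last first.
  by rewrite [leLHS](_ : _ = V t * p) //; ring.
apply: lerD; last first.
  by rewrite normrM (ger0_norm (pr_ge0 _ _)) ler_wpM2r ?pr_ge0.
rewrite (le_trans (ler_norm_sum _ _ _))// sE; apply: ler_sum_nat => v vn.
by rewrite -addSnnS; apply: IH => //; rewrite nnodes_attach tn.
Qed.

(** All trees X_k with k <= n are functions of X_n, see [tree_prefix]. *)
Lemma history_preimage n (B : set T) : (1 <= n)%N -> <<s history X n >> B ->
  exists C : set rtree, B = [set w | C (X n w)].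
Proof.
move=> n1 /(_ (preimage_set_system setT (X n) setT)) h.
suff [C _ <-] : preimage_set_system setT (X n) setT B by exists C; rewrite setTI.
apply: h; split.
  apply: sigma_algebra_preimage; split => //.
move=> A [k /= /andP[k1 kn] [D _ <-]].
exists [set s | D (take k.-1 s)] => //; rewrite !setTI.
by apply/seteqP; split => w /=; rewrite (@tree_prefix _ _ _ _ _ hX k n w)// k1.
Qed.

(** A kernel measurable for the history is constant on the atoms, so its
value there is an elementary conditional probability. *)
Lemma kernel_tree_event n (Z : T -> R)
    (k : R.-pker (g_sigma_algebraType (history X n)) ~> (measurableTypeR R)) :
  (1 <= n)%N -> regular_cond_distribution P Z k ->
  forall w (A : set (measurableTypeR R)), measurable A ->
  (k w A * (pr (tree_event X n (X n w)))%:E = P (tree_event X n (X n w) `&` Z @^-1` A))%E.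
Proof.
move=> n1 hk w A mA; rewrite -hk//; last exact: (@history_tree_event _ _ X n [set s | s = X n w] n1).
rewrite -prE; last exact: (measurable_tree_event hX).
rewrite -integral_cst; last exact: (measurable_tree_event hX).
apply: eq_integral => w'; rewrite inE => hw'.
have mk := measurable_kernel k A mA.
have [C hC] : exists C : set rtree, [set w' | k w' A = k w A] = [set w | C (X n w)].
  apply: history_preimage => //.
  have := mk measurableT [set k w A] (emeasurable_set1 _).
  by rewrite setTI.
have : [set w' | k w' A = k w A] w by [].
rewrite hC/= -hw' => Cw'.
by have : [set w' | k w' A = k w A] w' by rewrite hC.
Qed.

End conditional_laws.

Section restricted_pushforward.
Context (d : measure_display) (T : measurableType d) (R : realType)
  (P : probability T R) (H : set T) (Z : T -> R)
  (k : {measure set (measurableTypeR R) -> \bar R}) (p : R)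
  (mH : measurable H) (mZ : measurable_fun setT Z) (p0 : 0 <= p)
  (kE : forall A : set (measurableTypeR R), measurable A ->
    (k A * p%:E = P (H `&` Z @^-1` A))%E).

Lemma ge0_integral_restricted_pushforward (g : R -> \bar R) :
  measurable_fun setT g -> (forall x, (0 <= g x)%E) ->
  (\int[k]_x g x * p%:E = \int[P]_(w in H) g (Z w))%E.
Proof.
move=> mg g0.
pose m1 := mscale (NngNum p0) k.
pose m2 := mrestr P mH.
have mgZ : measurable_fun setT (g \o Z) by exact: measurableT_comp.
have -> : (\int[k]_x g x * p%:E = \int[m1]_x g x)%E.
  by rewrite ge0_integral_mscale// muleC.
transitivity (\int[pushforward m2 (Z : T -> measurableTypeR R)]_x g x)%E.
  apply: eq_measure_integral => A mA _.
  transitivity (p%:E * k A)%E; first by [].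
  by rewrite muleC kE// setIC.
rewrite ge0_integral_pushforward// preimage_setT.
rewrite -(setUv H) ge0_integral_setU//; last 4 first.
- exact: measurableC.
- by rewrite setUv.
- by move=> x _; exact: g0.
- by apply/disj_set2P; rewrite setICr.
rewrite (@null_set_integral _ _ _ m2 (~` H))//; last 3 first.
- exact: measurableC.
- exact: measurable_funTS.
- by transitivity (P (~` H `&` H)); last by rewrite setICl measure0.
rewrite adde0; apply: eq_measure_integral => A mA AH.
by transitivity (P (A `&` H)); last by rewrite (setIidl AH).
Qed.

(** The measure k, scaled by p, is the image under Z of the restriction of
P to H.  Adding the bound K to f reduces to the nonnegative case. *)
Lemma Rintegral_restricted_pushforward (f : R -> R) (K : R) :
  k setT = 1%E -> P H = p%:E ->
  measurable_fun setT f -> (forall x, `|f x| <= K) ->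
  \int[k]_x f x * p = \int[P]_(w in H) f (Z w).
Proof.
move=> k1 PH mf bf.
have mfK : measurable_fun setT (fun x => (f x + K)%:E).
  by apply/measurable_EFinP; exact: measurable_funD.
have fK0 x : (0 <= (f x + K)%:E)%E.
  by rewrite lee_fin; have := bf x; rewrite ler_norml => /andP[? _]; lra.
have K0 : 0 <= K by apply: le_trans (bf 0).
have := ge0_integral_restricted_pushforward mfK fK0.
have kfin : (k setT < +oo)%E by rewrite k1 ltry.
have Pfin : (P H < +oo)%E by rewrite PH ltry.
have fi := bounded_fun_integrable measurableT kfin mf bf.
have Ki : k.-integrable setT (EFin \o (fun=> K)).
  by apply: (@bounded_fun_integrable _ _ _ _ _ _ K) => // x; rewrite ger0_norm.
have mfZ : measurable_fun H (f \o Z) by apply: measurable_funTS; exact: measurableT_comp.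
have fZi : P.-integrable H (EFin \o (f \o Z)).
  by apply: (@bounded_fun_integrable _ _ _ _ _ _ K) => // x; exact: bf.
have KZi : P.-integrable H (EFin \o (fun=> K)).
  by apply: (@bounded_fun_integrable _ _ _ _ _ _ K) => // x; rewrite ger0_norm.
rewrite integralD_EFin// integralD_EFin//=.
rewrite -[(\int[k]_x (f x)%:E)%E]fineK; last exact: integrable_fin_num.
rewrite -[(\int[P]_(x in H) (f (Z x))%:E)%E]fineK; last exact: integrable_fin_num.
rewrite !integral_cst// k1.
rewrite [X in _ = (_ + X)%E -> _](_ : _ = (K * p)%:E); last first.
  exact: (congr1 (fun z => (K%:E * z)%E) PH).
rewrite mule1 -EFinD -EFinM -EFinD => -[].
rewrite /Rintegral; lra.
Qed.

End restricted_pushforward.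

(** * Harmonic numbers and logarithms *)

Section logarithm.
Context (R : realType).

Lemma ln_natS_bounds (k : nat) : (1 <= k)%N ->
  (k.+1%:R^-1 : R) <= ln (k.+1%:R : R) - ln (k%:R : R) <= (k%:R^-1 : R).
Proof.
move=> k1; have k0 : 0 < k%:R :> R by rewrite ltr0n.
have kS0 : 0 < k.+1%:R :> R by rewrite ltr0n.
have kn : k%:R != 0 :> R by rewrite gt_eqF.
have kSn : k.+1%:R != 0 :> R by rewrite gt_eqF.
have kSE : k.+1%:R = k%:R + 1 :> R by rewrite natr1.
rewrite -ln_div ?posrE//; apply/andP; split; last first.
  rewrite (_ : k.+1%:R / k%:R = 1 + k%:R^-1); last by rewrite kSE; field.
  apply: le_ln1Dx; rewrite (lt_trans (ltrN10 _))// invr_gt0//.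
rewrite -[leRHS]opprK -lnV ?posrE ?divr_gt0// invf_div lerNr.
rewrite (_ : k%:R / k.+1%:R = 1 + (- k.+1%:R^-1)); last by rewrite kSE; field; rewrite -kSE.
apply: le_ln1Dx; rewrite ltrN2 invf_lt1// ltr1n ltnS//.
Qed.

(** This sequence converges to the Euler-Mascheroni constant; only the rate
of convergence in [harmonic_gap_cauchy] matters. *)
Definition harmonic_gap (n : nat) : R := \sum_(1 <= i < n.+1) i%:R^-1 - ln n%:R.

Lemma harmonic_gap_cauchy (n m : nat) : (1 <= n <= m)%N ->
  0 <= harmonic_gap n - harmonic_gap m <= n%:R^-1.
Proof.
move=> /andP[n1 nm]; suff : 0 <= harmonic_gap n - harmonic_gap m <= n%:R^-1 - m%:R^-1.
  by move=> /andP[-> /le_trans]; apply; rewrite gerBl invr_ge0.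
elim: m nm => [|m IH]; first by rewrite leqn0 => /eqP n0; rewrite n0 in n1.
rewrite leq_eqVlt => /predU1P[<-|nm]; first by rewrite !subrr lexx.
have m1 : (1 <= m)%N by rewrite (leq_trans n1).
have := ln_natS_bounds m1; have := IH nm.
have e : \sum_(1 <= i < m.+2) i%:R^-1 = \sum_(1 <= i < m.+1) i%:R^-1 + m.+1%:R^-1 :> R.
  by rewrite big_nat_recr.
rewrite /harmonic_gap e.
move: (\sum_(1 <= i < m.+1) _) (\sum_(1 <= i < n.+1) _) => s t.
move: (ln m.+1%:R) (ln m%:R) (ln n%:R) m.+1%:R^-1 m%:R^-1 n%:R^-1 => c1 c2 c3 c4 c5 c6.
move=> /andP[a1 a2] /andP[b1 b2]; apply/andP; split; lra.
Qed.

Lemma sum_telescope_bound (u v : nat -> R) (n : nat) :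
  (forall k, (1 <= k)%N -> `|u k| <= v k - v k.+1) -> (forall k, 0 <= v k) ->
  `|\sum_(1 <= k < n) u k| <= v 1%N.
Proof.
move=> uv v0; case: n => [|n]; first by rewrite big_geq// normr0.
suff : `|\sum_(1 <= k < n.+1) u k| <= v 1%N - v n.+1.
  by move=> /le_trans; apply; rewrite gerBl.
elim: n => [|n IH]; first by rewrite big_geq// normr0 subrr.
rewrite big_nat_recr//= (le_trans (ler_normD _ _))//.
have := uv n.+1 isT; lra.
Qed.

(** The left-hand side is what remains of S / (k + 1)^2 along a path with
S = O(sqrt k); it is summable by telescoping. *)
Lemma sqrt_decr (k : nat) : (1 <= k)%N ->
  Num.sqrt k%:R / (k%:R + 1) ^+ 2 <= 2 * ((Num.sqrt k%:R)^-1 - (Num.sqrt k.+1%:R)^-1) :> R.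
Proof.
move=> k1; rewrite -[k.+1%:R]natr1.
have k0 : 0 < k%:R :> R by rewrite ltr0n.
set x := Num.sqrt k%:R; set y := Num.sqrt (k%:R + 1).
have x0 : 0 < x by rewrite sqrtr_gt0.
have y0 : 0 < y by rewrite sqrtr_gt0 addr_gt0.
have xx : x ^+ 2 = k%:R by rewrite sqr_sqrtr// ltW.
have yy : y ^+ 2 = x ^+ 2 + 1 by rewrite xx sqr_sqrtr// addr_ge0// ltW.
have xy : x <= y by rewrite ler_sqrt ?lerDl// addr_gt0.
rewrite -xx -yy.
have -> : x^-1 - y^-1 = (x * y * (x + y))^-1.
  have h : (y - x) * (x + y) = 1 by rewrite (_ : _ * _ = y ^+ 2 - x ^+ 2); [rewrite yy; ring|ring].
  have -> : x^-1 - y^-1 = (y - x) / (x * y) by field; rewrite !gt_eqF.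
  have xy0 : x + y != 0 by rewrite gt_eqF// addr_gt0.
  by rewrite -[y - x](mulfK xy0) h; field; rewrite xy0 !gt_eqF.
have d0 : 0 < x * y * (x + y) by rewrite !mulr_gt0 ?addr_gt0.
rewrite ler_pdivrMr ?exprn_gt0// mulrAC ler_pdivlMr//.
rewrite (_ : x * (x * y * (x + y)) = x ^+ 2 * (y * (x + y))); last by ring.
rewrite (_ : 2 * (y ^+ 2) ^+ 2 = y ^+ 2 * (y * (y + y))); last by ring.
apply: ler_pM; rewrite ?mulr_ge0 ?addr_ge0 ?(ltW x0) ?(ltW y0)//.
  by rewrite lerXn2r ?nnegrE ?(ltW x0) ?(ltW y0).
by rewrite ler_wpM2l ?(ltW y0)// lerD2r.
Qed.

End logarithm.

(** * Almost sure bounds and convergence *)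

Section almost_sure.
Context (d : measure_display) (T : measurableType d) (R : realType)
  (P : probability T R) (X : nat -> T -> rtree)
  (hX : random_recursive_tree P X).
Local Notation pr := (real_prob P).
Local Notation N := (@order R).
Local Notation S := (@var_depth R).
Local Notation B := (@exp_depth R).
Local Notation W := (@depth_martingale R).
Local Notation C := (10 ^+ 4 : R).

Lemma order_tree n w : (1 <= n)%N -> N (X n w) = n%:R.
Proof. by move=> n1; rewrite /order (tree_valid hX w n1).1. Qed.

Lemma order_root : N root_tree = 1. Proof. by []. Qed.

Lemma exp_depth_root : B root_tree = 1.
Proof. by rewrite /exp_depth /avg /depths /= big_seq1 expr0 divr1. Qed.

Lemma pr_hits_le (V : rtree -> R) (lam : R) : 0 < lam ->
  (forall s, 0 <= V s) -> (forall s, step V s <= V s) ->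
  pr [set w | exists2 k, (1 <= k)%N & lam <= V (X k w)] <= V root_tree / lam.
Proof.
move=> l0 V0 sV.
have := maximal_inequality hX (isT : 1 <= 1)%N (erefl : nnodes root_tree = 1%N) l0 V0 sV.
by rewrite (tree_event1 hX) setTI /real_prob probability_setT/= mulr1.
Qed.

Lemma measurable_hits n (V : rtree -> R) (lam : R) : (1 <= n)%N ->
  measurable [set w | exists2 k, (n <= k)%N & lam <= V (X k w)].
Proof.
move=> n1.
rewrite (_ : [set w | _] = \bigcup_(k in [set k | (n <= k)%N]) [set w | lam <= V (X k w)]).
  apply: bigcup_measurable => k /= nk.
  by apply: (measurable_tree hX [set s | lam <= V s]); exact: leq_trans nk.
by apply/seteqP; split => w [k kk h]; exists k.
Qed.

Lemma pr_le0_negligible (A : set T) : measurable A ->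
  (forall e, 0 < e -> pr A <= e) -> P A = 0%E.
Proof.
move=> mA h; rewrite prE//; congr EFin; apply/eqP; rewrite eq_le pr_ge0 andbT.
by apply/ler_addgt0Pr => e e0; rewrite add0r h.
Qed.

(** The maximal inequality bounds the probability of exceeding j by a
constant over j. *)
Lemma superharmonic_ae_bounded (V : rtree -> R) :
  (forall s, 0 <= V s) -> (forall s, step V s <= V s) ->
  {ae P, forall w, exists K : R, forall n, (1 <= n)%N -> V (X n w) <= K}.
Proof.
move=> V0 sV.
pose A := \bigcap_(j : nat) [set w | exists2 k, (1 <= k)%N & j.+1%:R <= V (X k w)].
have mA : measurable A by apply: bigcap_measurable => // j _; exact: measurable_hits.
exists A; split => //; last first.
  move=> w /= h j _; apply: contrapT => hj; apply: h; exists j.+1%:R => n n1.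
  by rewrite leNgt; apply/negP => hn; apply: hj; exists n => //; exact: ltW.
apply: pr_le0_negligible => // e e0.
near \oo => j.
apply: (@le_trans _ _ (pr [set w | exists2 k, (1 <= k)%N & j.+1%:R <= V (X k w)])).
  by apply: le_pr => //; [exact: measurable_hits|move=> w; apply].
apply: (le_trans (pr_hits_le _ V0 sV)) => //.
rewrite ler_pdivrMr// mulrC -ler_pdivrMr// (@le_trans _ _ j%:R)//; last first.
  by rewrite ler_nat.
by near: j; apply: nbhs_infty_ger.
Unshelve. all: by end_near. Qed.

Let C2_ge0 : 0 <= 2 * C. Proof. by rewrite mulr_ge0// exprn_ge0. Qed.

Let osc_term_ge0 s : 0 <= 2 * C * ((N s)^-1 * B s).
Proof.
have b : 0 <= B s by apply: le_trans (exp_depth_ge1 R s).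
have n0 : 0 <= (N s)^-1 by rewrite invr_ge0 ltW// order_gt0.
by apply: mulr_ge0; [exact: C2_ge0|exact: mulr_ge0].
Qed.

Lemma osc_potential_ge0 m s : 0 <= osc_potential m s :> R.
Proof. by apply: addr_ge0; [exact: sqr_ge0|exact: osc_term_ge0]. Qed.

Lemma measurable_oscillation n e : (1 <= n)%N ->
  measurable [set w | exists2 k, (n <= k)%N & e <= `|W (X k w) - W (X n w)|].
Proof.
move=> n1; rewrite (_ : [set w | _] = \bigcup_(k in [set k | (n <= k)%N])
    [set w | e <= `|W (X k w) - W (take n.-1 (X k w))|]).
  apply: bigcup_measurable => k /= nk.
  apply: (measurable_tree hX [set s | e <= `|W s - W (take n.-1 s)|]).
  exact: leq_trans nk.
apply/seteqP; split => w [k kk h]; exists k => //; move: h; rewrite /=.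
  by rewrite (@tree_prefix _ _ _ _ _ hX n k w)// n1.
by rewrite (@tree_prefix _ _ _ _ _ hX n k w)// n1.
Qed.

(** Given X_n the probability is at most [osc_potential] / e^2, which is of
order [exp_depth] / n; averaging over X_n with the superharmonic function
[exp_depth] / sqrt n leaves 1 / sqrt n. *)
Lemma pr_oscillation_le n e : (1 <= n)%N -> 0 < e ->
  pr [set w | exists2 k, (n <= k)%N & e <= `|W (X k w) - W (X n w)|]
  <= 2 * C / e ^+ 2 / Num.sqrt n%:R.
Proof.
move=> n1 e0; set H := [set w | _].
have mH : measurable H by exact: measurable_oscillation.
have q0 : 0 <= 2 * C / e ^+ 2 / Num.sqrt n%:R.
  by apply: divr_ge0 => //; apply: divr_ge0; [exact: C2_ge0|exact: sqr_ge0].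
(* at size n this equals osc_potential / e^2, as sqrt n * sqrt n = n *)
pose V s := (2 * C / e ^+ 2 / Num.sqrt n%:R) * ((Num.sqrt (N s))^-1 * B s).
have sV s : step V s <= V s.
  rewrite /V (@eq_step _ _ (fun s => 0 + (2 * C / e ^+ 2 / Num.sqrt n%:R) * ((Num.sqrt (N s))^-1 * B s) + 0 * 0)).
    by rewrite step_affine mul0r add0r addr0 ler_wpM2l// step_exp_depth_div_sqrt.
  by move=> v; ring.
have hV s : nnodes s = n -> pr (tree_event X n s `&` H) <= V s * pr (tree_event X n s).
  move=> sn.
  have e20 : 0 < e ^+ 2 by rewrite exprn_gt0.
  have := maximal_inequality hX n1 sn e20 (osc_potential_ge0 (W s)) (step_osc_potential (W s)).
  have -> : osc_potential (W s) s / e ^+ 2 = V s.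
    rewrite /osc_potential subrr expr0n/= add0r /V /order sn.
    have s0 : Num.sqrt n%:R != 0 :> R by rewrite gt_eqF// sqrtr_gt0 ltr0n.
    have -> : (n%:R^-1 : R) = (Num.sqrt n%:R)^-1 * (Num.sqrt n%:R)^-1.
      by rewrite -invfM -expr2 sqr_sqrtr.
    by ring.
  apply: le_trans; apply: le_pr.
  - by apply: measurableI => //; exact: (measurable_tree_event hX).
  - by apply: measurableI; [exact: (measurable_tree_event hX)|exact: measurable_hits].
  - move=> w [sw [k nk ek]]; split => //; exists k => //.
    have sw' : X n w = s := sw; rewrite sw' in ek.
    rewrite /osc_potential -[leLHS]addr0; apply: lerD; last exact: osc_term_ge0.
    by rewrite -(real_normK (num_real (_ - _))) lerXn2r// ?nnegrE// ltW.
have := pr_le_superharmonic hX (n1 : 1 <= 1 <= n)%N (erefl : nnodes root_tree = 1%N) mH sV hV.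
rewrite (tree_event1 hX) setTI /real_prob probability_setT/= mulr1.
by rewrite /V exp_depth_root order_root sqrtr1 invr1 !mulr1.
Qed.

Lemma martingale_ae_cauchy :
  {ae P, forall w, forall i : nat, exists2 n, (1 <= n)%N &
    forall k, (n <= k)%N -> `|W (X k w) - W (X n w)| <= i.+1%:R^-1}.
Proof.
pose E n (i : nat) := [set w | exists2 k, (n <= k)%N & i.+1%:R^-1 <= `|W (X k w) - W (X n w)|].
have mE n i : (1 <= n)%N -> measurable (E n i).
  by move=> n1; exact: measurable_oscillation.
pose A i := \bigcap_(n in [set n | (1 <= n)%N]) E n i.
have mA i : measurable (A i) by apply: bigcap_measurable => [|n n1]; [exists 1%N|exact: mE].
have A0 i : P (A i) = 0%E.
    apply: pr_le0_negligible => // e e0.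
    pose K : R := 2 * C / (i.+1%:R^-1) ^+ 2.
    have K0 : 0 <= K by apply: divr_ge0; [exact: C2_ge0|exact: sqr_ge0].
    near \oo => n.
    have n1 : (1 <= n)%N by near: n; exists 1%N.
    apply: (@le_trans _ _ (pr (E n i))).
      by apply: le_pr => //; [exact: mE|move=> w; apply].
    apply: (le_trans (pr_oscillation_le n1 _)); first by rewrite invr_gt0.
    rewrite -/K ler_pdivrMr ?sqrtr_gt0 ?ltr0n// mulrC -ler_pdivrMr//.
    rewrite -(@ler_pXn2r _ 2)// ?nnegrE ?sqrtr_ge0 ?divr_ge0// ?(ltW e0)//.
    rewrite sqr_sqrtr//.
    by near: n; apply: nbhs_infty_ger.
have nA i : P.-negligible (A i) by exists (A i); split.
apply: (negligibleS _ (negligible_bigcup nA)).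
move=> w /= h; apply: contrapT => hw; apply: h => i; apply: contrapT => hi; apply: hw.
  exists i => // n n1; apply: contrapT => hn; apply: hi; exists n => // k nk.
  by rewrite leNgt; apply/negP => hk; apply: hn; exists k => //; exact: ltW.
Unshelve. all: by end_near. Qed.

End almost_sure.

Section paths.
Context (d : measure_display) (T : measurableType d) (R : realType)
  (P : probability T R) (X : nat -> T -> rtree)
  (hX : random_recursive_tree P X).
Local Notation N := (@order R).
Local Notation S := (@var_depth R).
Local Notation B := (@exp_depth R).
Local Notation W := (@depth_martingale R).
Local Notation C := (10 ^+ 4 : R).

Lemma ipl_normalizedE n w : (1 <= n)%N ->
  ipl_normalized R X n w = W (X n w) + harmonic_gap R n.
Proof.
move=> n1; have [sn rt] := tree_valid hX w n1.
rewrite /ipl_normalized /depth_martingale /harmonic_gap iplE// sn.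
rewrite [mean_depth R (X n w)](_ : _ = (sumn (depths (X n w)))%:R / n%:R); last first.
  by rewrite /mean_depth /avg size_depths sn sumnE natr_sum.
have n0 : n%:R != 0 :> R by rewrite pnatr_eq0 -lt0n.
by set s := \sum_(_ <= _ < _) _; field.
Qed.

Lemma var_depth_tree n w : (1 <= n)%N ->
  S (X n w) = comp_var R (X n w) + \sum_(1 <= k < n) drift R (X k w).
Proof.
move=> n1; have [sn _] := tree_valid hX w n1.
rewrite /comp_var; set s' := \sum_(_ <= _ < _) _; set s := \sum_(_ <= _ < _) _.
suff -> : s' = s by ring.
have sz : size (X n w) = n.-1 by rewrite -[in RHS]sn.
rewrite /s big_add1 /s' sz; apply: eq_big_nat => k /andP[_ kn].
by rewrite (@tree_prefix _ _ _ _ _ hX k.+1 n w)//=; lia.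
Qed.

Lemma ln_sum n : (1 <= n)%N ->
  ln n%:R = \sum_(1 <= k < n) (ln k.+1%:R - ln k%:R) :> R.
Proof. by move=> n1; rewrite telescope_sumr// ln1 subr0. Qed.

Lemma drift_close k w (K : R) : (1 <= k)%N -> 0 <= K ->
  B (X k w) <= K * Num.sqrt k%:R ->
  `|drift R (X k w) - (ln k.+1%:R - ln k%:R)| <=
    (2 * k%:R^-1 + 2 * (C * K) * (Num.sqrt k%:R)^-1) -
    (2 * k.+1%:R^-1 + 2 * (C * K) * (Num.sqrt k.+1%:R)^-1).
Proof.
move=> k1 K0 bK.
have k0 : 0 < k%:R :> R by rewrite ltr0n.
have /andP[l1 l2] := @ln_natS_bounds R k k1.
have sq := @sqrt_decr R k k1.
rewrite /drift (order_tree hX)// mulrBl.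
have S0 := var_depth_ge0 R (X k w).
have SB : S (X k w) <= C * (K * Num.sqrt k%:R).
  by rewrite (le_trans (var_depth_le R _))// ler_wpM2l// exprn_ge0.
have kS : k.+1%:R = k%:R + 1 :> R by rewrite natr1.
have q0 : 0 <= (k%:R + 1) ^- 2 :> R by rewrite invr_ge0 exprn_ge0// addr_ge0.
have h1 : S (X k w) * (k%:R + 1) ^- 2 <= 2 * (C * K) * ((Num.sqrt k%:R)^-1 - (Num.sqrt k.+1%:R)^-1).
  apply: (@le_trans _ _ (C * (K * Num.sqrt k%:R) * (k%:R + 1) ^- 2)); first by rewrite ler_wpM2r.
  rewrite [leLHS](_ : _ = C * K * (Num.sqrt k%:R / (k%:R + 1) ^+ 2)); last by ring.
  rewrite [leRHS](_ : _ = C * K * (2 * ((Num.sqrt k%:R)^-1 - (Num.sqrt k.+1%:R)^-1))); last by ring.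
  by rewrite ler_wpM2l// mulr_ge0// exprn_ge0.
have h0 : 0 <= S (X k w) * (k%:R + 1) ^- 2 by rewrite mulr_ge0.
have k0n : k%:R != 0 :> R by rewrite gt_eqF.
have k1n : k%:R + 1 != 0 :> R by rewrite gt_eqF// addr_gt0.
have h2 : k%:R / (k%:R + 1) ^+ 2 <= k.+1%:R^-1 :> R.
  rewrite kS -subr_ge0 [leRHS](_ : _ = (k%:R + 1) ^- 2)//.
  by field.
have h3 : k%:R^-1 - k%:R / (k%:R + 1) ^+ 2 <= 2 * (k%:R^-1 - k.+1%:R^-1) :> R.
  rewrite kS -subr_ge0 [leRHS](_ : _ = k%:R^-1 * (k%:R + 1) ^- 2); last by field; rewrite k0n k1n.
  by rewrite mulr_ge0// invr_ge0 ltW.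
move: l1 l2 sq h0 h1 h2 h3.
move: (ln _ - ln _) (_ * _ ^- 2) (k%:R / _) => L x y.
move: k%:R^-1 k.+1%:R^-1 (Num.sqrt k%:R)^-1 (Num.sqrt k.+1%:R)^-1 => a b u v.
set cK := C * K => l1 l2 sq h0 h1 h2 h3.
rewrite ler_norml; apply/andP; split; lra.
Qed.

(** The variance is a bounded martingale part plus the sum of the drifts,
and the drifts differ from the increments of the logarithm by a summable
sequence. *)
Lemma var_depth_close w (K K' : R) : 0 <= K ->
  (forall n, (1 <= n)%N -> B (X n w) <= K * Num.sqrt n%:R) ->
  (forall n, (1 <= n)%N -> comp_var_potential R (X n w) <= K') ->
  forall n, (1 <= n)%N -> `|S (X n w) - ln n%:R| <= K' + 1 + (2 + 2 * (C * K)).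
Proof.
move=> K0 hB hY n n1.
rewrite var_depth_tree// ln_sum// -addrA -sumrB (le_trans (ler_normD _ _))// lerD//.
  have b : 0 <= B (X n w) by apply: le_trans (exp_depth_ge1 R _).
  have n0 : 0 <= (N (X n w))^-1 by rewrite invr_ge0 ltW// order_gt0.
  have c0 : 0 <= 128 * C by rewrite mulr_ge0// exprn_ge0.
  have := hY n n1; rewrite /comp_var_potential.
  have : 0 <= 128 * C * ((N (X n w))^-1 * B (X n w)) by apply: mulr_ge0 => //; exact: mulr_ge0.
  move: (128 * C * _) => u; rewrite -(real_normK (num_real (comp_var R _))).
  move: `|_| => y u0 yu; have := sqr_ge0 (y - 1 / 2); rewrite sqrrB; lra.
have cK0 : 0 <= 2 * (C * K) by rewrite mulr_ge0// mulr_ge0// exprn_ge0.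
apply: le_trans (sum_telescope_bound (v := fun k => 2 * k%:R^-1 + 2 * (C * K) * (Num.sqrt k%:R)^-1) _ _ _) _.
- by move=> k k1; apply: drift_close => //; exact: hB.
- by move=> k; rewrite addr_ge0// mulr_ge0// invr_ge0 sqrtr_ge0.
- by rewrite invr1 sqrtr1 invr1 !mulr1.
Qed.

(** The two properties of a path under which the conditional laws converge
to the normal law. *)
Lemma ae_regular : {ae P, forall w, exists2 K : R, 0 <= K & forall n, (1 <= n)%N ->
  B (X n w) <= K * Num.sqrt n%:R /\ `|S (X n w) - ln n%:R| <= K}.
Proof.
have h1 : {ae P, forall w, exists K : R, forall n, (1 <= n)%N ->
    (Num.sqrt (N (X n w)))^-1 * B (X n w) <= K}.
  apply: (superharmonic_ae_bounded hX (V := fun s => (Num.sqrt (N s))^-1 * B s)).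
    move=> s; rewrite mulr_ge0 ?invr_ge0 ?sqrtr_ge0// (le_trans _ (exp_depth_ge1 R s))//.
  exact: step_exp_depth_div_sqrt.
have h2 : {ae P, forall w, exists K : R, forall n, (1 <= n)%N ->
    comp_var_potential R (X n w) <= K}.
  apply: (superharmonic_ae_bounded hX (V := comp_var_potential R)).
    move=> s; have b : 0 <= B s by apply: le_trans (exp_depth_ge1 R _).
    have n0 : 0 <= (N s)^-1 by rewrite invr_ge0 ltW// order_gt0.
    have c0 : 0 <= 128 * C by rewrite mulr_ge0// exprn_ge0.
    by apply: addr_ge0; [exact: sqr_ge0|apply: mulr_ge0 => //; exact: mulr_ge0].
  exact: step_comp_var_potential.
apply: filterS2 h1 h2 => w [K1 hK1] [K2 hK2].
have hB n : (1 <= n)%N -> B (X n w) <= `|K1| * Num.sqrt n%:R.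
  move=> n1; have := hK1 n n1; rewrite (order_tree hX)// ler_pdivrMl ?sqrtr_gt0 ?ltr0n//.
  by move=> /le_trans; apply; rewrite mulrC ler_wpM2r ?sqrtr_ge0// ler_norm.
have hS := var_depth_close (normr_ge0 K1) hB hK2.
set K3 := _ + _ in hS.
exists (`|K1| + `|K3|); first by rewrite addr_ge0.
move=> n n1; split.
  by rewrite (le_trans (hB n n1))// ler_wpM2r ?sqrtr_ge0// lerDl.
by rewrite (le_trans (hS n n1))// (le_trans (ler_norm _))// lerDr.
Qed.

(** Both the martingale and the gap between harmonic numbers and logarithms
are Cauchy sequences. *)
Lemma ae_cvg_normalized :
  {ae P, forall w, cvgn (fun n => ipl_normalized R X n w)}.
Proof.
apply: filterS (martingale_ae_cauchy hX) => w hw.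
apply/cauchy_cvgP/cauchy_exP => e e0.
have e40 : 0 < e / 4 by rewrite divr_gt0.
near \oo => i.
have ie : i.+1%:R^-1 <= e / 4 :> R.
  rewrite -[leRHS]invrK lef_pV2 ?posrE ?ltr0n ?invr_gt0//.
  rewrite (@le_trans _ _ i%:R)// ?ler_nat//.
  by near: i; apply: nbhs_infty_ger.
have [n n1 hn] := hw i.
near \oo => m.
have m1 : (1 <= m)%N by near: m; exists 1%N.
have nm : (n <= m)%N by near: m; exists n.
have me : m%:R^-1 <= e / 4 :> R.
  rewrite -[leRHS]invrK lef_pV2 ?posrE ?ltr0n ?invr_gt0//.
  by near: m; apply: nbhs_infty_ger.
exists (ipl_normalized R X m w); exists m => // k /= mk.
have k1 := leq_trans m1 mk.
rewrite /ball/= !ipl_normalizedE//.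
have a := le_trans (hn _ nm) ie; have b := le_trans (hn _ (leq_trans nm mk)) ie.
have /andP[g0 g1] := @harmonic_gap_cauchy R m k (introT andP (conj m1 mk)).
have g2 := le_trans g1 me.
move: a b; rewrite !ler_norml => /andP[a1 a2] /andP[b1 b2].
rewrite ltr_norml; apply/andP; split; lra.
Unshelve. all: by end_near. Qed.

End paths.

(** * Numerical bounds along a regular path *)

Lemma cos_lipschitz (R : realType) (x h : R) : `|cos (x + h) - cos x| <= 2 * `|h|.
Proof.
wlog h0 : x h / 0 <= h.
  move=> H; have [h0|h0] := leP 0 h; first exact: H.
  have := H (x + h) (- h); rewrite oppr_ge0 (ltW h0) normrN => /(_ isT).
  by rewrite addrK distrC.
rewrite (ger0_norm h0) cosD.
have s2 : 0 <= h + sin h.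
  apply: (@derive_ge0_ge0 _ (fun x => x + sin x) (fun x => 1 + cos x)) h0 => [|y _].
  - by rewrite sin0 addr0.
  - by have := cos_geN1 y; lra.
have s1 := sin_le_id h0; have c1 := cos_ge_onem h0; have c2 := cos_le1 h.
rewrite (_ : _ - _ = cos x * (cos h - 1) - sin x * sin h); last by ring.
rewrite (le_trans (ler_normB _ _))// !normrM.
rewrite (_ : 2 * h = 1 * h + 1 * h); last by ring.
apply: lerD; apply: ler_pM => //; rewrite ?cos_max ?sin_max// ler_norml; apply/andP; split; lra.
Qed.

Section rates.
Context (R : realType).
Local Notation C := (10 ^+ 4 : R).
Context (n : nat) (t : rtree) (K : R)
  (K0 : 0 <= K) (tn : nnodes t = n) (ln1 : 1 <= ln n%:R :> R)
  (hB : exp_depth R t <= K * Num.sqrt n%:R)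
  (hS : `|var_depth R t - ln n%:R| <= K).
Let x : R := n%:R.
Let a : R := ln n%:R.
Definition clt_scale (n : nat) : R := Num.sqrt (n%:R / ln n%:R).
Let c := clt_scale n.

Let a0 : 0 < a. Proof. by apply: lt_le_trans ln1. Qed.
Let x0 : 0 < x.
Proof.
rewrite /x ltr0n lt0n; apply/eqP => n0; have := ln1.
by rewrite n0 ln0// ler10.
Qed.
Let ax : a <= x.
Proof.
have := @le_ln1Dx R (x - 1); rewrite ltrBrDl subrr => /(_ x0).
rewrite [1 + _]addrC subrK -/a; lra.
Qed.
Let c0 : 0 <= c. Proof. exact: sqrtr_ge0. Qed.
Let cc : c ^+ 2 = x / a.
Proof. by rewrite sqr_sqrtr// divr_ge0// ltW. Qed.
Let x1 : 1 <= x. Proof. exact: le_trans ax. Qed.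
Let an : a != 0. Proof. by rewrite gt_eqF. Qed.
Let xn : x != 0. Proof. by rewrite gt_eqF. Qed.

(** That is, n log n >= (log n)^2; so the deterministic part of the
normalized path length is negligible at the scale of the limit theorem. *)
Lemma clt_scale_div_le : c / x <= a^-1.
Proof.
have ia : 0 <= a^-1 by rewrite invr_ge0 ltW.
have ix : 0 <= c / x by rewrite divr_ge0// ltW.
rewrite -(@ler_pXn2r _ 2)// ?nnegrE//.
rewrite exprMn cc (_ : x / a * x^-1 ^+ 2 = x^-1 * a^-1); last by field; rewrite xn an.
by rewrite expr2 ler_wpM2r// lef_pV2.
Qed.

Let sqrtx : Num.sqrt x ^+ 2 = x. Proof. by rewrite sqr_sqrtr// ltW. Qed.

Let c_le : c <= Num.sqrt x.
Proof.
rewrite -(@ler_pXn2r _ 2)// ?nnegrE ?sqrtr_ge0//.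
by rewrite cc sqrtx ler_pdivrMr// ler_peMr// ltW.
Qed.

Let Bx : exp_depth R t / x <= K.
Proof.
rewrite ler_pdivrMr//; apply: le_trans hB _; rewrite ler_wpM2l//.
rewrite -(@ler_pXn2r _ 2)// ?nnegrE ?sqrtr_ge0// ?(ltW x0)//.
by rewrite sqrtx expr2 ler_peMr// ltW.
Qed.

Let B0 : 0 <= exp_depth R t. Proof. by apply: le_trans (exp_depth_ge1 R t). Qed.

Let dev_bound : c ^+ 2 * dev_potential a t <= (K ^+ 2 + 4 + 128 * (C * K)) / a.
Proof.
rewrite cc /dev_potential /order tn -/x.
rewrite [leLHS](_ : _ = ((var_depth R t - a) ^+ 2 + 4 + 128 * (C * (exp_depth R t / x))) / a); last first.
  by field; rewrite xn an.
rewrite ler_wpM2r ?invr_ge0 ?(ltW a0)//; apply: lerD.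
  rewrite lerD2r -(real_normK (num_real (_ - _))) lerXn2r ?nnegrE//.
by rewrite ler_wpM2l// ler_wpM2l// exprn_ge0.
Qed.

Lemma tight_bound : c ^+ 2 * tight_potential a (depth_martingale R t) t <=
  2 + (K ^+ 2 + 4 + 128 * (C * K)).
Proof.
have ia : a^-1 <= 1 by rewrite invf_le1.
rewrite /tight_potential subrr expr0n/= add0r mulrDr.
rewrite /order tn -/x (_ : c ^+ 2 * ((a + 1) * x^-1) = 1 + a^-1); last first.
  by rewrite cc; field; rewrite xn an.
apply: lerD; first by rewrite (_ : 2 = 1 + 1)// lerD2l.
apply: (le_trans dev_bound); rewrite ler_piMr// addr_ge0 ?mulr_ge0 ?exprn_ge0//.
by rewrite addr_ge0// exprn_ge0.
Qed.

(** Depends on the path through K only; the errors at time n sum up to at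
most this multiple of 1 / log n. *)
Definition clt_rate (th K : R) : R :=
  17 * `|th| ^+ 3 * (C * K) + th ^+ 2 / 2 * (1 / 2 + (K ^+ 2 + 4 + 128 * (C * K)) + 1)
  + th ^+ 4 / 4 + 2 * `|th|.

Lemma lindeberg_bound (th : R) :
  lindeberg_potential (th * c) a t + 2 * (`|th * c| / x) <= clt_rate th K / a.
Proof.
rewrite /lindeberg_potential /order tn -/x.
have ia0 : 0 <= a^-1 by rewrite invr_ge0 ltW.
have xa : x^-1 <= a^-1 by rewrite lef_pV2.
have C0 : 0 <= C by rewrite exprn_ge0.
have t1 : 17 * `|th * c| ^+ 3 * (C * (x ^- 2 * exp_depth R t)) <=
    17 * `|th| ^+ 3 * (C * K) / a.
  have hh : c ^+ 3 * (x ^- 2 * exp_depth R t) <= K / a.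
    rewrite exprS cc.
    apply: (@le_trans _ _ (Num.sqrt x * (x / a) * (x ^- 2 * (K * Num.sqrt x)))).
      have k1 : 0 <= x / a by rewrite divr_ge0// ltW.
      have k2 : 0 <= x ^- 2 by rewrite invr_ge0 exprn_ge0// ltW.
      apply: ler_pM; [exact: mulr_ge0|exact: mulr_ge0| |]; first by rewrite ler_wpM2r.
      by rewrite ler_wpM2l.
    rewrite [leLHS](_ : _ = Num.sqrt x ^+ 2 * (K / (a * x))); last by field; rewrite xn an.
    by rewrite sqrtx [leLHS](_ : _ = K / a)//; field; rewrite xn an.
  rewrite normrM (ger0_norm c0) exprMn.
  rewrite [leLHS](_ : _ = 17 * `|th| ^+ 3 * C * (c ^+ 3 * (x ^- 2 * exp_depth R t))); last by ring.
  rewrite [leRHS](_ : _ = 17 * `|th| ^+ 3 * C * (K / a)); last by ring.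
  by rewrite ler_wpM2l// mulr_ge0// mulr_ge0// exprn_ge0.
have t2 : (th * c) ^+ 2 / 2 * (2^-1 * x^-1 + dev_potential a t + a * x ^- 2) <=
    th ^+ 2 / 2 * (1 / 2 + (K ^+ 2 + 4 + 128 * (C * K)) + 1) / a.
  rewrite [leLHS](_ : _ = th ^+ 2 / 2 *
    (1 / 2 * (c ^+ 2 / x) + c ^+ 2 * dev_potential a t + c ^+ 2 / x * a / x)); last by field.
  have -> : c ^+ 2 / x = a^-1 by rewrite cc; field; rewrite xn an.
  rewrite mulVf//.
  rewrite [leRHS](_ : _ = th ^+ 2 / 2 *
    (1 / 2 * a^-1 + (K ^+ 2 + 4 + 128 * (C * K)) / a + a^-1)); last by ring.
  apply: ler_wpM2l; first by apply: divr_ge0 => //; exact: sqr_ge0.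
  by apply: lerD; [apply: lerD => //; exact: dev_bound|rewrite mul1r].
have t3 : (th * c) ^+ 4 * a ^+ 2 / 4 * x ^- 3 <= th ^+ 4 / 4 / a.
  rewrite [leLHS](_ : _ = th ^+ 4 / 4 * x^-1); last first.
    rewrite exprMn (_ : c ^+ 4 = (c ^+ 2) ^+ 2); last by rewrite -exprM.
    by rewrite cc; field; rewrite xn an.
  by rewrite ler_wpM2l// divr_ge0// exprn_even_ge0.
have t4 : 2 * (`|th * c| / x) <= 2 * `|th| / a.
  rewrite normrM (ger0_norm c0) -!mulrA ler_wpM2l// ler_wpM2l//.
  exact: clt_scale_div_le.
rewrite /clt_rate; move: t1 t2 t3 t4; set u1 := _ * _ / a; set u2 := _ / a.
set u3 := _ / a; set u4 := _ / a => t1 t2 t3 t4.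
rewrite [leRHS](_ : _ = u1 + u2 + u3 + u4); last by rewrite /u1 /u2 /u3 /u4; ring.
by do 3 (apply: lerD => //).
Qed.

End rates.

(** * The limit theorem *)

Section limit_theorem.
Context (d : measure_display) (T : measurableType d) (R : realType)
  (P : probability T R) (X : nat -> T -> rtree)
  (hX : random_recursive_tree P X).
Local Notation pr := (real_prob P).
Local Notation W := (@depth_martingale R).
Local Notation norm_ipl n := (ipl_normalized R X n).

Lemma measurable_ipl_normalized n : measurable_fun setT (norm_ipl n).
Proof.
case: n => [|n].
  rewrite (_ : norm_ipl 0 = fun=> 0); first exact: measurable_cst.
  by apply/funext => w; rewrite /ipl_normalized invr0 mulr0.
exact: (measurable_tree_fun hX (fun t => ((ipl t)%:R - n.+1%:R * ln n.+1%:R) / n.+1%:R : R)).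
Qed.

(** The upper limit is a measurable function on the whole space; it is the
limit wherever there is convergence. *)
Lemma ipl_limit_exists : exists L : {RV P >-> R}, ipl_limit P X L.
Proof.
pose l w := limn_esup (fun n => (norm_ipl n w)%:E).
have ml : measurable_fun setT (fun w => fine (l w)).
  apply: measurableT_comp => //.
  apply: measurable_fun_limn_esup => n.
  by apply/measurable_EFinP; exact: measurable_ipl_normalized.
pose L : {mfun T >-> R} := HB.pack (fun w => fine (l w)) (isMeasurableFun.Build _ _ _ _ (fun w => fine (l w)) ml).
exists L; apply: filterS (ae_cvg_normalized hX) => w cw.
have cE : (norm_ipl n w)%:E @[n --> \oo] --> (limn (fun n => norm_ipl n w))%:E.
  apply: cvg_EFin; first exact: nearW.
  exact: cw.
rewrite /= /l (cvg_limn_einf_sup cE).2 /=.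
exact: cw.
Qed.

Section fixed_limit.
Context (L : T -> R) (mL : measurable_fun setT L) (hL : ipl_limit P X L).

Let Z n w := clt_scale R n * (L w - norm_ipl n w).

Let measurable_Z n : measurable_fun setT (Z n).
Proof.
apply: measurable_funM => //; apply: measurable_funB => //.
exact: measurable_ipl_normalized.
Qed.

(** Dominated convergence; the limit variable is only an almost sure
limit. *)
Lemma cvg_tree_event_cos n t (th be : R) : (1 <= n)%N ->
  \int[P]_(w in tree_event X n t)
     cos (th * (clt_scale R n * (norm_ipl m w - norm_ipl n w)) + be) @[m --> \oo] -->
  \int[P]_(w in tree_event X n t) cos (th * Z n w + be).
Proof.
move=> n1; set c := clt_scale R n.
have mH := measurable_tree_event hX t n1.
have mc (h : T -> R) : measurable_fun setT h ->
    measurable_fun setT (fun w => cos (th * h w + be)).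
  move=> mh; apply: (@measurableT_comp _ _ _ _ _ _ (fun x : R => cos (th * x + be))) => //.
  exact: measurable_cos_affine.
have mf m : measurable_fun setT (fun w => cos (th * (c * (norm_ipl m w - norm_ipl n w)) + be)).
  apply: (mc (fun w => c * (norm_ipl m w - norm_ipl n w))).
  by apply: measurable_funM => //; apply: measurable_funB => //; exact: measurable_ipl_normalized.
have mZ : measurable_fun setT (fun w => cos (th * Z n w + be)) by exact: (mc (Z n)).
have iP (f : T -> R) : measurable_fun setT f -> (forall w, `|f w| <= 1) ->
    P.-integrable (tree_event X n t) (EFin \o f).
  move=> mf' bf; apply: (@bounded_fun_integrable _ _ _ _ _ _ 1) => //.
    exact: (P_tree_event_lty hX).
  exact: measurable_funTS.
pose f_ m w := (cos (th * (c * (norm_ipl m w - norm_ipl n w)) + be))%:E.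
pose f w := (cos (th * Z n w + be))%:E.
have A1 m : measurable_fun (tree_event X n t) (f_ m).
  by apply/measurable_EFinP; exact: measurable_funTS.
have A2 : measurable_fun (tree_event X n t) f.
  by apply/measurable_EFinP; exact: measurable_funTS.
have A3 : {ae P, forall w, tree_event X n t w -> f_ ^~ w @ \oo --> f w}.
  apply: filterS hL => w cw _.
  apply: cvg_EFin; first exact: nearW.
  rewrite /f_ /f /comp /=.
  apply: (@continuous_cvg _ _ _ _ _ _ (fun x : R => cos (th * (c * (x - norm_ipl n w)) + be))
    (L w)) => //.
  apply: continuous_comp; last exact: continuous_cos.
  apply: cvgD; last exact: cvg_cst.
  apply: cvgM; first exact: cvg_cst.
  apply: cvgM; first exact: cvg_cst.
  by apply: cvgB; [exact: cvg_id|exact: cvg_cst].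
have A4 : P.-integrable (tree_event X n t) (cst 1%E).
  by apply: (iP (fun=> 1)) => // w; rewrite normr1.
have A5 : {ae P, forall w m, tree_event X n t w -> (`|f_ m w| <= cst 1%E w)%E}.
  by apply: aeW => w m _; rewrite lee_fin cos_max.
have [_ _ cv] := dominated_convergence mH A1 A2 A3 A4 A5.
apply: (@fine_cvg _ _ _ _ (fun m => \int[P]_(x in tree_event X n t) f_ m x)%E).
rewrite /Rintegral fineK; first exact: cv.
apply: integrable_fin_num => //; apply: (iP (fun w => cos (th * Z n w + be))) => //.
by move=> w; exact: cos_max.
Qed.

Let clt_scale_sqr n : 1 <= ln n%:R :> R ->
  clt_scale R n ^+ 2 * ln n%:R = n%:R /\ 0 <= clt_scale R n.
Proof.
move=> a1; have a0 : 0 < ln n%:R :> R by apply: lt_le_trans a1.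
split; last exact: sqrtr_ge0.
rewrite sqr_sqrtr ?divr_ge0 ?(ltW a0)//.
by rewrite divfK// gt_eqF.
Qed.

(** At a finite time m the cosine differs from [char_wave] by the
contribution of the deterministic part, at most 2 |theta c_n| / n, and by that
of the remaining variance n / m, which vanishes as m grows. *)
Lemma finite_horizon_bound n m w (th be : R) : (1 <= n <= m)%N -> 1 <= ln n%:R :> R ->
  `|\int[P]_(w in tree_event X n (X n w))
     cos (th * (clt_scale R n * (norm_ipl m w - norm_ipl n w)) + be)
    - expR (- (th ^+ 2) / 2) * cos be * pr (tree_event X n (X n w))| <=
  (lindeberg_potential (th * clt_scale R n) (ln n%:R) (X n w)
    + 2 * (`|th * clt_scale R n| / n%:R) + th ^+ 2 * n%:R / 2 / m%:R)
   * pr (tree_event X n (X n w)).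
Proof.
move=> /andP[n1 nm] a1; set om := th * clt_scale R n; set t := X n w.
set H := tree_event X n t; set a := ln n%:R in a1 *.
have [ca c0] := clt_scale_sqr a1; rewrite -/a in ca.
have a0 : 0 <= a by apply: le_trans a1.
have mH := measurable_tree_event hX t n1.
have [tn _] := tree_valid hX w n1; rewrite -/t in tn.
have m1 := leq_trans n1 nm.
have n0 : n%:R != 0 :> R by rewrite pnatr_eq0 -lt0n.
have m0 : 0 < m%:R :> R by rewrite ltr0n.
pose F := char_wave om a (W t) be.
have F1 s : `|F s| <= 1.
  rewrite normrM -[leRHS]mulr1; apply: ler_pM => //; last exact: cos_max.
  rewrite ger0_norm ?expR_ge0// -expR0 ler_expR oppr_le0.
  by rewrite mulr_ge0 ?invr_ge0 ?(ltW (order_gt0 _ _))// divr_ge0// mulr_ge0// sqr_ge0.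
have V0 s : 0 <= lindeberg_potential om a s.
  have b : 0 <= exp_depth R s by apply: le_trans (exp_depth_ge1 R s).
  have k0 : 0 <= (order R s)^-1 by rewrite invr_ge0 ltW// order_gt0.
  have k2 : 0 <= order R s ^- 2 by rewrite -exprVn exprn_ge0.
  have k3 : 0 <= order R s ^- 3 by rewrite -exprVn exprn_ge0.
  have cc : 0 <= 10 ^+ 4 :> R by rewrite exprn_ge0.
  have dv := dev_potential_ge0 a s.
  apply: addr_ge0; [apply: addr_ge0|].
  - by apply: mulr_ge0; [rewrite mulr_ge0// exprn_ge0|apply: mulr_ge0 => //; exact: mulr_ge0].
  - apply: mulr_ge0; first by apply: divr_ge0 => //; exact: sqr_ge0.
    by rewrite addr_ge0 ?mulr_ge0// addr_ge0 ?mulr_ge0.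
  - by apply: mulr_ge0 => //; apply: divr_ge0 => //; apply: mulr_ge0; rewrite exprn_even_ge0.
have := Rintegral_superharmonic hX (m - n) n1 tn F1 V0 (fun s => step_char_wave om (W t) be s a0).
rewrite subnKC// -/H.
have -> : F t = expR (- (th ^+ 2) / 2) * cos be.
  rewrite /F /char_wave subrr mulr0 add0r /order tn; congr (expR _ * _).
  rewrite /om exprMn.
  rewrite (_ : th ^+ 2 * clt_scale R n ^+ 2 * a = th ^+ 2 * n%:R); last by rewrite -ca; ring.
  by field.
have iH (f : T -> R) : measurable_fun setT f -> (forall w, `|f w| <= 1) ->
    P.-integrable H (EFin \o f).
  move=> mf' bf; apply: (@bounded_fun_integrable _ _ _ _ _ _ 1) => //.
    exact: (P_tree_event_lty hX).
  exact: measurable_funTS.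
pose G w' := cos (th * (clt_scale R n * (norm_ipl m w' - norm_ipl n w')) + be).
have mG : measurable_fun setT G.
  apply: (@measurableT_comp _ _ _ _ _ _ (fun x : R => cos (th * x + be))).
    exact: measurable_cos_affine.
  by apply: measurable_funM => //; apply: measurable_funB => //; exact: measurable_ipl_normalized.
have mF : measurable_fun setT (fun w' => F (X m w')) by exact: (measurable_tree_fun hX F m1).
have iG := iH _ mG (fun w' => cos_max _).
have iF := iH _ mF (fun w' => F1 _).
have : `|\int[P]_(w' in H) G w' - \int[P]_(w' in H) F (X m w')| <=
    (2 * (`|om| / n%:R) + th ^+ 2 * n%:R / 2 / m%:R) * pr H.
  rewrite -RintegralB//; apply: (le_trans (le_normr_Rintegral _ _)) => //.
    exact: (integrableB mH iG iF).
  rewrite -[pr H]/(fine (P H)) -Rintegral_cst//.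
  have mD : measurable_fun setT (fun w' => `|G w' - F (X m w')|).
    by apply: measurableT_comp => //; exact: measurable_funB.
  apply: le_Rintegral => //.
  + apply: (@bounded_fun_integrable _ _ _ _ _ _ 2) => //.
    * exact: (P_tree_event_lty hX).
    * exact: measurable_funTS.
    * move=> w'; rewrite normr_id (le_trans (ler_normB _ _))// (_ : 2 = 1 + 1)//.
      by rewrite lerD//; exact: cos_max.
  + set D := _ + _; apply: (@bounded_fun_integrable _ _ _ _ _ _ `|D|) => //.
    exact: (P_tree_event_lty hX).
  move=> w' hw'; have {}hw' : X n w' = t := hw'.
  rewrite /G /F /char_wave (order_tree hX)//.
  rewrite !(ipl_normalizedE hX)// hw'.
  set u := om * (W (X m w') - W t) + be.
  set gap := harmonic_gap R m - harmonic_gap R n.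
  rewrite (_ : th * _ + be = u + om * gap); last by rewrite /u /om /gap; ring.
  set E := expR _.
  rewrite (_ : _ - _ = (cos (u + om * gap) - cos u) + (1 - E) * cos u); last by ring.
  rewrite (le_trans (ler_normD _ _))//; apply: lerD.
    rewrite (le_trans (cos_lipschitz _ _))// ler_wpM2l// normrM ler_wpM2l//.
    have /andP[g0 g1] := @harmonic_gap_cauchy R n m (introT andP (conj n1 nm)).
    by rewrite /gap distrC ger0_norm.
  rewrite normrM (le_trans (ler_piMr _ (cos_max _)))//.
  have s0 : 0 <= om ^+ 2 * a / 2 * m%:R^-1.
    by rewrite mulr_ge0 ?invr_ge0// divr_ge0// mulr_ge0// sqr_ge0.
  have sE : om ^+ 2 * a / 2 * m%:R^-1 = th ^+ 2 * n%:R / 2 / m%:R.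
    by rewrite -ca /om -/a; ring.
  rewrite -sE ger0_norm.
    by have := expR_ge1Dx (- (om ^+ 2 * a / 2 * m%:R^-1)); rewrite -/E; lra.
  by rewrite subr_ge0 -expR0 ler_expR oppr_le0.
rewrite -/G; set I1 := \int[P]_(w' in H) G w'; set I2 := \int[P]_(w' in H) F (X m w').
set p := pr H; set e := _ * cos be => h1 h2.
rewrite (_ : I1 - e * p = (I1 - I2) + (I2 - e * p)); last by ring.
rewrite (le_trans (ler_normD _ _))//.
rewrite [leRHS](_ : _ = (2 * (`|om| / n%:R) + th ^+ 2 * n%:R / 2 / m%:R) * p +
  lindeberg_potential om a t * p); last by ring.
exact: lerD.
Qed.

Lemma kernel_cos_bound n w (th be : R)
    (k : R.-pker (g_sigma_algebraType (history X n)) ~> (measurableTypeR R)) :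
  (1 <= n)%N -> 1 <= ln n%:R :> R -> regular_cond_distribution P (Z n) k ->
  `|\int[k w]_x cos (th * x + be) - expR (- (th ^+ 2) / 2) * cos be| <=
  lindeberg_potential (th * clt_scale R n) (ln n%:R) (X n w)
    + 2 * (`|th * clt_scale R n| / n%:R).
Proof.
move=> n1 a1 hk; set t := X n w; set e := _ * cos be.
set D := lindeberg_potential _ _ _ + _.
have mH := measurable_tree_event hX t n1.
have p0 : 0 < pr (tree_event X n t) by exact: (pr_tree_event_gt0 hX).
have kE := Rintegral_restricted_pushforward mH (measurable_Z n) (ltW p0)
  (kernel_tree_event hX n1 hk w) (prob_kernel w) (prE P mH) (measurable_cos_affine th be)
  (fun x => cos_max _).
rewrite -(ler_pM2r p0) -[X in _ * X <= _](ger0_norm (ltW p0)) -normrM mulrBl kE.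
apply/ler_addgt0Pr => eps eps0.
have eps20 : 0 < eps / 2 by rewrite divr_gt0.
have /cvgrPdist_le/(_ _ eps20) cv := @cvg_tree_event_cos n t th be n1.
near \oo => m.
have nm : (n <= m)%N by near: m; exists n.
have m0 : 0 < m%:R :> R by rewrite ltr0n (leq_trans n1).
have h1 : `|\int[P]_(x in tree_event X n t) cos (th * Z n x + be) -
  \int[P]_(w0 in tree_event X n t) cos (th * (clt_scale R n * (norm_ipl m w0 - norm_ipl n w0)) + be)| <= eps / 2.
  by near: m.
have h2 := @finite_horizon_bound n m w th be (introT andP (conj n1 nm)) a1.
rewrite -/t -/D -/e in h2.
have h3 : th ^+ 2 * n%:R / 2 / m%:R * pr (tree_event X n t) <= eps / 2.
  rewrite mulrAC ler_pdivrMr// [leRHS]mulrC -ler_pdivrMr//.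
  by near: m; apply: nbhs_infty_ger.
set J := \int[P]_(x in tree_event X n t) cos (th * Z n x + be) in h1 *.
set I1 := \int[P]_(w0 in tree_event X n t) cos _ in h1 h2.
rewrite (_ : J - _ = (J - I1) + (I1 - e * pr (tree_event X n t))); last by ring.
rewrite (le_trans (ler_normD _ _))//.
rewrite mulrDl in h2.
lra.
Unshelve. all: by end_near. Qed.

Lemma tight_potential_ge0 a m s : 0 <= a -> 0 <= tight_potential a m s :> R.
Proof.
move=> a0; have n0 : 0 <= (order R s)^-1 by rewrite invr_ge0 ltW// order_gt0.
have dv := dev_potential_ge0 a s.
apply: addr_ge0; first exact: sqr_ge0.
by rewrite addr_ge0// mulr_ge0// addr_ge0.
Qed.

(** If the rescaled limit exceeds K, then at some finite time the rescaled
martingale has moved by more than K - 1, the 1 accounting for the deterministic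
part; the maximal inequality for [tight_potential] applies. *)
Lemma kernel_tail_bound n w (K : R)
    (k : R.-pker (g_sigma_algebraType (history X n)) ~> (measurableTypeR R)) :
  (1 <= n)%N -> 1 <= ln n%:R :> R -> regular_cond_distribution P (Z n) k -> 1 < K ->
  (k w (tail_set K) <=
    (clt_scale R n ^+ 2 * tight_potential (ln n%:R) (W (X n w)) (X n w) / (K - 1) ^+ 2)%:E)%E.
Proof.
move=> n1 a1 hk K1; set t := X n w; set a := ln n%:R in a1 *; set c := clt_scale R n.
have [ca c0] := clt_scale_sqr a1; rewrite -/a -/c in ca c0.
have a0 : 0 < a by apply: lt_le_trans a1.
have n0 : 0 < n%:R :> R by rewrite ltr0n.
have cgt0 : 0 < c.
  rewrite lt_neqAle c0 andbT; apply/eqP => c00; move: ca; rewrite -c00 expr0n/= mul0r.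
  by move=> /esym/eqP; rewrite gt_eqF.
have cn : c / n%:R <= 1.
  rewrite ler_pdivrMr// mul1r -(@ler_pXn2r _ 2)// ?nnegrE//.
  have n1R : 1 <= n%:R :> R by rewrite ler1n.
  apply: (@le_trans _ _ n%:R); last by rewrite expr2 ler_peMr.
  by rewrite -ca ler_peMr// exprn_ge0.
have mH := measurable_tree_event hX t n1.
have [tn _] := tree_valid hX w n1; rewrite -/t in tn.
have p0 : 0 < pr (tree_event X n t) by exact: (pr_tree_event_gt0 hX).
have mA := @measurable_tail_set R K.
have kE := kernel_tree_event hX n1 hk w mA.
rewrite -/t in kE.
pose lam := ((K - 1) / c) ^+ 2.
have K10 : 0 < K - 1 by rewrite subr_gt0.
have l0 : 0 < lam by rewrite exprn_gt0// divr_gt0.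
have V0 s := tight_potential_ge0 (W t) s (ltW a0).
have hmax := maximal_inequality hX n1 tn l0 V0 (fun s => step_tight_potential (W t) s (ltW a0)).
set hits := [set w | _] in hmax.
have mhits : measurable hits by exact: (measurable_hits hX).
have sub : (P (tree_event X n t `&` Z n @^-1` tail_set K) <= P (tree_event X n t `&` hits))%E.
  have [M [mM M0 subM]] := hL.
  have mHh := measurableI _ _ mH mhits.
  rewrite -(measureU0 mHh mM M0).
  apply: le_measure; rewrite ?inE.
  - by apply: measurableI => //; rewrite -[X in measurable X]setTI; exact: measurable_Z.
  - exact: measurableU.
  move=> w' [hw' /= tw']; have [|nM] := pselect (M w'); first by right.
  left; split => //.
  have cw : norm_ipl m w' @[m --> \oo] --> L w' by apply: contrapT => h; apply: nM; exact: subM.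
  rewrite /tail_set/= /Z normrM (ger0_norm c0) mulrC -ltr_pdivrMr// in tw'.
  have gap0 : 0 < `|L w' - norm_ipl n w'| - K / c by rewrite subr_gt0.
  move/cvgrPdist_lt : cw => /(_ _ gap0) cw.
  near \oo => m.
  have nm : (n <= m)%N by near: m; exists n.
  have m1 := leq_trans n1 nm.
  have hm : `|L w' - norm_ipl m w'| < `|L w' - norm_ipl n w'| - K / c by near: m.
  exists m => //.
  have h2 : K / c < `|norm_ipl m w' - norm_ipl n w'|.
    have := ler_distD (norm_ipl m w') (L w') (norm_ipl n w'); lra.
  have tw : X n w' = t := hw'.
  rewrite !(ipl_normalizedE hX)// tw in h2.
  have /andP[g0 g1] := @harmonic_gap_cauchy R n m (introT andP (conj n1 nm)).
  have h3 : (K - 1) / c <= `|W (X m w') - W t|.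
    have : `|W (X m w') + harmonic_gap R m - (W t + harmonic_gap R n)| <=
       `|W (X m w') - W t| + n%:R^-1.
      rewrite (_ : _ - _ = (W (X m w') - W t) - (harmonic_gap R n - harmonic_gap R m)); last by ring.
      by rewrite (le_trans (ler_normB _ _))// lerD2l ger0_norm.
    have : n%:R^-1 <= c^-1 by rewrite lef_pV2// -(mul1r n%:R) -ler_pdivrMr.
    rewrite mulrBl mul1r; lra.
  rewrite /tight_potential -[leLHS]addr0; apply: lerD; last first.
    have dv := dev_potential_ge0 a (X m w').
    have no : 0 <= (order R (X m w'))^-1 by rewrite invr_ge0 ltW// order_gt0.
    by rewrite addr_ge0// mulr_ge0// addr_ge0// ltW.
  rewrite -[leRHS](real_normK (num_real _)) lerXn2r// ?nnegrE//.
  by rewrite divr_ge0// ltW.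
have kfin : k w (tail_set K) \is a fin_num.
  rewrite ge0_fin_numE//; apply: (@le_lt_trans _ _ 1%E); last exact: ltry.
  by rewrite -(prob_kernel (s := k) w); apply: le_measure; rewrite ?inE.
move: kE sub; rewrite -(fineK kfin) => kE sub.
rewrite -kE (prE P (measurableI _ _ mH mhits)) -EFinM lee_fin in sub.
rewrite lee_fin.
have := le_trans sub hmax; rewrite ler_pM2r// => /le_trans; apply.
rewrite /lam [leLHS](_ : _ = c ^+ 2 * tight_potential a (W t) t / (K - 1) ^+ 2)//.
by field; rewrite !gt_eqF.
Unshelve. all: by end_near. Qed.

Lemma ln_nat_large (A : R) : \forall n \near \oo, A <= ln n%:R :> R.
Proof.
near=> n; rewrite -[leLHS]expRK ler_ln ?posrE ?expR_gt0//.
  by near: n; apply: nbhs_infty_ger.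
by rewrite ltr0n; near: n; exists 1%N.
Unshelve. all: by end_near. Qed.

(** On a regular path the errors in the trigonometric integrals are
O(1 / log n), and the tail beyond 1 + q is at most D / q^2. *)
Lemma kernel_weak_cvg w (K : R)
    (k : forall n, R.-pker (g_sigma_algebraType (history X n)) ~> (measurableTypeR R)) :
  (forall n, (2 <= n)%N -> regular_cond_distribution P (Z n) (k n)) -> 0 <= K ->
  (forall n, (1 <= n)%N -> exp_depth R (X n w) <= K * Num.sqrt n%:R /\
    `|var_depth R (X n w) - ln n%:R| <= K) ->
  weak_cvg (fun n => k n w) (normal_prob 0 1).
Proof.
move=> hk K0 hw; apply: weak_cvg_of_cos.
- by move=> n; exact: prob_kernel.
- exact: probability_setT.
- move=> th be; rewrite normal_cos; apply/cvgrPdist_le => e e0.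
  near=> n.
  have n2 : (2 <= n)%N by near: n; exists 2%N.
  have n1 : (1 <= n)%N by exact: ltnW.
  have a1 : 1 <= ln n%:R :> R by near: n; exact: ln_nat_large.
  have [tn _] := tree_valid hX w n1; have [hB hS] := hw n n1.
  rewrite distrC (le_trans (kernel_cos_bound w th be n1 a1 (hk n n2)))//.
  rewrite (le_trans (lindeberg_bound K0 tn a1 hB hS th))//.
  rewrite ler_pdivrMr; last exact: lt_le_trans a1.
  rewrite mulrC -ler_pdivrMr//; near: n; exact: ln_nat_large.
- move=> e e0; pose D := 2 + (K ^+ 2 + 4 + 128 * (10 ^+ 4 * K)).
  have D0 : 0 <= D.
    by rewrite addr_ge0// addr_ge0 ?mulr_ge0 ?exprn_ge0// addr_ge0// exprn_ge0.
  (* the summand 1 makes q positive when D = 0 *)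
  pose q := Num.sqrt (D / e + 1).
  have q2 : q ^+ 2 = D / e + 1 by rewrite sqr_sqrtr// addr_ge0// divr_ge0// ltW.
  have q0 : 0 < q by rewrite sqrtr_gt0 ltr_wpDl// divr_ge0// ltW.
  exists (1 + q); near=> n.
  have n2 : (2 <= n)%N by near: n; exists 2%N.
  have n1 : (1 <= n)%N by exact: ltnW.
  have a1 : 1 <= ln n%:R :> R by near: n; exact: ln_nat_large.
  have [tn _] := tree_valid hX w n1; have [hB hS] := hw n n1.
  have q1 : 1 < 1 + q by rewrite ltrDl.
  apply: (le_trans (kernel_tail_bound w n1 a1 (hk n n2) q1)).
  rewrite lee_fin [1 + q]addrC addrK q2.
  have De : 0 < D / e + 1 by rewrite -q2 exprn_gt0.
  rewrite ler_pdivrMr// (le_trans (tight_bound K0 tn a1 hB hS))// -/D.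
  by rewrite mulrDr mulr1 mulrCA divff ?mulr1 ?lerDl ?(ltW e0)// gt_eqF.
Unshelve. all: by end_near. Qed.

End fixed_limit.
End limit_theorem.

Theorem mainTheorem4 (d : measure_display) (T : measurableType d)
    (R : realType) (P : probability T R) (X : nat -> T -> rtree)
    (hX : random_recursive_tree P X) :
  (exists L : {RV P >-> R}, ipl_limit P X L) /\
  forall L : {RV P >-> R}, ipl_limit P X L ->
  forall k : forall n : nat,
      R.-pker (g_sigma_algebraType (history X n)) ~> (measurableTypeR R),
    (forall n, (2 <= n)%N ->
       regular_cond_distribution P
         (fun w => Num.sqrt (n%:R / ln n%:R) * (L w - ipl_normalized R X n w))
         (k n)) ->
  {ae P, forall w, weak_cvg (fun n => k n w) (normal_prob 0 1)}.
Proof.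
split; first exact: ipl_limit_exists.
move=> L hL k hk; apply: filterS (ae_regular hX) => w [K K0 hw].
exact: (kernel_weak_cvg hX (measurable_funP L) hL hk K0 hw).
Qed.
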